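(* There exist a compact $C^\infty$ Riemannian manifold $N$ of dimension $4$ and a harmonic map $f\colon B^3\to N$ such that $f$ has an isolated singularity at $0$ and a continuum of distinct tangent maps at $0$.
   Context: $B^3$ is the unit ball centered at the origin in $\mathbb{R}^3$ with the Euclidean metric. A compact Riemannian manifold $N$ is regarded, via the Nash embedding theorem, as an isometrically embedded submanifold of some Euclidean space $\mathbb{R}^d$. For a measurable map $f\colon\Omega\to\mathbb{R}^d$ (with $\Omega$ the domain, here $\Omega=B^3$) such that $f(x)\in N$ for almost every $x$ and whose distributional first derivative is square integrable, the energy is $E(f)=\int_\Omega |Df|^2$. Harmonic map: a finite energy map $f\colon\Omega\to N$ that is smooth except at a finite set of discontinuities is called harmonic if it satisfies the Euler-Lagrange partial differential equations for the energy functional (so $f$ is a critical point of the energy, not necessarily a minimizer). Isolated singularity at $0$: $f$ is discontinuous at $0$ (and cannot be made continuous there by redefining its value at $0$), and $f$ is smooth on a punctured neighborhood of $0$. Tangent map: a tangent map to $f$ at a point $x$ is a map $f_\infty\colon\mathbb{R}^3\to N$, constant on rays through the origin, that arises as a weak limit (weakly in $W^{1,2}_{\mathrm{loc}}$) of the maps $y\mapsto f(x+r_i y)$ for some sequence of positive numbers $r_i\to 0$. ''A continuum of distinct tangent maps'' means that the set of tangent maps to $f$ at $0$ has the cardinality of the continuum. *)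

(* Defs.v *)
From HB Require Import structures.
From mathcomp Require Import all_boot all_order all_algebra.
From mathcomp Require Import all_classical all_reals all_analysis.

Set Implicit Arguments.
Unset Strict Implicit.
Unset Printing Implicit Defensive.

Import Order.TTheory GRing.Theory Num.Theory.
Import numFieldNormedType.Exports.

Local Open Scope classical_set_scope.
Local Open Scope ring_scope.

(* On an open set [U] of a finite-dimensional space this is C^k regularity. *)
Fixpoint Ck (R : realType) (V W : normedModType R) (k : nat) (U : set V)
    (f : V -> W) : Prop :=
  match k with
  | 0 => forall x, U x -> {for x, continuous f}
  | k'.+1 => (forall x, U x -> differentiable f x) /\
             (forall v, Ck k' U ('D_v f))
  end.

Definition smooth_on (R : realType) (V W : normedModType R) (U : set V)
    (f : V -> W) : Prop := forall k, Ck k U f.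

Definition dotv (R : realType) (d : nat) (u v : 'rV[R]_d) : R :=
  \sum_(j < d) u 0 j * v 0 j.

(* [N] is an [m]-dimensional embedded C^oo submanifold without boundary of R^d:
   near each of its points it is the zero set of a submersion into R^(d - m).
   It carries the Riemannian metric induced by the Euclidean inner product. *)
Definition submanifold (R : realType) (d m : nat) (N : set 'rV[R]_d) : Prop :=
  exists2 k : nat, (m + k = d)%N &
  forall p, N p -> exists (U : set 'rV[R]_d) (G : 'rV[R]_d -> 'rV[R]_k),
    [/\ open U, U p, smooth_on U G,
        (forall q, U q -> forall w, exists v, 'd G q v = w) &
        N `&` U = [set q | U q /\ G q = 0]].

(* The tangent space of [N] at [p], as the set of velocities of smooth curves
   in [N] through [p]. *)
Definition tangent_space (R : realType) (d : nat) (N : set 'rV[R]_d)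
    (p : 'rV[R]_d) : set 'rV[R]_d :=
  [set v : 'rV[R]_d | exists (e : R) (c : R -> 'rV[R]_d),
     [/\ 0 < e, smooth_on [set t | `|t| < e] c,
         (forall t, `|t| < e -> N (c t)), c 0 = p & derive1 c 0 = v]].

(* Points of R^3 are triples, so that R^3 has both the normed-module structure
   and the product measurable structure of the library. The library norm on
   products is the sup norm; [enorm] is the Euclidean one. *)
Notation R3 R := (R * R * R)%type.

Definition e3 (R : realType) (i : 'I_3) : R3 R :=
  ((i == 0 :> nat)%:R, (i == 1 :> nat)%:R, (i == 2 :> nat)%:R).

Definition enorm (R : realType) (x : R3 R) : R :=
  Num.sqrt (x.1.1 ^+ 2 + x.1.2 ^+ 2 + x.2 ^+ 2).

Definition eball (R : realType) (r : R) : set (R3 R) := [set x | enorm x < r].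

(* R^3 with the measurable structure on which [leb3] is a measure: [Real.sort R]
   and [measurableTypeR R] have the same (Borel) measurable sets but distinct
   displays. *)
Notation mR3 R :=
  (measurableTypeR R * measurableTypeR R * measurableTypeR R)%type
  (only parsing).

(* A notation rather than a definition, so that canonical structures of product
   measures are found on it. *)
Notation leb3 R :=
  ((@lebesgue_measure R \x @lebesgue_measure R) \x @lebesgue_measure R)%E
  (only parsing).

Section energy_space.
Variables (R : realType) (d : nat).
Implicit Types (U : set (R3 R)) (f g : R3 R -> 'rV[R]_d)
  (Df Dg : 'I_3 -> R3 R -> 'rV[R]_d).

Definition test_function U (phi : R3 R -> R) : Prop :=
  smooth_on setT phi /\
  exists2 K : set (R3 R), compact K /\ K `<=` U &
    forall x, ~ K x -> phi x = 0.

Definition vmeasurable U f : Prop :=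
  forall j, @measurable_fun _ _ (mR3 R) R U (fun x => f x 0 j).

Definition energy U Df : \bar R :=
  (\int[leb3 R]_(x in U) (\sum_(i < 3) dotv (Df i x) (Df i x))%:E)%E.

(* [f] is in W^{1,2}(U; R^d) and [Df i] is its distributional partial derivative
   in the direction [e3 i]. *)
Definition W12 U f Df : Prop :=
  [/\ vmeasurable U f,
      (\int[leb3 R]_(x in U) (dotv (f x) (f x))%:E < +oo)%E,
      forall i, vmeasurable U (Df i),
      (energy U Df < +oo)%E &
      forall (phi : R3 R -> R) i j, test_function U phi ->
        \int[leb3 R]_(x in U) (f x 0 j * 'D_(e3 R i) phi x) =
        - \int[leb3 R]_(x in U) (Df i x 0 j * phi x)].

Definition L2 U (h : R3 R -> R) : Prop :=
  @measurable_fun _ _ (mR3 R) R U h /\ (\int[leb3 R]_(x in U) (h x ^+ 2)%:E < +oo)%E.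

(* Weak convergence in W^{1,2}(U; R^d): the components and their distributional
   derivatives converge weakly in L^2(U). The maps [f_ n] are only required to
   be in W^{1,2}(U; R^d) for large [n]. *)
Definition weak_cvg_W12 U (f_ : nat -> R3 R -> 'rV[R]_d) f : Prop :=
  exists (Df_ : nat -> 'I_3 -> R3 R -> 'rV[R]_d) Df,
    [/\ \forall n \near \oo, W12 U (f_ n) (Df_ n),
        W12 U f Df &
        forall h, L2 U h -> forall j,
          (\int[leb3 R]_(x in U) (f_ n x 0 j * h x) @[n --> \oo] -->
             \int[leb3 R]_(x in U) (f x 0 j * h x)) /\
          (forall i, \int[leb3 R]_(x in U) (Df_ n i x 0 j * h x) @[n --> \oo] -->
             \int[leb3 R]_(x in U) (Df i x 0 j * h x))].

End energy_space.

Section harmonic_maps.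
Variables (R : realType) (d : nat) (N : set 'rV[R]_d).
Implicit Types (f g : R3 R -> 'rV[R]_d) (x y : R3 R).

(* Maps on the unit ball are total functions whose values outside of
   [eball 1] are irrelevant. *)
Definition finite_energy_map f : Prop :=
  (forall x, eball 1 x -> N (f x)) /\ exists Df, W12 (eball 1) f Df.

Definition laplacian f x : 'rV[R]_d :=
  \sum_(i < 3) 'D_(e3 R i) ('D_(e3 R i) f) x.

(* For the metric induced from R^d, the Euler-Lagrange system of the energy
   among maps into [N] says that the tangential part of the Laplacian, i.e. the
   tension field of [f], vanishes. *)
Definition euler_lagrange f x : Prop :=
  forall v, tangent_space N (f x) v -> dotv (laplacian f x) v = 0.

Definition harmonic_map f : Prop :=
  finite_energy_map f /\
  exists S : set (R3 R),
    [/\ finite_set S, S `<=` eball 1,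
        forall x, S x -> ~ {for x, continuous f},
        smooth_on (eball 1 `\` S) f &
        forall x, (eball 1 `\` S) x -> euler_lagrange f x].

Definition isolated_singularity0 f : Prop :=
  (forall c, ~ {for 0, continuous (fun x => if x == 0 then c else f x)}) /\
  exists2 r : R, 0 < r & smooth_on [set x | 0 < enorm x < r] f.

Definition tangent_map f x g : Prop :=
  [/\ forall y, N (g y),
      forall (t : R) y, 0 < t -> g (t *: y) = g y &
      exists r_ : nat -> R,
        [/\ forall n, 0 < r_ n, r_ n @[n --> \oo] --> 0 &
            forall rho : R, 0 < rho ->
              weak_cvg_W12 (eball rho) (fun n y => f (x + r_ n *: y)) g]].

(* As elements of W^{1,2}_loc, tangent maps that agree almost everywhere are
   identified: the tangent maps of [f] at [x] are counted as equivalence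
   classes. *)
Definition tangent_maps f x : set (set (R3 R -> 'rV[R]_d)) :=
  [set C | exists2 g, tangent_map f x g &
     C = [set h | tangent_map f x h /\ h = g %[ae leb3 R]]].

End harmonic_maps.

(* Main.v *)
Require Import Defs.
From HB Require Import structures.
From mathcomp Require Import all_boot all_order all_algebra.
From mathcomp Require Import all_classical all_reals all_analysis.
From mathcomp Require Import measurable_realfun.
From mathcomp Require Import ring lra.

Set Implicit Arguments.
Unset Strict Implicit.
Unset Printing Implicit Defensive.

Import Order.TTheory GRing.Theory Num.Theory.
Import numFieldNormedType.Exports.

Local Open Scope classical_set_scope.
Local Open Scope ring_scope.

(* White's example, with explicit functions. Put t = T - ln |x|, u = 1/t,
   s = 1/ln t, and let theta = phase (ln t), where phase' lies between 1/2
   and 2. The map is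
     f x = ((1 + u) x/|x|, s, cos theta, sin theta)
   with values in a hypersurface |p|^2 = Phi (s, w) of R^3 x R x S^1. As x
   tends to 0, u and s vanish while theta tends to infinity, but only like
   ln ln (1/|x|), so that theta is asymptotically constant on every annulus
   a r < |x| < b r. Hence the blow-ups of f along r_i converge exactly when
   exp (i theta) does, to maps y |-> (y/|y|, 0, l) with l in S^1, and every l
   occurs.

   The target is tailored to f. Along the curve (s, cos theta, sin theta) the
   Euler-Lagrange system amounts to two scalar equations: one prescribes the
   derivative of Phi across the curve, the other one prescribes phase'. All
   corrections to Phi carry the factor u = exp (-1/s), which makes Phi smooth
   across s = 0 although the curve spirals towards the circle s = 0. *)

(** * Derivatives and smoothness *)

(** Why phase' has a closed form. Regard the profile gamma = (1 + u, s, theta) as a curve in t, with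
    ' for d/dt. For maps of this shape the system, tested against gamma', reads (|gamma'|^2 / 2 - (1
    + u)^2)' = |gamma'|^2. For u = 1/t this holds as soon as |gamma'|^2 = 2 u^2, because the bracket
    is then - 1 - 2 u. Now u' = - u^2, s' = - s^2 u and theta' = u phase' (ln t), so the requirement
    is phase'^2 = 2 - u^2 - s^4, the radicand of [kapf]. The equation across the curve is then met
    by prescribing the transversal slope of Phi. The main constraint on the target is regularity at
    s = 0: the coefficients of the corrections oscillate there, and their derivatives blow up like
    powers of 1/s, which exp (-1/s) outweighs. A second one is that the target has to be closed up
    at positive s without creating singular points; the parameters sig and M take care of this.
    Counting the tangent maps from above requires identifying every weak limit, not only those along
    well chosen radii. *)

Section has_diff.
Context {R : realType}.
Implicit Types V W : normedModType R.

(** [L] is a bare function, so that a derivative computed by the rules below can be replaced,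
    through [has_diff_ext], by any formula that [ring] or [field] identifies with it. *)
Definition has_diff {V W} (f : V -> W) (x : V) (L : V -> W) : Prop :=
  differentiable f x /\ forall v, 'D_v f x = L v.

Lemma has_diff_is_derive V W (f : V -> W) x L v : has_diff f x L -> is_derive x v f (L v).
Proof. by move=> [df <-]; apply/derivableP/diff_derivable. Qed.

Lemma has_diff_ext V W (f : V -> W) x L L' : has_diff f x L -> (forall v, L v = L' v) ->
  has_diff f x L'.
Proof. by move=> [df fL] LL'; split=> // v; rewrite fL. Qed.

Lemma near_eq_differentiable V W (f g : V -> W) x :
  (\near x, f x = g x) -> differentiable f x -> differentiable g x.
Proof.
move=> fg df.
have fgx : f x = g x by exact: (nbhs_singleton fg).
have [dfc dfo] := (diff_locallyP _ _).1 df.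
have go : g \o shift x = cst (g x) + 'd f x +o_ 0 id.
  apply/eqaddoP => e e0.
  have /eqaddoP/(_ e e0) := dfo.
  have fg' : \forall h \near 0, f (h + x) = g (h + x).
    have : (h + x) @[h --> 0] --> x.
      by rewrite -{2}(add0r x); apply: cvgD; [exact: cvg_id|exact: cvg_cst].
    by move/(_ _ fg).
  move=> fo; near=> h.
  suff -> : (g \o shift x - (cst (g x) + 'd f x)) h =
            (f \o shift x - (cst (f x) + 'd f x)) h by near: h.
  by rewrite /= !fctE /= -(near fg' h) // fgx.
(* ['d g x] is chosen among the continuous linear maps that realize the first order expansion; by
   [getPex] it suffices to exhibit one, and ['d f x] does. *)
apply/diffP => /=.
apply: (@getPex _ (fun (df : {linear V -> W}) => continuous df /\
  forall y, g y = g (lim (nbhs x)) + df (y - lim (nbhs x))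
                  +o_(y \near x) (y - lim (nbhs x)))).
exists ('d f x); split=> //; apply: eqaddoEx => z.
have -> : g z = (g \o shift x) (z - x) by rewrite /= subrK.
rewrite go !lim_id // /= !fctE; congr (_ + _).
rewrite -(comp_centerK x id) -[X in the_littleo _ _ _ X](comp_centerK x).
by rewrite -[_ (z - x)]/((_ \o (center x)) z) -littleo_center0.
Unshelve. all: by end_near. Qed.

Lemma has_diff_near V W (f g : V -> W) x L :
  (\near x, f x = g x) -> has_diff f x L -> has_diff g x L.
Proof.
move=> fg [df fL]; split; first exact: near_eq_differentiable fg df.
by move=> v; rewrite -fL; apply/esym/near_eq_derive.
Qed.

Lemma has_diff_cst V W (c : W) (x : V) : has_diff (fun=> c) x (fun=> 0).
Proof. by split=> [|v]; [exact: differentiable_cst|exact: derive_cst]. Qed.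

Lemma has_diffD V W (f g : V -> W) x L M : has_diff f x L -> has_diff g x M ->
  has_diff (fun y => f y + g y) x (fun v => L v + M v).
Proof.
move=> [df fL] [dg gM]; split; first exact: differentiableD.
by move=> v; rewrite deriveD ?fL ?gM//; exact: diff_derivable.
Qed.

Lemma has_diffM V (f g : V -> R) x L M : has_diff f x L -> has_diff g x M ->
  has_diff (fun y => f y * g y) x (fun v => L v * g x + f x * M v).
Proof.
move=> [df fL] [dg gM]; split; first exact: differentiableM.
move=> v; rewrite (@deriveM _ _ f g)//; try exact: diff_derivable.
by rewrite fL gM addrC mulrC [X in _ + X]mulrC [X in X + _]mulrC.
Qed.

Lemma has_diffN V (f : V -> R) x L : has_diff f x L ->
  has_diff (fun y => - f y) x (fun v => - L v).
Proof.
move=> [df fL]; split; first exact: differentiableN.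
by move=> v; rewrite deriveN ?fL//; exact: diff_derivable.
Qed.

Lemma has_diff_comp1 V W (h : V -> R) (g : R -> W) x L dg : has_diff h x L ->
  is_derive (h x) 1 g dg -> has_diff (fun y => g (h y)) x (fun v => L v *: dg).
Proof.
move=> [dh hL] [dg1 gdg].
have dg' : differentiable g (h x) by exact/derivable1_diffP.
split; first exact: differentiable_comp.
move=> v; rewrite deriveE; last exact: differentiable_comp.
have hv : 'd h x v = L v by rewrite -deriveE// hL.
rewrite diff_comp//= hv -gdg deriveE// -linearZ/=.
by congr ('d g _ _); rewrite -[RHS]/(L v * 1) mulr1.
Qed.

Lemma has_diff_compM V (h : V -> R) (g : R -> R) x L dg : has_diff h x L ->
  is_derive (h x) 1 g dg -> has_diff (fun y => g (h y)) x (fun v => dg * L v).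
Proof.
move=> hL gdg; apply: has_diff_ext (has_diff_comp1 hL gdg) _ => v.
exact: mulrC.
Qed.

Lemma has_diffV V (f : V -> R) x L : f x != 0 -> has_diff f x L ->
  has_diff (fun y => (f y)^-1) x (fun v => - (f x) ^- 2 * L v).
Proof.
move=> fx0 [df fL]; split; first exact: differentiableV.
by move=> v; rewrite deriveV// ?fL//; exact: diff_derivable.
Qed.

Lemma has_diff_sqrt V (f : V -> R) x L : 0 < f x -> has_diff f x L ->
  has_diff (fun y => Num.sqrt (f y)) x (fun v => (2 * Num.sqrt (f x))^-1 * L v).
Proof. by move=> fx0 fL; apply: has_diff_compM fL _; exact: is_derive1_sqrt. Qed.

Lemma has_diffX V (f : V -> R) n x L : has_diff f x L ->
  has_diff (fun y => f y ^+ n) x (fun v => n%:R * f x ^+ n.-1 * L v).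
Proof.
move=> fL; apply: (@has_diff_compM _ f (fun y => y ^+ n) _ _ _ fL).
have := @is_deriveX _ _ (@id R) n (f x) 1 1 (is_derive_id _ _).
by rewrite /= [_ *: _]mulr1 fctE.
Qed.

Lemma has_diff_expR V (f : V -> R) x L : has_diff f x L ->
  has_diff (fun y => expR (f y)) x (fun v => expR (f x) * L v).
Proof. by move=> fL; apply: has_diff_compM fL _; exact: is_derive_expR. Qed.

Lemma has_diff_cos V (f : V -> R) x L : has_diff f x L ->
  has_diff (fun y => cos (f y)) x (fun v => - sin (f x) * L v).
Proof. by move=> fL; apply: has_diff_compM fL _; exact: is_derive_cos. Qed.

Lemma has_diff_sin V (f : V -> R) x L : has_diff f x L ->
  has_diff (fun y => sin (f y)) x (fun v => cos (f x) * L v).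
Proof. by move=> fL; apply: has_diff_compM fL _; exact: is_derive_sin. Qed.

Lemma has_diff_ln V (f : V -> R) x L : 0 < f x -> has_diff f x L ->
  has_diff (fun y => ln (f y)) x (fun v => (f x)^-1 * L v).
Proof. by move=> fx0 fL; apply: has_diff_compM fL _; exact: is_derive1_ln. Qed.

Lemma has_diff_lin V W (f : {linear V -> W}) x : continuous f -> has_diff f x f.
Proof.
move=> cf; split; first exact: linear_differentiable.
by move=> v; rewrite deriveE ?diff_lin//; exact: linear_differentiable.
Qed.

Definition coordv d (j : 'I_d) (p : 'rV[R]_d) : R := p 0 j.

Lemma coordv_linear d (j : 'I_d) : linear (coordv j).
Proof. by move=> a p q; rewrite /coordv !mxE. Qed.

HB.instance Definition _ d j := GRing.isLinear.Build R 'rV[R]_d R *:%R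
  (coordv j) (@coordv_linear d j).

Lemma has_diff_coord d (j : 'I_d) (p : 'rV[R]_d) :
  has_diff (fun p : 'rV[R]_d => p 0 j) p (fun v => v 0 j).
Proof. by apply: (@has_diff_lin _ _ (coordv j)); exact: coord_continuous. Qed.

Lemma derive_coord V d (F : V -> 'rV[R]_d) x v j : differentiable F x ->
  'D_v F x 0 j = 'D_v (fun y => F y 0 j) x.
Proof. by move=> dF; rewrite derive_mx ?mxE//; exact: diff_derivable. Qed.

Lemma differentiable_rV V d (F : V -> 'rV[R]_d) x :
  (forall j, differentiable (fun y => F y 0 j) x) -> differentiable F x.
Proof.
move=> dF.
rewrite (_ : F = \sum_(j < d) (fun y => F y 0 j *: (delta_mx 0 j : 'rV[R]_d))); last first.
  apply/funext => y; rewrite fct_sumE; apply/rowP => k.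
  rewrite summxE (bigD1 k)//= big1 => [|i ik]; last first.
    by rewrite !mxE eqxx/= eq_sym (negbTE ik) mulr0.
  by rewrite !mxE !eqxx/= mulr1 addr0.
by apply: differentiable_sum => j; exact: differentiableZl.
Qed.

Lemma has_diff_rV V d (F : V -> 'rV[R]_d) x (L : V -> 'rV[R]_d) :
  (forall j, has_diff (fun y => F y 0 j) x (fun v => L v 0 j)) -> has_diff F x L.
Proof.
move=> FL; have dF : differentiable F x.
  by apply: differentiable_rV => j; case: (FL j).
split=> // v; apply/rowP => j; rewrite derive_coord//.
by case: (FL j).
Qed.

Lemma Ck_sub V W k (U U' : set V) (f : V -> W) : U' `<=` U ->
  Ck k U f -> Ck k U' f.
Proof.
move=> UU'; elim: k f => [|k IH] f /=; first by move=> cf x /UU'; exact: cf.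
by move=> [df Df]; split=> [x /UU'/df//|v]; exact: IH.
Qed.

Lemma Ck_eq V W k (U : set V) (f g : V -> W) : open U ->
  (forall x, U x -> f x = g x) -> Ck k U f -> Ck k U g.
Proof.
move=> oU; elim: k f g => [|k IH] f g fg /=.
  move=> cf x Ux; have fgx : \near x, f x = g x.
    by near=> y; apply: fg; near: y; exact: open_nbhs_nbhs.
  have : f @ x --> g x by rewrite -(fg x Ux); exact: cf.
  by apply: cvg_trans; exact: near_eq_cvg.
move=> [df Df]; have fgx x : U x -> \near x, f x = g x.
  by move=> Ux; near=> y; apply: fg; near: y; exact: open_nbhs_nbhs.
split=> [x Ux|v]; first exact: near_eq_differentiable (fgx x Ux) (df x Ux).
by apply: IH (Df v) => x Ux; apply: near_eq_derive; exact: fgx.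
Unshelve. all: by end_near. Qed.

Lemma smooth_on_eq V W (U : set V) (f g : V -> W) : open U ->
  (forall x, U x -> f x = g x) -> smooth_on U f -> smooth_on U g.
Proof. by move=> oU fg sf k; apply: Ck_eq (sf k). Qed.

(** The order of differentiation decreases while the function moves inside [S]. A derivative agrees
    with a member of [S] on [U] only; openness of [U] lets [Ck_eq] transfer the regularity. *)
Lemma smooth_of_closed V W (U : set V) (S : set (V -> W)) : open U ->
  (forall f x, S f -> U x -> differentiable f x) ->
  (forall f v, S f -> exists2 g, S g & forall x, U x -> 'D_v f x = g x) ->
  forall f, S f -> smooth_on U f.
Proof.
move=> oU dS DS f + k; elim: k f => [|k IH] f Sf /=.
  by move=> x Ux; exact/differentiable_continuous/dS.
split=> [x|v]; first exact: dS.
have [g Sg fg] := DS f v Sf.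
by apply: Ck_eq (IH _ Sg) => // x Ux; rewrite fg.
Qed.

Lemma smooth_on_rV V d (U : set V) (F : V -> 'rV[R]_d) : open U ->
  (forall j, smooth_on U (fun x => F x 0 j)) -> smooth_on U F.
Proof.
move=> oU sF k; have {}sF j := sF j k.
elim: k F sF => [|k IH] F sF /=.
  move=> x Ux; apply/cvgrPdist_le => e e0; near=> y.
  rewrite [leLHS]/Num.Def.normr/= mx_normrE (bigmax_le _ (ltW e0))//= => -[i j] _.
  rewrite !mxE /= (ord1 i); move: j; near: y; apply: filter_forall => j.
  by have /cvgrPdist_le/(_ e e0) := sF j x Ux.
have dF x : U x -> differentiable F x.
  by move=> Ux; apply: differentiable_rV => j; case: (sF j) => + _; exact.
split=> // v; apply: IH => j; have [_ /(_ v)] := sF j.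
by apply: Ck_eq => // x Ux; rewrite derive_coord//; exact: dF.
Unshelve. all: by end_near. Qed.

(* The ring generated by [G]: when the generators have their partial derivatives
   in it, smoothness follows without computing higher derivatives. *)
Inductive gen V (G : set (V -> R)) : (V -> R) -> Prop :=
| gen_cst c : gen G (fun=> c)
| gen_in g : G g -> gen G g
| genD f g : gen G f -> gen G g -> gen G (fun x => f x + g x)
| genM f g : gen G f -> gen G g -> gen G (fun x => f x * g x).

Definition gradient_closed V (U : set V) (G : set (V -> R)) : Prop :=
  forall g, G g -> exists L, (forall x, U x -> has_diff g x (L x)) /\
    forall v, gen G (fun x => L x v).

Lemma gen_gradient V (U : set V) (G : set (V -> R)) : gradient_closed U G ->
  gradient_closed U (gen G).
Proof.
move=> cG g; elim=> {g} [c|g Gg|f g Gf [L [fL GL]] Gg [M [gM GM]]|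
  f g Gf [L [fL GL]] Gg [M [gM GM]]].
- exists (fun=> fun=> 0); split=> [x _|v]; first exact: has_diff_cst.
  exact/gen_in/gen_cst.
- have [L [gL GL]] := cG g Gg.
  by exists L; split=> // v; exact/gen_in/GL.
- exists (fun x v => L x v + M x v); split=> [x Ux|v].
    by apply: has_diffD; [exact: fL|exact: gM].
  exact: genD.
- exists (fun x v => L x v * g x + f x * M x v); split=> [x Ux|v].
    by apply: has_diffM; [exact: fL|exact: gM].
  by apply: genD; apply: genM => //; exact: gen_in.
Qed.

Lemma gen_gen V (G : set (V -> R)) f : gen (gen G) f -> gen G f.
Proof.
elim=> {f} [c|//|f g _ Gf _ Gg|f g _ Gf _ Gg]; first exact: gen_cst.
- exact: genD.
- exact: genM.
Qed.

Lemma gen_smooth V (U : set V) (G : set (V -> R)) f : open U ->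
  gradient_closed U G -> gen G f -> smooth_on U f.
Proof.
move=> oU /gen_gradient cG; apply: smooth_of_closed => // {}f.
- by move=> x /cG[L [/(_ x) fL _]] /fL[].
- move=> v /cG[L [fL GL]]; exists (fun x => L x v); first exact: gen_gen.
  by move=> x /fL[].
Qed.
End has_diff.

(** * Flat functions of one variable *)

Section flat_functions.
Context {R : realType}.
Implicit Types s t : R.

(* In terms of s = 1/ln t: [uf s] is u = 1/t and [kapf s] is phase' (ln t). *)
Definition uf s : R := expR (- s^-1).
Definition kapf s : R := Num.sqrt (2 - uf s ^+ 2 - s ^+ 4).
Definition phase (tau : R) : R :=
  (\int[@lebesgue_measure R]_(x in `[1, tau]) kapf x^-1)%R.
Definition Kf s : R := phase s^-1.
(** Minus the coefficient of x/|x| in |x|^2 times the Laplacian of the map, see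
    [laplacian_spiral]. *)
Definition qf s : R := 2 + 2 * uf s - uf s ^+ 2 - 2 * uf s ^+ 3.
(** s < 1/2 means ln t > 2: there [phase] is evaluated inside its range of integration and the
    radicand of [kapf] is at least 15/16. *)
Definition I2 : set R := [set s | 0 < s < 2^-1].

Lemma has_diff_id s : has_diff (@id R) s id.
Proof. by split=> // v; exact: derive_id. Qed.

Lemma uf_gt0 s : 0 < uf s. Proof. exact: expR_gt0. Qed.

Lemma uf_lt1 s : 0 < s -> uf s < 1.
Proof. by move=> s0; rewrite expR_lt1 oppr_lt0 invr_gt0. Qed.

Lemma kap2_ge s : I2 s -> 15 / 16 <= 2 - uf s ^+ 2 - s ^+ 4.
Proof.
move=> /andP[s0 s2]; have u1 := uf_lt1 s0; have u0 := uf_gt0 s.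
have : s ^+ 2 <= 4^-1 by rewrite (_ : 4^-1 = 2^-1 ^+ 2 :> R) ?lerXn2r ?nnegrE ?ltW//; field.
have s20 : 0 <= s ^+ 2 by rewrite sqr_ge0.
rewrite (_ : s ^+ 4 = (s ^+ 2) ^+ 2); last by rewrite -exprM.
by move: (s ^+ 2) s20 => x x0 x4; nra.
Qed.

Lemma kapf_sqr s : I2 s -> kapf s ^+ 2 = 2 - uf s ^+ 2 - s ^+ 4.
Proof. by move=> /kap2_ge h; rewrite sqr_sqrtr//; lra. Qed.

Lemma kapf_ge s : I2 s -> 2^-1 <= kapf s.
Proof.
move=> Is; have := kapf_sqr Is; have := kap2_ge Is.
have : 0 <= kapf s by exact: sqrtr_ge0.
by nra.
Qed.

Lemma kapf_le s : kapf s <= 2.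
Proof.
rewrite -(ler_pXn2r (ltn0Sn 1)) ?nnegrE ?sqrtr_ge0//.
rewrite /kapf; set x := (X in Num.sqrt X).
have x2 : x <= 2 by rewrite /x; have := sqr_ge0 (uf s); have := sqr_ge0 (s ^+ 2); rewrite -exprM => ? ?; lra.
have [x0|x0] := leP 0 x; first by rewrite sqr_sqrtr//; lra.
by rewrite ler0_sqrtr ?ltW//; lra.
Qed.

Lemma qf_ge1 s : 0 < s -> 1 <= qf s.
Proof.
move=> s0; have := uf_lt1 s0; have := uf_gt0 s; rewrite /qf.
by move: (uf s) => u u0 u1; nra.
Qed.

Lemma has_diff_uf s : s != 0 -> has_diff uf s (fun v => uf s * s ^- 2 * v).
Proof.
move=> s0; apply: has_diff_ext => [|v].
  by apply: (@has_diff_expR _ _ (fun s => - s^-1)); exact/has_diffN/has_diffV/has_diff_id.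
by rewrite /uf /=; ring.
Qed.

Lemma has_diff_kapf s : I2 s ->
  has_diff kapf s (fun v => (- uf s ^+ 2 * s ^- 2 - 2 * s ^+ 3) * (kapf s)^-1 * v).
Proof.
move=> Is; have /andP[s0 _] := Is; have sn0 : s != 0 by rewrite gt_eqF.
have k2 := kap2_ge Is.
apply: has_diff_ext => [|v].
  apply: (@has_diff_sqrt _ _ (fun s => 2 - uf s ^+ 2 - s ^+ 4)); first by lra.
  apply: has_diffD; first apply: has_diffD; [exact: has_diff_cst|apply: has_diffN|apply: has_diffN].
    exact/has_diffX/has_diff_uf.
  exact/(@has_diffX _ _ id)/has_diff_id.
rewrite -/(kapf s) /=.
have : kapf s != 0 by have := kapf_ge Is; apply: contraTneq => ->; lra.
by move=> k0; field; rewrite k0.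
Qed.

Lemma continuous_kapf_inv (x : R) : 0 < x -> {for x, continuous (fun x : R => kapf x^-1)}.
Proof.
move=> x0; apply: (@continuous_comp _ _ _ (fun x : R => 2 - uf x^-1 ^+ 2 - x^-1 ^+ 4 : R) (@Num.sqrt R)); last exact: sqrt_continuous.
have xi : has_diff (fun x : R => x^-1) x (fun v => - x ^- 2 * v).
  by apply: (@has_diffV _ _ id) (has_diff_id x); rewrite gt_eqF.
have xi0 : x^-1 != 0 by rewrite gt_eqF// invr_gt0.
have ui := has_diff_compM xi (has_diff_is_derive (1 : R) (has_diff_uf xi0)).
have [df _] := has_diffD (has_diffD (has_diff_cst (2 : R) x) (has_diffN (has_diffX 2 ui))) (has_diffN (has_diffX 4 xi)).
exact: differentiable_continuous.
Qed.

Lemma is_derive_phase (x : R) : 1 < x -> is_derive x 1 phase (kapf x^-1).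
Proof.
move=> x1; have x0 : 0 < x by exact: lt_trans x1.
have ik : (@lebesgue_measure R).-integrable `[1, x + 1]
    (EFin \o (fun x : R => kapf x^-1)).
  apply: continuous_compact_integrable; first exact: segment_compact.
  apply: continuous_in_subspaceT => y; rewrite inE/= in_itv/= => /andP[y1 _].
  by apply: continuous_kapf_inv; exact: lt_le_trans y1.
have [] := @continuous_FTC1_closed R _ 1 x (x + 1) _ ik x1 (continuous_kapf_inv x0).
  by rewrite ltrDl.
by move=> d; rewrite derive1E => <-; exact/derivableP.
Qed.

Lemma has_diff_Kf s : I2 s -> has_diff Kf s (fun v => - kapf s * s ^- 2 * v).
Proof.
move=> /andP[s0 s2]; apply: has_diff_ext => [|v].
  apply: (@has_diff_compM _ _ (fun s : R => s^-1) phase).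
    by apply: (@has_diffV _ _ id) (has_diff_id s); rewrite gt_eqF.
  by apply: is_derive_phase; rewrite invf_gt1//; lra.
by rewrite /= invrK; ring.
Qed.

(** Mean value theorem with 1/2 <= phase' <= 2. The lower bound makes the phase reach every large
    value, the upper one makes the spiral slow. *)
Lemma phase_incr (x y : R) : 2 < x -> x <= y ->
  2^-1 * (y - x) <= phase y - phase x <= 2 * (y - x).
Proof.
move=> x2; rewrite le_eqVlt => /orP[/eqP <-|xy]; first by rewrite !subrr !mulr0 lexx.
have dphi z : x <= z -> is_derive z 1 phase (kapf z^-1).
  by move=> xz; apply: is_derive_phase; lra.
have [||z zxy ->] := @MVT R phase (fun z : R => kapf z^-1) x y xy.
- by move=> z; rewrite in_itv/= => /andP[xz _]; apply: dphi; exact: ltW.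
- apply: continuous_in_subspaceT => z; rewrite inE/= in_itv/= => /andP[xz _].
  by apply: differentiable_continuous; apply/derivable1_diffP; case: (dphi z xz).
have Iz : I2 z^-1.
  move: zxy; rewrite in_itv/= => /andP[xz _].
  by rewrite /I2/= invr_gt0 ltf_pV2 ?posrE//; lra.
by apply/andP; split; apply: ler_wpM2r; rewrite ?subr_ge0 ?kapf_le ?kapf_ge// ltW.
Qed.

Inductive base1 : (R -> R) -> Prop :=
| base1_inv : base1 (fun s => s^-1)
| base1_id : base1 id
| base1_u : base1 uf
| base1_k : base1 kapf
| base1_kV : base1 (fun s => (kapf s)^-1)
| base1_cos : base1 (fun s => cos (Kf s))
| base1_sin : base1 (fun s => sin (Kf s))
| base1_qV : base1 (fun s => (qf s)^-1).

Lemma genX (V : normedModType R) (G : set (V -> R)) f n : gen G f -> gen G (fun x => f x ^+ n).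
Proof.
move=> Gf; elim: n => [|n IH]; first exact: gen_cst.
by rewrite (_ : (fun x => _) = fun x => f x * f x ^+ n); [exact: genM|
  apply/funext => x; rewrite exprS].
Qed.

Lemma genN (V : normedModType R) (G : set (V -> R)) f : gen G f -> gen G (fun x => - f x).
Proof.
move=> Gf; rewrite (_ : (fun x => _) = fun x => (-1) * f x).
  by apply: genM => //; exact: gen_cst.
by apply/funext => x; rewrite mulN1r.
Qed.

Lemma base1_closed : gradient_closed I2 base1.
Proof.
have s0 s : I2 s -> s != 0 by move=> /andP[s0 _]; rewrite gt_eqF.
have k0 s : I2 s -> kapf s != 0.
  by move=> /kapf_ge; apply: contraTneq => ->; lra.
have q0 s : I2 s -> qf s != 0.
  by move=> /andP[/qf_ge1 + _]; apply: contraTneq => ->; lra.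
have Gi n : gen base1 (fun s => s ^- n).
  rewrite (_ : (fun s => _) = fun s => s^-1 ^+ n).
    exact/genX/gen_in/base1_inv.
  by apply/funext => x; rewrite exprVn.
have Gk n : gen base1 (fun s => kapf s ^- n).
  rewrite (_ : (fun s => _) = fun s => (kapf s)^-1 ^+ n).
    exact/genX/gen_in/base1_kV.
  by apply/funext => x; rewrite exprVn.
have Gq n : gen base1 (fun s => qf s ^- n).
  rewrite (_ : (fun s => _) = fun s => (qf s)^-1 ^+ n).
    exact/genX/gen_in/base1_qV.
  by apply/funext => x; rewrite exprVn.
have Gs : gen base1 id by exact/gen_in/base1_id.
have Gu : gen base1 uf by exact/gen_in/base1_u.
have Gkap : gen base1 kapf by exact/gen_in/base1_k.
have Gcos : gen base1 (fun s => cos (Kf s)) by exact/gen_in/base1_cos.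
have Gsin : gen base1 (fun s => sin (Kf s)) by exact/gen_in/base1_sin.
have Gc c : gen base1 (fun=> c) by exact: gen_cst.
move=> g [].
- exists (fun s v => - s ^- 2 * v); split=> [s Is|v].
    exact: (@has_diffV _ _ id) (s0 _ Is) (has_diff_id s).
  by apply: genM; [exact: genN|].
- by exists (fun s v => v); split=> [s _|v]; [exact: has_diff_id|].
- exists (fun s v => uf s * s ^- 2 * v); split=> [s Is|v].
    by apply: has_diff_uf; exact: s0.
  by do ?apply: genM.
- exists (fun s v => (- uf s ^+ 2 * s ^- 2 - 2 * s ^+ 3) * (kapf s)^-1 * v).
  split=> [s Is|v]; first exact: has_diff_kapf.
  apply: genM => //; apply: genM; last exact: (Gk 1).
  apply: genD; last by apply: genN; apply: genM => //; exact: (@genX _ _ id).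
  by apply: genM => //; apply: genN; exact: genX.
- exists (fun s v => - kapf s ^- 2 * ((- uf s ^+ 2 * s ^- 2 - 2 * s ^+ 3) * (kapf s)^-1 * v)).
  split=> [s Is|v]; first by apply: has_diffV; [exact: k0|exact: has_diff_kapf].
  apply: genM; first exact: genN.
  apply: genM => //; apply: genM; last exact: (Gk 1).
  apply: genD; last by apply: genN; apply: genM => //; exact: (@genX _ _ id).
  by apply: genM => //; apply: genN; exact: genX.
- exists (fun s v => - sin (Kf s) * (- kapf s * s ^- 2 * v)).
  split=> [s Is|v]; first exact/has_diff_cos/has_diff_Kf.
  by do ?[exact: genN|apply: genM].
- exists (fun s v => cos (Kf s) * (- kapf s * s ^- 2 * v)).
  split=> [s Is|v]; first exact/has_diff_sin/has_diff_Kf.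
  by do ?[exact: genN|apply: genM].
- exists (fun s v => - qf s ^- 2 *
    ((2 - 2 * uf s - 6 * uf s ^+ 2) * (uf s * s ^- 2 * v))).
  split=> [s Is|v].
    apply: has_diff_ext => [|v].
      apply: has_diffV; first exact: q0.
      have hu := has_diff_uf (s0 _ Is).
      exact: has_diffD (has_diffD (has_diffD (has_diff_cst _ _) (has_diffM (has_diff_cst _ _) hu))
        (has_diffN (has_diffX 2 hu))) (has_diffN (has_diffM (has_diff_cst _ _) (has_diffX 3 hu))).
    by rewrite /=; ring.
  apply: genM; first exact: genN.
  apply: genM; last by do ?apply: genM.
  apply: genD; last by apply: genN; apply: genM => //; exact: genX.
  by apply: genD => //; apply: genN; exact: genM.
Qed.

Lemma base1_bound g : base1 g -> forall s, I2 s -> `|g s| <= s^-1.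
Proof.
have s2 s : I2 s -> 2 <= s^-1.
  by move=> /andP[s0 s2]; rewrite -(invrK 2) lef_pV2 ?posrE ?ltW// invr_gt0.
move=> [] s Is; have := s2 _ Is; have /andP[s0 s1] := Is => si.
- by rewrite ger0_norm// invr_ge0 ltW.
- by rewrite ger0_norm ?ltW//; lra.
- by rewrite ger0_norm ?ltW ?uf_gt0//; have := uf_lt1 s0; lra.
- by rewrite ger0_norm ?sqrtr_ge0// (le_trans (kapf_le s)).
- rewrite ger0_norm ?invr_ge0 ?sqrtr_ge0//; apply: le_trans si.
  by rewrite -[leRHS]invrK lef_pV2 ?posrE ?kapf_ge//; have := kapf_ge Is; lra.
- by apply: le_trans si; rewrite ler_norml; have := cos_le1 (Kf s); have := cos_geN1 (Kf s); lra.
- by apply: le_trans si; rewrite ler_norml; have := sin_le1 (Kf s); have := sin_geN1 (Kf s); lra.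
- have q1 := qf_ge1 s0; rewrite ger0_norm ?invr_ge0; last by lra.
  by apply: le_trans (_ : 1 <= _); [rewrite invf_le1; lra|lra].
Qed.

(** Every element of the ring grows at most like a power of 1/s, which the factor [uf] = exp (-1/s)
    beats. *)
Lemma gen_base1_bound g : gen base1 g ->
  exists C n, 0 <= C /\ forall s, I2 s -> `|g s| <= C * s ^- n.
Proof.
have i0 s n : I2 s -> 0 <= s ^- n.
  by move=> /andP[s0 _]; rewrite invr_ge0 exprn_ge0// ltW.
have ile s n m : I2 s -> (n <= m)%N -> s ^- n <= s ^- m.
  move=> /andP[s0 s1] nm; rewrite lef_pV2 ?posrE ?exprn_gt0//.
  by apply: ler_wiXn2l => //; lra.
elim=> {g} [c|g bg|f g _ [C [n [C0 fC]]] _ [D [m [D0 gD]]]|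
  f g _ [C [n [C0 fC]]] _ [D [m [D0 gD]]]].
- by exists `|c|, 0; split=> // s _; rewrite expr0 invr1 mulr1.
- by exists 1, 1; split=> // s Is; rewrite mul1r expr1; exact: base1_bound.
- exists (C + D), (maxn n m); split=> [|s Is]; first exact: addr_ge0.
  rewrite (le_trans (ler_normD _ _))// mulrDl lerD//.
  + by rewrite (le_trans (fC s Is))// ler_wpM2l// ile// leq_maxl.
  + by rewrite (le_trans (gD s Is))// ler_wpM2l// ile// leq_maxr.
- exists (C * D), (n + m)%N; split=> [|s Is]; first exact: mulr_ge0.
  rewrite normrM exprD invfM mulrACA ler_pM//; [exact: fC|exact: gD].
Qed.

(** The inequality a <= exp a at a = 1 / ((n + 1) s), raised to the power n + 1 and inverted. *)
Lemma uf_le s n : 0 < s -> uf s <= (n.+1%:R * s) ^+ n.+1.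
Proof.
move=> s0; have n0 : 0 < n.+1%:R :> R by rewrite ltr0n.
rewrite /uf expRN -[leRHS]invrK lef_pV2 ?posrE ?expR_gt0 ?invr_gt0 ?exprn_gt0 ?mulr_gt0//.
rewrite (_ : s^-1 = n.+1%:R * (n.+1%:R * s)^-1); last first.
  by rewrite invfM mulrA divff ?mul1r// gt_eqF.
rewrite expRM_natl -exprVn lerXn2r ?nnegrE ?expR_ge0 ?invr_ge0 ?mulr_ge0 ?ltW//.
by apply: lt_le_trans (expR_ge1Dx _); rewrite ltrDr.
Qed.

Definition flat (g : R -> R) s : R := if 0 < s then uf s * g s else 0.

(** The quadratic bound serves twice: for differentiability at 0, and to make the corrections to Phi
    small on a narrow strip around s = 0. *)
Lemma flat_bound g : gen base1 g ->
  exists2 C, 0 <= C & forall s, s < 2^-1 -> `|flat g s| <= C * s ^+ 2.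
Proof.
move=> /gen_base1_bound[C [n [C0 gC]]].
(* Of the n + 2 powers of s supplied by [uf_le], n absorb the growth of [g] and two remain. *)
exists ((n.+2%:R) ^+ n.+2 * C) => [|s s2]; first by rewrite mulr_ge0 ?exprn_ge0.
rewrite /flat; case: ifPn => s0; last first.
  rewrite normr0; apply: mulr_ge0 (sqr_ge0 _); apply: mulr_ge0 => //; exact: exprn_ge0.
have Is : I2 s by rewrite /I2/= s0.
rewrite normrM ger0_norm ?(ltW (uf_gt0 _))//.
apply: le_trans (ler_pM _ _ (uf_le n.+1 s0) (gC _ Is)) _ => //; first exact/ltW/uf_gt0.
rewrite exprMn (_ : s ^+ n.+2 = s ^+ 2 * s ^+ n); last by rewrite -exprD.
move: (n.+2%:R ^+ _) (s ^+ n) (expf_neq0 n (lt0r_neq0 s0)) => a b b0.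
by rewrite le_eqVlt; apply/orP; left; apply/eqP; field.
Qed.

(** Flat functions are stable under differentiation: (u g)' = u (g / s^2 + g'), and the new
    coefficient is again in the ring. Smoothness across 0 follows by iteration. *)
Lemma flat_is_derive g : gen base1 g -> exists2 h, gen base1 h &
  forall s, s < 2^-1 -> is_derive s 1 (flat g) (flat h s).
Proof.
move=> Gg; have [L [gL GL]] := gen_gradient base1_closed Gg.
exists (fun s => g s * s^-1 ^+ 2 + L s 1).
  by apply: genD; [apply: genM => //; exact/genX/gen_in/base1_inv|
    exact: gen_gen (GL (1 : R))].
move=> s s2; have [s0|s0|->] := ltgtP s 0.
- rewrite {2}/flat ltNge ltW//=; apply: near_eq_is_derive (is_derive_cst 0 _ _).
  near=> x; rewrite /flat ltNge ltW//=; near: x; exact: lt_nbhsl.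
- have Is : I2 s by rewrite /I2/= s0.
  have dug := has_diffM (has_diff_uf (lt0r_neq0 s0)) (gL s Is).
  have fg : \near s, uf s * g s = flat g s.
    by near=> x; rewrite /flat ifT//; near: x; exact: lt_nbhsr.
  apply: is_derive_eq (has_diff_is_derive (1 : R) (has_diff_near fg dug)) _.
  by rewrite /flat s0 exprVn /=; ring.
- rewrite {2}/flat ltxx.
  have [C C0 fC] := flat_bound Gg.
  (* At 0 the difference quotient is at most C |h| in absolute value, by the quadratic bound. *)
  have h : h^-1 *: (flat g (h *: 1 + 0) - flat g 0) @[h --> 0^'] --> (0 : R).
    apply/cvgr0Pnorm_le => e e0; near=> h.
    rewrite {2}/flat ltxx subr0 addr0 [h *: 1]mulr1 normrM normfV.
    have hn0 : 0 < `|h| by rewrite normr_gt0; near: h; exact: nbhs_dnbhs_neq.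
    rewrite ler_pdivrMl//; apply: le_trans (fC _ _) _.
      by rewrite (le_lt_trans (ler_norm _))//; near: h; apply: dnbhs0_lt; rewrite invr_gt0.
    rewrite -real_normK ?num_real// expr2 mulrCA ler_wpM2l//.
    rewrite (@le_trans _ _ ((C + 1) * `|h|)) ?ler_wpM2r ?lerDl//.
    have C1 : 0 < C + 1 by rewrite ltr_wpDl.
    by rewrite -ler_pdivlMl//; near: h; apply: dnbhs0_le; rewrite mulr_gt0// invr_gt0 ltr_wpDl.
  by apply: DeriveDef; [apply/cvg_ex; exists 0|exact/cvg_lim].
Unshelve. all: by end_near. Qed.
End flat_functions.

(** * The target manifold *)

Definition o6 (k : nat) : 'I_6 := inord k.

Lemma sum_ord6 (V : nmodType) (F : 'I_6 -> V) : \sum_(j < 6) F j =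
  F (o6 0) + (F (o6 1) + (F (o6 2) + (F (o6 3) + (F (o6 4) + F (o6 5))))).
Proof.
rewrite !big_ord_recl big_ord0 addr0.
by do 5?congr (F _ + _); try congr F; apply/val_inj; rewrite /= inordK.
Qed.

Lemma forall_ord6 (P : 'I_6 -> Prop) :
  P (o6 0) -> P (o6 1) -> P (o6 2) -> P (o6 3) -> P (o6 4) -> P (o6 5) ->
  forall j, P j.
Proof.
move=> P0 P1 P2 P3 P4 P5 j; rewrite -(inord_val j).
by case: j => -[|[|[|[|[|[|//]]]]]].
Qed.

Section target.
Context {R : realType}.
Implicit Types (p v : 'rV[R]_6) (s sig M : R).

Definition vec6 (a0 a1 a2 a3 a4 a5 : R) : 'rV[R]_6 :=
  \row_j [:: a0; a1; a2; a3; a4; a5]`_j.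

Lemma vec6E a0 a1 a2 a3 a4 a5 :
  (vec6 a0 a1 a2 a3 a4 a5 0 (o6 0) = a0) *
  (vec6 a0 a1 a2 a3 a4 a5 0 (o6 1) = a1) *
  (vec6 a0 a1 a2 a3 a4 a5 0 (o6 2) = a2) *
  (vec6 a0 a1 a2 a3 a4 a5 0 (o6 3) = a3) *
  (vec6 a0 a1 a2 a3 a4 a5 0 (o6 4) = a4) *
  (vec6 a0 a1 a2 a3 a4 a5 0 (o6 5) = a5).
Proof. by do !split; rewrite mxE inordK. Qed.

(* The derivative of Phi across the spiral divided by u, as forced by the
   component of the Euler-Lagrange system along the circle S^1. *)
Definition cf s : R :=
  (- kapf s - uf s * kapf s + uf s * (uf s ^+ 2 + 2 * s ^+ 5) * (kapf s)^-1) *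
  (2 * (1 + uf s)) * (qf s)^-1.

(** For s > 0 this is u (2 + u) = (1 + u)^2 - 1. *)
Definition Af : R -> R := flat (fun s => 2 + uf s).
(** For s > 0, ([B1f], [B2f]) is u * [cf] times the unit tangent (- sin, cos) of the circle at the
    current angle of the spiral. *)
Definition B1f : R -> R := flat (fun s => - (cf s * sin (Kf s))).
Definition B2f : R -> R := flat (fun s => cf s * cos (Kf s)).
Definition psi : R -> R := flat (fun=> 1).

Lemma gen_cf : gen base1 cf.
Proof.
have Gu : gen base1 (@uf R) by exact/gen_in/base1_u.
have Gk : gen base1 (@kapf R) by exact/gen_in/base1_k.
have Gc c : gen base1 (fun=> c : R) by exact: gen_cst.
apply: genM; last exact/gen_in/base1_qV.
apply: genM; last by apply: genM => //; exact: genD.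
apply: genD; last first.
  apply: genM; last exact/gen_in/base1_kV.
  apply: genM => //; apply: genD; first exact: genX.
  by apply: genM => //; apply: (@genX _ _ _ id); exact/gen_in/base1_id.
by apply: genD; apply: genN => //; exact: genM.
Qed.

Lemma gen_A : gen base1 (fun s : R => 2 + uf s).
Proof. by apply: genD; [exact: gen_cst|exact/gen_in/base1_u]. Qed.

Lemma gen_B1 : gen base1 (fun s : R => - (cf s * sin (Kf s))).
Proof. by apply: genN; apply: genM; [exact: gen_cf|exact/gen_in/base1_sin]. Qed.

Lemma gen_B2 : gen base1 (fun s : R => cf s * cos (Kf s)).
Proof. by apply: genM; [exact: gen_cf|exact/gen_in/base1_cos]. Qed.

Lemma flat_derive1 g s : gen base1 g -> s < 2^-1 ->
  is_derive s 1 (flat g) (derive1 (flat g) s).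
Proof.
move=> /flat_is_derive[h _ gh] s2; rewrite derive1E.
by case: (gh s s2) => d _; exact/derivableP.
Qed.

Lemma flat_derive1_bound g : gen base1 g ->
  exists2 C, 0 <= C & forall s, s < 2^-1 -> `|derive1 (flat g) s| <= C * s ^+ 2.
Proof.
move=> /flat_is_derive[h /flat_bound[C C0 hC] gh]; exists C => // s s2.
by rewrite derive1E; case: (gh s s2) => _ ->; exact: hC.
Qed.

Lemma psi_derive1 s : 0 < s -> s < 2^-1 -> derive1 psi s = psi s * s ^- 2.
Proof.
move=> s0 s2; have hu := has_diff_uf (lt0r_neq0 s0).
have fg : \near s, uf s = psi s.
  by near=> x; rewrite /psi /flat ifT ?mulr1//; near: x; exact: lt_nbhsr.
have [_ +] := has_diff_near fg hu; rewrite derive1E => ->.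
by rewrite mulr1 -(nbhs_singleton fg).
Unshelve. all: by end_near. Qed.

Lemma psi_ge0 s : 0 <= psi s.
Proof. by rewrite /psi /flat; case: ifP => // _; rewrite mulr1 ltW// uf_gt0. Qed.

Lemma psi_gt0 s : 0 < s -> 0 < psi s.
Proof. by rewrite /psi /flat => ->; rewrite mulr1 uf_gt0. Qed.

Lemma psi0 s : s <= 0 -> psi s = 0.
Proof. by rewrite /psi /flat leNgt => /negbTE ->. Qed.

Lemma psi_le s t : s <= t -> psi s <= psi t.
Proof.
move=> st; have [s0|s0] := leP s 0; first by rewrite psi0// psi_ge0.
have t0 := lt_le_trans s0 st.
by rewrite /psi /flat s0 t0 !mulr1 /uf ler_expR lerN2 lef_pV2.
Qed.

(* On the spiral the [B1f], [B2f] terms cancel and Phi = (1 + u)^2. The last term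
   vanishes for s^2 <= sig and makes Phi negative at s^2 = 2 sig, which closes
   the target up. *)
Definition Phi sig M (p : 'rV[R]_6) : R := 1 + Af (p 0 (o6 3)) + p 0 (o6 4) * B1f (p 0 (o6 3))
  + p 0 (o6 5) * B2f (p 0 (o6 3)) - M * psi (p 0 (o6 3) ^+ 2 - sig).

Definition Phis sig M (p : 'rV[R]_6) : R := derive1 Af (p 0 (o6 3)) +
  p 0 (o6 4) * derive1 B1f (p 0 (o6 3)) + p 0 (o6 5) * derive1 B2f (p 0 (o6 3)) -
  M * (derive1 psi (p 0 (o6 3) ^+ 2 - sig) * (2 * p 0 (o6 3))).

(** [flat_is_derive] differentiates flat functions below 1/2 only; both arguments that occur in
    [Phi] are kept there. *)
Definition ndom sig : set 'rV[R]_6 :=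
  [set p : 'rV[R]_6 | p 0 (o6 3) < 2^-1 /\ p 0 (o6 3) ^+ 2 - sig < 2^-1].

Definition nu2 (p : 'rV[R]_6) : R := p 0 (o6 0) ^+ 2 + p 0 (o6 1) ^+ 2 + p 0 (o6 2) ^+ 2.
Definition nw2 (p : 'rV[R]_6) : R := p 0 (o6 4) ^+ 2 + p 0 (o6 5) ^+ 2.

Definition Gmap sig M p : 'rV[R]_2 :=
  \row_j (if j == 0 then nu2 p - Phi sig M p else nw2 p - 1).

(** The inequality is non-strict for the sake of compactness; for admissible parameters it is never
    an equality, so that no boundary arises. *)
Definition Nset sig M : set 'rV[R]_6 :=
  [set p : 'rV[R]_6 | [/\ p 0 (o6 3) ^+ 2 <= 2 * sig, nw2 p = 1 & nu2 p = Phi sig M p]].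

Inductive base6 sig : ('rV[R]_6 -> R) -> Prop :=
| base6_coord j : base6 sig (fun p : 'rV[R]_6 => p 0 j)
| base6_flat g : gen base1 g -> base6 sig (fun p : 'rV[R]_6 => flat g (p 0 (o6 3)))
| base6_flat2 g : gen base1 g ->
    base6 sig (fun p : 'rV[R]_6 => flat g (p 0 (o6 3) ^+ 2 - sig)).

Lemma base6_closed sig : gradient_closed (ndom sig) (base6 sig).
Proof.
have Gc j : gen (base6 sig) (fun p : 'rV[R]_6 => p 0 j) by exact/gen_in/base6_coord.
move=> g [j|{}g Gg|{}g Gg].
- exists (fun p v : 'rV[R]_6 => v 0 j); split=> [p _|v]; first exact: has_diff_coord.
  exact: gen_cst.
- have [h Gh gh] := flat_is_derive Gg.
  exists (fun p v : 'rV[R]_6 => flat h (p 0 (o6 3)) * v 0 (o6 3)); split=> [p [p3 _]|v].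
    by apply: has_diff_compM; [exact: has_diff_coord|exact: gh].
  by apply: genM; [exact/gen_in/base6_flat|exact: gen_cst].
- have [h Gh gh] := flat_is_derive Gg.
  exists (fun p v : 'rV[R]_6 => flat h (p 0 (o6 3) ^+ 2 - sig) * (2 * p 0 (o6 3) ^+ 1 * v 0 (o6 3) + 0)).
  split=> [p [_ p3]|v].
    apply: (@has_diff_compM _ _ (fun p : 'rV[R]_6 => p 0 (o6 3) ^+ 2 - sig)); last exact: gh.
    by apply: has_diffD; [exact/has_diffX/has_diff_coord|exact: has_diff_cst].
  apply: genM; first exact/gen_in/base6_flat2.
  apply: genD; last exact: gen_cst.
  apply: genM; last exact: gen_cst.
  by apply: genM; [exact: gen_cst|exact: genX].
Qed.

Lemma continuous_coordv d (j : 'I_d) : continuous (fun p : 'rV[R]_d => p 0 j).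
Proof. exact: coord_continuous. Qed.

Lemma open_ndom sig : open (ndom sig).
Proof.
apply: openI.
  apply: (@open_comp _ _ (fun p : 'rV[R]_6 => p 0 (o6 3)) [set x | x < 2^-1]) => [p _|].
    exact: continuous_coordv.
  exact: open_lt.
apply: (@open_comp _ _ (fun p : 'rV[R]_6 => p 0 (o6 3) ^+ 2 - sig) [set x | x < 2^-1]) => [p _|].
  have [d _] := has_diffD (has_diffX 2 (has_diff_coord (o6 3) p)) (has_diff_cst (- sig) p).
  exact: differentiable_continuous.
exact: open_lt.
Qed.

Lemma gen_Phi sig M : gen (base6 sig) (Phi sig M).
Proof.
have Gc j : gen (base6 sig) (fun p : 'rV[R]_6 => p 0 j) by exact/gen_in/base6_coord.
apply: genD; last first.
  apply: genN; apply: genM; first exact: gen_cst.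
  exact/gen_in/base6_flat2/gen_cst.
apply: genD; last by apply: genM => //; exact/gen_in/base6_flat/gen_B2.
apply: genD; last by apply: genM => //; exact/gen_in/base6_flat/gen_B1.
by apply: genD; [exact: gen_cst|exact/gen_in/base6_flat/gen_A].
Qed.

Lemma has_diff_Phi sig M p : ndom sig p -> has_diff (Phi sig M) p
  (fun v => Phis sig M p * v 0 (o6 3) + B1f (p 0 (o6 3)) * v 0 (o6 4)
            + B2f (p 0 (o6 3)) * v 0 (o6 5)).
Proof.
move=> [p3 p3s].
have c j := has_diff_coord j p.
have fl g : gen base1 g -> has_diff (fun p : 'rV[R]_6 => flat g (p 0 (o6 3))) p
    (fun v => derive1 (flat g) (p 0 (o6 3)) * v 0 (o6 3)).
  by move=> Gg; apply: has_diff_compM; [exact: c|exact: flat_derive1].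
have ps : has_diff (fun p : 'rV[R]_6 => psi (p 0 (o6 3) ^+ 2 - sig)) p
   (fun v => derive1 psi (p 0 (o6 3) ^+ 2 - sig) * (2 * p 0 (o6 3) ^+ 1 * v 0 (o6 3) + 0)).
  apply: (@has_diff_compM _ _ (fun p : 'rV[R]_6 => p 0 (o6 3) ^+ 2 - sig)).
    by apply: has_diffD; [exact/has_diffX/has_diff_coord|exact: has_diff_cst].
  by apply: flat_derive1 => //; exact: gen_cst.
apply: has_diff_ext => [|v].
  exact: has_diffD (has_diffD (has_diffD (has_diffD (has_diff_cst _ _) (fl _ gen_A))
    (has_diffM (c _) (fl _ gen_B1))) (has_diffM (c _) (fl _ gen_B2)))
    (has_diffN (has_diffM (has_diff_cst _ _) ps)).
rewrite /Phis -/Af -/B1f -/B2f /=; ring.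
Qed.
End target.

(** * Choice of the parameters; the target is a submanifold *)

Section manifold.
Context {R : realType}.
Implicit Types (p q v : 'rV[R]_6) (s sig M : R).

Lemma open_pos (V : topologicalType) (U : set V) (h : V -> R) : open U ->
  (forall x, U x -> {for x, continuous h}) -> open (U `&` [set x | 0 < h x]).
Proof.
rewrite !openE => oU ch x [Ux hx]; near=> y; split.
  by near: y; exact: oU.
by near: y; exact: (cvgr_gt (h x) (ch x Ux)).
Unshelve. all: by end_near. Qed.

Lemma nw2_le1 p : nw2 p = 1 -> `|p 0 (o6 4)| <= 1 /\ `|p 0 (o6 5)| <= 1.
Proof.
rewrite /nw2 => h; rewrite !ler_norml; have := sqr_ge0 (p 0 (o6 4)); have := sqr_ge0 (p 0 (o6 5)).
by split; nra.
Qed.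

(** The third condition rules out a boundary. The fourth keeps the defining map a submersion where
    the sphere |p|^2 = Phi shrinks to a point and d|p|^2 vanishes. *)
Definition admissible sig M : Prop :=
  [/\ 0 < sig, sig <= 16^-1, forall p, Nset sig M p -> p 0 (o6 3) ^+ 2 < 2 * sig
    & forall p, Nset sig M p -> nu2 p = 0 -> Phis sig M p <> 0].

Lemma small_sqr s sig : sig <= 16^-1 -> s ^+ 2 <= 2 * sig -> s < 2^-1.
Proof. by move=> sig16 s2; nra. Qed.

Lemma Nset_ndom sig p : sig <= 16^-1 -> p 0 (o6 3) ^+ 2 <= 2 * sig -> ndom sig p.
Proof. by move=> h s2; split; [exact: small_sqr s2|lra]. Qed.

Lemma mulr_le_bound (a b e : R) : `|a| <= 1 -> `|b| <= e -> `|a * b| <= e.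
Proof. by move=> a1 be; rewrite normrM; have := normr_ge0 a; have := normr_ge0 b; nra. Qed.

(** The flat corrections to Phi and their s-derivatives are O(s^2), hence small on s^2 <= 2 sig if
    sig is. The barrier M psi (s^2 - sig) then decides: it makes Phi negative at s^2 = 2 sig, and
    wherever Phi vanishes its slope dominates, because psi' / psi = 1 / x^2 is large. *)
Lemma exists_admissible : exists sig M, admissible sig M.
Proof.
have [C1 C10 h1] := flat_bound (@gen_A R); have [C2 C20 h2] := flat_bound (@gen_B1 R).
have [C3 C30 h3] := flat_bound (@gen_B2 R).
have [C4 C40 h4] := flat_derive1_bound (@gen_A R).
have [C5 C50 h5] := flat_derive1_bound (@gen_B1 R).
have [C6 C60 h6] := flat_derive1_bound (@gen_B2 R).
pose C := C1 + C2 + C3 + C4 + C5 + C6.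
(* Chosen so that C * (2 sig) <= 1/10: each of the three corrections is at most 1/10, their sum at
   most 3/10. *)
pose sig := (16 + 20 * C)^-1; have C0 : 0 <= C by rewrite /C; lra.
have D0 : 0 < 16 + 20 * C by lra.
have sig0 : 0 < sig by rewrite invr_gt0.
have sigC : C * (2 * sig) <= 10^-1.
  by rewrite mulrA ler_pdivrMr//; lra.
have sig16 : sig <= 16^-1 by rewrite lef_pV2 ?posrE//; lra.
have bnd (Ci : R) s (x : R) : 0 <= Ci -> Ci <= C -> s ^+ 2 <= 2 * sig -> `|x| <= Ci * s ^+ 2 ->
    `|x| <= 10^-1.
  move=> Ci0 CiC s2 /le_trans; apply; apply: le_trans sigC.
  by apply: ler_pM => //; exact: sqr_ge0.
have p2 : 0 < psi (sig / 2) by rewrite psi_gt0// divr_gt0.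
(* At s^2 = 2 sig the barrier is M psi (sig) >= 4, while the rest of Phi is at most 13/10. *)
pose M := 4 / psi (sig / 2).
have M0 : 0 < M by rewrite divr_gt0.
exists sig, M.
have NB p : Nset sig M p -> let s := p 0 (o6 3) in
  [/\ `|Af s + p 0 (o6 4) * B1f s + p 0 (o6 5) * B2f s| <= 3 / 10 &
      `|derive1 Af s + p 0 (o6 4) * derive1 B1f s + p 0 (o6 5) * derive1 B2f s| <= 3 / 10].
  move=> [s2 /nw2_le1[w1 w2] _] s; have sl : s < 2^-1 by exact: small_sqr s2.
  have a1 := bnd C1 s _ C10 _ s2 (h1 s sl); have a2 := bnd C2 s _ C20 _ s2 (h2 s sl).
  have a3 := bnd C3 s _ C30 _ s2 (h3 s sl); have a4 := bnd C4 s _ C40 _ s2 (h4 s sl).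
  have a5 := bnd C5 s _ C50 _ s2 (h5 s sl); have a6 := bnd C6 s _ C60 _ s2 (h6 s sl).
  have {}a1 := a1 ltac:(rewrite /C; lra); have {}a2 := mulr_le_bound w1 (a2 ltac:(rewrite /C; lra)).
  have {}a3 := mulr_le_bound w2 (a3 ltac:(rewrite /C; lra)); have {}a4 := a4 ltac:(rewrite /C; lra).
  have {}a5 := mulr_le_bound w1 (a5 ltac:(rewrite /C; lra)).
  have {}a6 := mulr_le_bound w2 (a6 ltac:(rewrite /C; lra)).
  split; apply: le_trans (ler_normD _ _) _.
    have := ler_normD (Af s) (p 0 (o6 4) * B1f s).
    rewrite -/Af -/B1f -/B2f in a1 a2 a3; lra.
  have := ler_normD (derive1 Af s) (p 0 (o6 4) * derive1 B1f s).
  rewrite -/Af -/B1f -/B2f in a4 a5 a6; lra.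
have nu0 p : 0 <= nu2 p by rewrite /nu2 !addr_ge0 ?sqr_ge0.
split=> //.
- move=> p Np; have [s2 _ ueq] := Np; rewrite lt_neqAle s2 andbT.
  apply/eqP => s2E; have [+ _] := NB p Np; rewrite ler_norml => /andP[_ h].
  have : 4 <= M * psi (p 0 (o6 3) ^+ 2 - sig).
    rewrite -ler_pdivrMl// /M invfM invrK mulrC mulrA mulfV ?mul1r//.
    by rewrite psi_le// s2E; lra.
  by have := nu0 p; rewrite ueq /Phi; lra.
- move=> p Np u0; have [h1' h2'] := NB p Np; have [s2 _ ueq] := Np.
  move: h1' h2'; set s := p 0 (o6 3); set x := s ^+ 2 - sig.
  rewrite !ler_norml => /andP[e1 e2] /andP[d1 d2].
  have Mp : 7 / 10 <= M * psi x.
    by move: ueq; rewrite u0 /Phi -/s -/x; lra.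
  have x0 : 0 < x.
    rewrite ltNge; apply/negP => /psi0 px; move: Mp; rewrite px mulr0; lra.
  have xsig : x <= sig by rewrite /x; rewrite -/s in s2; lra.
  rewrite /Phis -/s -/x psi_derive1//; last by lra.
  (* Since x <= |s| and x <= 1, one has 2 |s| >= x^2, so the slope of the barrier is at least M psi
     x >= 7/10 in absolute value. *)
  have Q : 3 / 10 < `|M * (psi x / x ^+ 2 * (2 * s))|.
    have s0 : x <= `|s|.
      have : x <= `|s| ^+ 2 by rewrite real_normK ?num_real// /x; lra.
      by have := normr_ge0 s; nra.
    have -> : M * (psi x / x ^+ 2 * (2 * s)) = (M * psi x) * ((x ^+ 2)^-1 * (2 * s)) by ring.
    have -> : `|M * psi x * ((x ^+ 2)^-1 * (2 * s))| = M * psi x * ((x ^+ 2)^-1 * (2 * `|s|)).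
      rewrite normrM ger0_norm; last by rewrite mulr_ge0 ?psi_ge0// ltW.
      by rewrite normrM ger0_norm ?invr_ge0 ?sqr_ge0// normrM ger0_norm.
    have : 1 <= (x ^+ 2)^-1 * (2 * `|s|).
      rewrite ler_pdivlMl ?exprn_gt0// mulr1.
      by nra.
    move: (M * psi x) Mp (_ * (2 * `|s|)) => a a7 b b1; nra.
  move=> h; have : `|M * (psi x / x ^+ 2 * (2 * s))| <= 3 / 10.
    by rewrite ler_norml; move: h => /eqP; rewrite subr_eq0 => /eqP <-; rewrite d1 d2.
  by rewrite leNgt Q.
Qed.

Definition dnu2 p v : R := 2 * (p 0 (o6 0) * v 0 (o6 0) + p 0 (o6 1) * v 0 (o6 1) + p 0 (o6 2) * v 0 (o6 2)).
Definition dnw2 p v : R := 2 * (p 0 (o6 4) * v 0 (o6 4) + p 0 (o6 5) * v 0 (o6 5)).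
Definition dPhi sig M p v : R := Phis sig M p * v 0 (o6 3)
  + B1f (p 0 (o6 3)) * v 0 (o6 4) + B2f (p 0 (o6 3)) * v 0 (o6 5).

Lemma has_diff_nu2 p : has_diff nu2 p (dnu2 p).
Proof.
have c k := has_diffX 2 (has_diff_coord (o6 k) p).
by apply: has_diff_ext (has_diffD (has_diffD (c 0) (c 1)) (c 2)) _ => v; rewrite /dnu2/=; ring.
Qed.

Lemma has_diff_nw2 p : has_diff nw2 p (dnw2 p).
Proof.
have c k := has_diffX 2 (has_diff_coord (o6 k) p).
by apply: has_diff_ext (has_diffD (c 4) (c 5)) _ => v; rewrite /dnw2/=; ring.
Qed.

Lemma has_diff_Gmap sig M p : ndom sig p -> has_diff (Gmap sig M) p
  (fun v => \row_j (if j == 0 then dnu2 p v - dPhi sig M p v else dnw2 p v)).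
Proof.
move=> Dp; apply: has_diff_rV => j; case: (eqVneq j 0) => j0.
  rewrite (_ : (fun y => _) = fun p => nu2 p - Phi sig M p); last first.
    by apply/funext => q; rewrite mxE j0.
  apply: has_diff_ext (has_diffD (has_diff_nu2 p) (has_diffN (has_diff_Phi M Dp))) _ => v.
  by rewrite mxE j0.
rewrite (_ : (fun y => _) = fun p => nw2 p - 1); last first.
  by apply/funext => q; rewrite mxE (negbTE j0).
apply: has_diff_ext (has_diffD (has_diff_nw2 p) (has_diff_cst _ _)) _ => v.
by rewrite mxE (negbTE j0) addr0.
Qed.

Lemma smooth_Gmap sig M : smooth_on (ndom sig) (Gmap sig M).
Proof.
have Gc j n : gen (base6 sig) (fun p => p 0 j ^+ n).
  by apply: genX; exact/gen_in/base6_coord.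
apply: smooth_on_rV => [|j]; first exact: open_ndom.
apply: gen_smooth (@open_ndom _ _) (@base6_closed _ _) _.
case: (eqVneq j 0) => j0.
  rewrite (_ : (fun y => _) = fun p => nu2 p - Phi sig M p); last first.
    by apply/funext => q; rewrite mxE j0.
  apply: genD; last exact/genN/gen_Phi.
  by do ?apply: genD.
rewrite (_ : (fun y => _) = fun p => nw2 p - 1); last first.
  by apply/funext => q; rewrite mxE (negbTE j0).
by apply: genD; [exact: genD|exact: gen_cst].
Qed.

(** [Phis] is the derivative of the smooth function [Phi] along the s-axis. *)
Lemma continuous_Phis sig M p : ndom sig p -> {for p, continuous (Phis sig M)}.
Proof.
move=> Dp.
have sP : smooth_on (ndom sig) (Phi sig M).
  exact: gen_smooth (@open_ndom _ _) (@base6_closed _ _) (gen_Phi _ _).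
have c0 : Ck 0 (ndom sig) ('D_(vec6 0 0 0 1 0 0) (Phi sig M)) := proj2 (sP 1) _.
suff c1 : Ck 0 (ndom sig) (Phis sig M) by exact: c1.
apply: Ck_eq c0; first exact: open_ndom.
move=> q Dq; have [_ ->] := has_diff_Phi M Dq.
by rewrite !vec6E mulr1 !mulr0 !addr0.
Qed.

Lemma has_diff_surj (f : 'rV[R]_6 -> 'rV[R]_2) q L : has_diff f q L ->
  (forall w, exists v, L v = w) -> forall w, exists v, 'd f q v = w.
Proof.
by move=> [df fL] sL w; have [v <-] := sL w; exists v; rewrite -deriveE// fL.
Qed.

Lemma submanifold_N sig M : admissible sig M -> submanifold 4 (Nset sig M).
Proof.
move=> [sig0 sig16 Ns NP]; exists 2; first by [].
move=> p Np; have [p3 pw pu] := Np.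
(* The inequalities keep the constraint on s inactive and the differential of [Gmap] onto. *)
pose U := ndom sig `&` [set q | 0 < 2 * sig - q 0 (o6 3) ^+ 2]
  `&` [set q | 0 < nw2 q] `&` [set q | 0 < nu2 q + Phis sig M q ^+ 2].
exists U, (Gmap sig M).
have nu0 q : 0 <= nu2 q by rewrite /nu2 !addr_ge0 ?sqr_ge0.
have oU : open U.
  apply: open_pos; first apply: open_pos; first apply: open_pos.
  - exact: open_ndom.
  - move=> q _; have [d _] := has_diffD (has_diff_cst (2 * sig) q) (has_diffN (has_diffX 2 (has_diff_coord (o6 3) q))).
    exact: differentiable_continuous.
  - by move=> q _; apply: differentiable_continuous; case: (has_diff_nw2 q).
  - move=> q [[Dq _] _]; apply: continuousD.
      by apply: differentiable_continuous; case: (has_diff_nu2 q).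
    by apply: (@continuousM _ _ (Phis sig M) (Phis sig M)); exact: continuous_Phis.
split=> //.
- split; last first.
    rewrite /= lt_def addr_ge0 ?sqr_ge0 ?nu0// andbT paddr_eq0 ?sqr_ge0//.
    by apply/negP => /andP[/eqP u0]; rewrite sqrf_eq0 => /eqP; exact: NP.
  split; last by rewrite /= pw.
  split; first exact: Nset_ndom.
  by rewrite /= subr_gt0; exact: Ns.
- by move=> k; apply: Ck_sub (smooth_Gmap sig M k) => q [[[]]].
- move=> q [[[Dq q3] qw] qu]; apply: (has_diff_surj (has_diff_Gmap M Dq)) => w.
  (* Scaling the two circle coordinates by b produces the second component of w and shifts the first
     one by - dw. Moving k times along (q0, q1, q2, - Phis) then adjusts the first component at the
     rate 2 nu2 + Phis^2 and leaves the second one alone. *)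
  pose b := w 0 1 / (2 * nw2 q).
  pose dw := B1f (q 0 (o6 3)) * (b * q 0 (o6 4)) + B2f (q 0 (o6 3)) * (b * q 0 (o6 5)).
  pose k := (w 0 0 + dw) / (2 * nu2 q + Phis sig M q ^+ 2).
  exists (vec6 (k * q 0 (o6 0)) (k * q 0 (o6 1)) (k * q 0 (o6 2)) (- k * Phis sig M q)
    (b * q 0 (o6 4)) (b * q 0 (o6 5))).
  apply/rowP => j; rewrite mxE /dnu2 /dnw2 /dPhi !vec6E.
  have P0 : 2 * nu2 q + Phis sig M q ^+ 2 != 0.
    by rewrite gt_eqF//; have := nu0 q; rewrite /= in qu; lra.
  case: (eqVneq j 0) => [->|j0].
    transitivity (k * (2 * nu2 q + Phis sig M q ^+ 2) - dw).
      by rewrite /dw /nu2; ring.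
    by rewrite /k divfK// addrK.
  have -> : j = 1 by apply/val_inj; case: j j0 => -[|[|]].
  transitivity (b * (2 * nw2 q)); first by rewrite /nw2; ring.
  by rewrite /b divfK// mulf_neq0// gt_eqF.
- apply/seteqP; split=> [q [[q3 qw qu] Uq]|q [Uq G0]]; split=> //.
    apply/rowP => j; rewrite !mxE; case: ifP => _; first by rewrite qu subrr.
    by rewrite qw subrr.
  have [[[_ /ltW q3] _] _] := Uq; split; first by move: q3; rewrite subr_ge0.
    by have /rowP/(_ 1) := G0; rewrite !mxE /= => /eqP; rewrite subr_eq0 => /eqP.
  by have /rowP/(_ 0) := G0; rewrite !mxE /= => /eqP; rewrite subr_eq0 => /eqP.
Qed.
End manifold.

(** * Compactness and tangent vectors of the target *)

Section target_geometry.
Context {R : realType}.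
Implicit Types (p q v : 'rV[R]_6) (s sig M : R).

(** Continuity of [Gmap] is available on [ndom] only. The closed condition on s therefore passes to
    the limit first, and places the limit point in [ndom]; the two equations follow by continuity
    there. *)
Lemma closed_N sig M : sig <= 16^-1 -> closed (Nset sig M).
Proof.
move=> sig16.
have cs : closed [set p : 'rV[R]_6 | p 0 (o6 3) ^+ 2 <= 2 * sig].
  apply: (@closed_comp _ _ (fun p : 'rV[R]_6 => p 0 (o6 3) ^+ 2) [set x | x <= 2 * sig]); last exact: closed_le.
  move=> p _; have [d _] := has_diffX 2 (has_diff_coord (o6 3) p).
  exact: differentiable_continuous.
move=> p clp.
have s2 : p 0 (o6 3) ^+ 2 <= 2 * sig.
  by apply: cs; apply: closureS clp => q [].
have Dp := Nset_ndom sig16 s2.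
have cG : {for p, continuous (Gmap sig M)}.
  by apply: differentiable_continuous; case: (has_diff_Gmap M Dp).
suff G0 : Gmap sig M p = 0.
  split=> //; first by have /rowP/(_ 1) := G0; rewrite !mxE /= => /eqP; rewrite subr_eq0 => /eqP.
  by have /rowP/(_ 0) := G0; rewrite !mxE /= => /eqP; rewrite subr_eq0 => /eqP.
have : closed [set (0 : 'rV[R]_2)] by exact/accessible_closed_set1/hausdorff_accessible/norm_hausdorff.
apply; move=> B /cG nB; have [q [Nq Bq]] := clp _ nB.
exists (Gmap sig M q); split=> //=.
case: Nq => _ qw qu; apply/rowP => j; rewrite !mxE.
by case: ifP => _; rewrite ?qu ?qw subrr.
Qed.

Lemma bounded_N sig M : sig <= 16^-1 -> bounded_set (Nset sig M).
Proof.
move=> sig16.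
have [C1 C10 h1] := flat_bound (@gen_A R); have [C2 C20 h2] := flat_bound (@gen_B1 R).
have [C3 C30 h3] := flat_bound (@gen_B2 R).
have [C4 C40 h4] := flat_bound (@gen_cst R _ (@base1 R) 1).
pose B : R := 1 + C1 + C2 + C3 + `|M| * C4.
have B0 : 1 <= B by rewrite /B -!addrA lerDl !addr_ge0// mulr_ge0.
exists B; split; first exact: num_real.
move=> b Bb p Np; have [s2 /[dup] pw /nw2_le1[w1 w2] pu] := Np.
have [s12 x12] := Nset_ndom sig16 s2.
set s := p 0 (o6 3) in s2 s12 x12; pose x := s ^+ 2 - sig.
have sq := sqr_ge0 s; have sig0 : 0 <= sig by lra.
have PB : Phi sig M p <= B.
  rewrite /Phi -/s -/x.
  have le1 (C y z : R) : 0 <= C -> y ^+ 2 <= 1 -> `|z| <= C * y ^+ 2 -> `|z| <= C.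
    by move=> C0 y1 /le_trans; apply; rewrite ler_piMr.
  have s1 : s ^+ 2 <= 1 by lra.
  have x1 : x ^+ 2 <= 1 by rewrite /x; nra.
  have a1 := le1 _ _ _ C10 s1 (h1 s s12).
  have a2 := mulr_le_bound w1 (le1 _ _ _ C20 s1 (h2 s s12)).
  have a3 := mulr_le_bound w2 (le1 _ _ _ C30 s1 (h3 s s12)).
  have a4 : `|M * psi x| <= `|M| * C4.
    by rewrite normrM ler_wpM2l//; exact: le1 C40 x1 (h4 x x12).
  move: a1 a2 a3 a4; rewrite -/Af -/B1f -/B2f !ler_norml /B.
  by move=> /andP[_ ?] /andP[_ ?] /andP[_ ?] /andP[? _]; lra.
have sqB (y : R) : y ^+ 2 <= B -> `|y| <= B.
  by move=> y2; have := normr_ge0 y; move: y2; rewrite -real_normK ?num_real//; nra.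
rewrite /= [leLHS]/Num.Def.normr/= mx_normrE (bigmax_le _ _)//=; first by lra.
move=> [i j] _ /=; rewrite (ord1 i); apply: le_trans (ltW Bb).
move: j; apply: forall_ord6; last first.
- by apply: le_trans B0.
- by apply: le_trans B0.
- by apply: sqB; rewrite -/s; lra.
all: apply: sqB; apply: le_trans PB; rewrite -pu /nu2.
all: have := sqr_ge0 (p 0 (o6 0)); have := sqr_ge0 (p 0 (o6 1)); have := sqr_ge0 (p 0 (o6 2)); lra.
Qed.

Lemma compact_N sig M : sig <= 16^-1 -> compact (Nset sig M).
Proof.
by move=> h; apply: bounded_closed_compact; [exact: bounded_N|exact: closed_N].
Qed.

Lemma derive_along (V W : normedModType R) (c : R -> V) (g : V -> W) L :
  differentiable c 0 -> has_diff g (c 0) L -> 'D_1 (g \o c) 0 = L (derive1 c 0).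
Proof.
move=> dc [dg gL]; rewrite deriveE; last exact: differentiable_comp.
by rewrite diff_comp//= -gL derive1E (deriveE _ dg) (deriveE _ dc).
Qed.

(** [nu2 - Phi] and [nw2] are constant along every curve in the target, so their differentials
    annihilate its velocity. *)
Lemma tangent_N sig M p v : sig <= 16^-1 -> tangent_space (Nset sig M) p v ->
  dnu2 p v = dPhi sig M p v /\ dnw2 p v = 0.
Proof.
move=> sig16 [e [c [e0 sc Nc c0 cv]]].
have dc : differentiable c 0.
  by have [+ _] := sc 1; apply; rewrite /= normr0.
have Np : Nset sig M p by rewrite -c0; apply: Nc; rewrite normr0.
have Dp : ndom sig p by apply: Nset_ndom => //; case: Np.
have nc : \forall t \near (0 : R), Nset sig M (c t).
  near=> t; apply: Nc; near: t; apply/nbhs_normP; exists e => //= t /=.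
  by rewrite sub0r normrN.
have c0D : ndom sig (c 0) by rewrite c0.
have d0 (g : 'rV[R]_6 -> R) L k : has_diff g (c 0) L -> (forall q, Nset sig M q -> g q = k) ->
    L v = 0.
  move=> gL gk; rewrite -cv -(derive_along dc gL).
  transitivity ('D_1 (cst k : R -> R) (0 : R)); last exact: derive_cst.
  apply: near_eq_derive.
  by near=> t; apply: gk; near: t; exact: nc.
split.
  have := d0 _ _ 0 (has_diffD (has_diff_nu2 (c 0)) (has_diffN (has_diff_Phi M c0D))).
  rewrite c0 => /(_ _)/eqP; rewrite subr_eq0 => h; apply/eqP; apply: h.
  by move=> q [_ _ ->]; rewrite subrr.
have := d0 _ _ 1 (has_diff_nw2 (c 0)).
by rewrite c0; apply => q [].
Unshelve. all: by end_near. Qed.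
End target_geometry.

(** * The singular map *)

Section space.
Context {R : realType}.
Implicit Types (x y v : R3 R) (T t r : R).

Definition dot3 x v : R := x.1.1 * v.1.1 + x.1.2 * v.1.2 + x.2 * v.2.

Lemma has_diff_x1 x : has_diff (fun x : R3 R => x.1.1) x (fun v => v.1.1).
Proof.
have h : linear (fun x : R3 R => x.1.1) by [].
pose f : {linear R3 R -> R} := HB.pack (fun x : R3 R => x.1.1) (GRing.isLinear.Build _ _ _ _ _ h).
apply: (@has_diff_lin _ _ _ f) => y /=; apply: (@cvg_comp _ _ _ fst fst); exact: cvg_fst.
Qed.

Lemma has_diff_x2 x : has_diff (fun x : R3 R => x.1.2) x (fun v => v.1.2).
Proof.
have h : linear (fun x : R3 R => x.1.2) by [].
pose f : {linear R3 R -> R} := HB.pack (fun x : R3 R => x.1.2) (GRing.isLinear.Build _ _ _ _ _ h).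
by apply: (@has_diff_lin _ _ _ f) => y /=; apply: (@cvg_comp _ _ _ fst snd); [exact: cvg_fst|exact: cvg_snd].
Qed.

Lemma has_diff_x3 x : has_diff (fun x : R3 R => x.2) x (fun v => v.2).
Proof.
have h : linear (fun x : R3 R => x.2) by [].
pose f : {linear R3 R -> R} := HB.pack (fun x : R3 R => x.2) (GRing.isLinear.Build _ _ _ _ _ h).
by apply: (@has_diff_lin _ _ _ f) => y /=; exact: cvg_snd.
Qed.

Lemma has_diff_dot3 x w : has_diff (fun x => dot3 x w) x (fun v => dot3 v w).
Proof.
apply: has_diff_ext (has_diffD (has_diffD (has_diffM (has_diff_x1 x) (has_diff_cst _ _))
  (has_diffM (has_diff_x2 x) (has_diff_cst _ _))) (has_diffM (has_diff_x3 x) (has_diff_cst _ _))) _ => v.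
by rewrite /dot3 /=; ring.
Qed.

Lemma enormE x : enorm x = Num.sqrt (dot3 x x).
Proof. by rewrite /enorm /dot3 -!expr2. Qed.

Lemma dot3_ge0 x : 0 <= dot3 x x.
Proof. by rewrite /dot3 -!expr2 !addr_ge0 ?sqr_ge0. Qed.

Lemma enorm_sqr x : enorm x ^+ 2 = dot3 x x.
Proof. by rewrite enormE sqr_sqrtr ?dot3_ge0. Qed.

Lemma enorm_ge0 x : 0 <= enorm x.
Proof. exact: sqrtr_ge0. Qed.

Lemma enorm0 : enorm (0 : R3 R) = 0.
Proof. by rewrite /enorm /= !expr0n /= !addr0 sqrtr0. Qed.

Lemma enorm_gt0 x : (0 < enorm x) = (x != 0).
Proof.
rewrite lt_def enorm_ge0 andbT; congr (~~ _).
apply/idP/eqP => [|->]; last by rewrite enorm0.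
rewrite -sqrf_eq0 enorm_sqr /dot3 -!expr2 => h.
have := sqr_ge0 x.1.1; have := sqr_ge0 x.1.2; have := sqr_ge0 x.2 => h1 h2 h3.
move: h; rewrite !paddr_eq0 ?addr_ge0// !sqrf_eq0.
by case: x h1 h2 h3 => [[a b] c] /= _ _ _ /andP[/andP[/eqP-> /eqP->] /eqP->].
Qed.

Lemma enormZ t x : 0 <= t -> enorm (t *: x) = t * enorm x.
Proof.
move=> t0; rewrite /enorm -[X in _ = X * _](ger0_norm t0) -sqrtr_sqr -sqrtrM ?sqr_ge0//.
by congr Num.sqrt; rewrite /= /GRing.scale /=; ring.
Qed.

Definition ri x : R := (enorm x)^-1.

Lemma ri_dot3 x : x != 0 -> ri x ^+ 2 * dot3 x x = 1.
Proof.
rewrite -enorm_gt0 => x0; rewrite -enorm_sqr /ri exprVn mulVf//.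
by rewrite expf_neq0// gt_eqF.
Qed.

Lemma ri_ge0 x : 0 <= ri x.
Proof. by rewrite invr_ge0 enorm_ge0. Qed.

Lemma has_diff_enorm x : x != 0 -> has_diff (@enorm R) x (fun v => ri x * dot3 x v).
Proof.
move=> x0; have e0 : 0 < enorm x by rewrite enorm_gt0.
have -> : @enorm R = fun x => Num.sqrt (dot3 x x) by apply/funext => y; rewrite enormE.
have d : has_diff (fun x => dot3 x x) x (fun v => 2 * dot3 x v).
  apply: has_diff_ext (has_diffD (has_diffD (has_diffM (has_diff_x1 x) (has_diff_x1 x))
    (has_diffM (has_diff_x2 x) (has_diff_x2 x))) (has_diffM (has_diff_x3 x) (has_diff_x3 x))) _ => v.
  by rewrite /dot3; ring.
apply: has_diff_ext (has_diff_sqrt _ d) _ => [|v]; first by rewrite -enorm_sqr exprn_gt0.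
by rewrite -enormE /ri; field; rewrite gt_eqF.
Qed.

Lemma has_diff_ri x : x != 0 -> has_diff ri x (fun v => - ri x ^+ 3 * dot3 x v).
Proof.
move=> x0; have e0 : 0 < enorm x by rewrite enorm_gt0.
apply: has_diff_ext (has_diffV _ (has_diff_enorm x0)) _ => [|v]; first by rewrite gt_eqF.
by rewrite /ri; field; rewrite gt_eqF.
Qed.

Definition rtime T x : R := T - ln (enorm x).
Definition ut T x : R := (rtime T x)^-1.
Definition st T x : R := (ln (rtime T x))^-1.

Definition spiral_dom T : set (R3 R) := [set x | x != 0 /\ expR 2 < rtime T x].

Lemma has_diff_rtime T x : x != 0 -> has_diff (rtime T) x (fun v => - (ri x ^+ 2 * dot3 x v)).
Proof.
move=> x0; have e0 : 0 < enorm x by rewrite enorm_gt0.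
apply: has_diff_ext (has_diffD (has_diff_cst T x) (has_diffN (has_diff_ln e0 (has_diff_enorm x0)))) _ => v.
by rewrite -/(ri x); ring.
Qed.

Lemma spiral_dom_facts T x : spiral_dom T x ->
  [/\ x != 0, 0 < rtime T x, 0 < ln (rtime T x), I2 (st T x) & uf (st T x) = ut T x].
Proof.
move=> [x0 t2]; have t0 : 0 < rtime T x by exact: lt_trans (expR_gt0 _) t2.
have l2 : 2 < ln (rtime T x) by rewrite -(expRK 2) ltr_ln ?posrE ?expR_gt0.
have l0 : 0 < ln (rtime T x) by exact: lt_trans l2.
split=> //; last by rewrite /uf /st invrK expRN lnK.
by rewrite /I2/= /st invr_gt0 l0 ltf_pV2 ?posrE.
Qed.

Lemma has_diff_ut T x : spiral_dom T x ->
  has_diff (ut T) x (fun v => ut T x ^+ 2 * (ri x ^+ 2 * dot3 x v)).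
Proof.
move=> /spiral_dom_facts[x0 t0 _ _ _].
apply: has_diff_ext (has_diffV _ (has_diff_rtime T x0)) _ => [|v]; first by rewrite gt_eqF.
by rewrite /ut -exprVn; ring.
Qed.

Lemma has_diff_st T x : spiral_dom T x ->
  has_diff (st T) x (fun v => st T x ^+ 2 * ut T x * (ri x ^+ 2 * dot3 x v)).
Proof.
move=> /spiral_dom_facts[x0 t0 l0 _ _].
apply: has_diff_ext (has_diffV _ (has_diff_ln t0 (has_diff_rtime T x0))) _ => [|v]; first by rewrite gt_eqF.
by rewrite /st /ut -exprVn; ring.
Qed.

Definition kt T x : R := kapf (st T x).

Lemma kt_neq0 T x : spiral_dom T x -> kt T x != 0.
Proof. by move=> /spiral_dom_facts[_ _ _ /kapf_ge + _]; apply: contraTneq; rewrite /kt => ->; lra. Qed.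

Lemma st_neq0 T x : spiral_dom T x -> st T x != 0.
Proof. by move=> /spiral_dom_facts[_ _ _ /andP[+ _] _] => ?; rewrite gt_eqF. Qed.

Lemma has_diff_kt T x : spiral_dom T x -> has_diff (kt T) x (fun v =>
  - (ut T x ^+ 2 + 2 * st T x ^+ 5) * (kt T x)^-1 * ut T x * (ri x ^+ 2 * dot3 x v)).
Proof.
move=> Ox; have [x0 t0 l0 Is us] := spiral_dom_facts Ox.
apply: has_diff_ext (has_diff_compM (has_diff_st Ox) (has_diff_is_derive (1 : R) (has_diff_kapf Is))) _ => v.
rewrite -/(kt T x) us; have := kt_neq0 Ox; have := st_neq0 Ox => s0 k0.
by field; rewrite s0 k0.
Qed.

Lemma has_diff_cost T x : spiral_dom T x -> has_diff (fun x => cos (Kf (st T x))) x (fun v =>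
  sin (Kf (st T x)) * kt T x * ut T x * (ri x ^+ 2 * dot3 x v)).
Proof.
move=> Ox; have [x0 t0 l0 Is us] := spiral_dom_facts Ox.
apply: has_diff_ext (has_diff_cos (has_diff_compM (has_diff_st Ox) (has_diff_is_derive (1 : R) (has_diff_Kf Is)))) _ => v.
by rewrite -/(kt T x); have s0 := st_neq0 Ox; field.
Qed.

Lemma has_diff_sint T x : spiral_dom T x -> has_diff (fun x => sin (Kf (st T x))) x (fun v =>
  - (cos (Kf (st T x)) * kt T x * ut T x * (ri x ^+ 2 * dot3 x v))).
Proof.
move=> Ox; have [x0 t0 l0 Is us] := spiral_dom_facts Ox.
apply: has_diff_ext (has_diff_sin (has_diff_compM (has_diff_st Ox) (has_diff_is_derive (1 : R) (has_diff_Kf Is)))) _ => v.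
by rewrite -/(kt T x); have s0 := st_neq0 Ox; field.
Qed.

Lemma continuous_dot3 : continuous (fun x => dot3 x x).
Proof.
move=> x; apply: differentiable_continuous.
by have [] := has_diffD (has_diffD (has_diffM (has_diff_x1 x) (has_diff_x1 x))
    (has_diffM (has_diff_x2 x) (has_diff_x2 x))) (has_diffM (has_diff_x3 x) (has_diff_x3 x)).
Qed.

Lemma continuous_enorm : continuous (@enorm R).
Proof.
have -> : @enorm R = fun x => Num.sqrt (dot3 x x) by apply/funext => y; rewrite enormE.
move=> x; apply: continuous_comp; first exact: continuous_dot3.
exact: sqrt_continuous.
Qed.

Lemma open_punctured : open [set x : R3 R | x != 0].
Proof.
have -> : [set x : R3 R | x != 0] = [set: R3 R] `&` [set x | 0 < enorm x].
  by apply/seteqP; split=> [x /=|x [_ /=]]; rewrite enorm_gt0.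
by apply: open_pos; [exact: openT|move=> x _; exact: continuous_enorm].
Qed.

Lemma open_spiral_dom T : open (spiral_dom T).
Proof.
have -> : spiral_dom T = [set x | x != 0] `&` [set x | 0 < rtime T x - expR 2].
  by apply/seteqP; split=> x [x0] /=; rewrite subr_gt0.
apply: open_pos; first exact: open_punctured.
move=> x x0; have [d _] := has_diffD (has_diff_rtime T x0) (has_diff_cst (- expR 2) x).
exact: differentiable_continuous.
Qed.

Inductive base3 T : (R3 R -> R) -> Prop :=
| base3_x w : base3 T (fun x => dot3 x w)
| base3_ri : base3 T ri
| base3_u : base3 T (ut T)
| base3_s : base3 T (st T)
| base3_k : base3 T (kt T)
| base3_kV : base3 T (fun x => (kt T x)^-1)
| base3_cos : base3 T (fun x => cos (Kf (st T x)))
| base3_sin : base3 T (fun x => sin (Kf (st T x))).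

Lemma base3_closed T : gradient_closed (spiral_dom T) (base3 T).
Proof.
have Gx w : gen (base3 T) (fun x => dot3 x w) by exact/gen_in/base3_x.
have Gri n : gen (base3 T) (fun x => ri x ^+ n) by exact/genX/gen_in/base3_ri.
have Gu : gen (base3 T) (ut T) by exact/gen_in/base3_u.
have Gs : gen (base3 T) (st T) by exact/gen_in/base3_s.
have Gk : gen (base3 T) (kt T) by exact/gen_in/base3_k.
have GkV : gen (base3 T) (fun x => (kt T x)^-1) by exact/gen_in/base3_kV.
have Gcos : gen (base3 T) (fun x => cos (Kf (st T x))) by exact/gen_in/base3_cos.
have Gsin : gen (base3 T) (fun x => sin (Kf (st T x))) by exact/gen_in/base3_sin.
have Gr v : gen (base3 T) (fun x => ri x ^+ 2 * dot3 x v) by exact: genM.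
have GkD v : gen (base3 T) (fun x => - (ut T x ^+ 2 + 2 * st T x ^+ 5) * (kt T x)^-1 * ut T x * (ri x ^+ 2 * dot3 x v)).
  apply: genM => //; apply: genM => //; apply: genM => //; apply: genN.
  apply: genD; first exact: genX.
  by apply: genM; [exact: gen_cst|exact: genX].
move=> g [w| | | | | | |].
- exists (fun _ v => dot3 v w); split=> [x _|v]; first exact: has_diff_dot3.
  exact: gen_cst.
- exists (fun x v => - ri x ^+ 3 * dot3 x v); split=> [x [x0 _]|v]; first exact: has_diff_ri.
  by apply: genM => //; exact: genN.
- exists (fun x v => ut T x ^+ 2 * (ri x ^+ 2 * dot3 x v)); split=> [x Ox|v]; first exact: has_diff_ut.
  by apply: genM => //; exact: genX.
- exists (fun x v => st T x ^+ 2 * ut T x * (ri x ^+ 2 * dot3 x v)); split=> [x Ox|v]; first exact: has_diff_st.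
  by do ?apply: genM => //; exact: genX.
- by eexists; split=> [x Ox|v]; [exact: has_diff_kt|exact: GkD].
- eexists; split=> [x Ox|v].
    by apply: has_diffV; [exact: kt_neq0|exact: has_diff_kt].
  apply: genM; last exact: GkD.
  apply: genN; rewrite (_ : (fun x => _) = fun x => (kt T x)^-1 ^+ 2).
    exact: genX.
  by apply/funext => x; rewrite exprVn.
- exists (fun x v => sin (Kf (st T x)) * kt T x * ut T x * (ri x ^+ 2 * dot3 x v)); split=> [x Ox|v]; first exact: has_diff_cost.
  by apply: genM (Gr v); apply: genM => //; exact: genM.
- exists (fun x v => - (cos (Kf (st T x)) * kt T x * ut T x * (ri x ^+ 2 * dot3 x v))); split=> [x Ox|v]; first exact: has_diff_sint.
  by apply: genN; apply: genM (Gr v); apply: genM => //; exact: genM.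
Qed.
End space.

(** * The spiral map and its Laplacian *)

Section map.
Context {R : realType}.
Implicit Types (x y v : R3 R) (T t r : R).

Lemma sum_ord3 (V : nmodType) (f : 'I_3 -> V) :
  \sum_(i < 3) f i = f 0 + (f 1 + f (inord 2)).
Proof.
rewrite !big_ord_recl big_ord0 addr0.
by do 2?congr (f _ + _); try congr f; apply/val_inj; rewrite /= ?inordK.
Qed.

Lemma e3_0 : e3 R 0 = (1, 0, 0). Proof. by []. Qed.
Lemma e3_1 : e3 R 1 = (0, 1, 0). Proof. by []. Qed.
Lemma e3_2 : e3 R (inord 2) = (0, 0, 1). Proof. by rewrite /e3 inordK. Qed.

Lemma laplacianE d (F : R3 R -> 'rV[R]_d) (U : set (R3 R)) L x j : open U -> U x ->
  (forall y, U y -> has_diff F y (L y)) ->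
  (forall i k, differentiable (fun y => L y (e3 R i) 0 k) x) ->
  laplacian F x 0 j = \sum_(i < 3) 'D_(e3 R i) (fun y => L y (e3 R i) 0 j) x.
Proof.
move=> oU Ux FL dL; rewrite /laplacian summxE; apply: eq_bigr => i _.
have e : \near x, 'D_(e3 R i) F x = L x (e3 R i).
  by near=> y; case: (FL y) => //; near: y; exact: open_nbhs_nbhs.
rewrite (near_eq_derive _ e) derive_coord//.
by apply: differentiable_rV => k; exact: dL.
Unshelve. all: by end_near. Qed.

(** The derivative of ln |x| in the direction [v]. With r = |x|, a radial g has derivative (r d/dr
    g) * [rad]. *)
Definition rad x v : R := ri x ^+ 2 * dot3 x v.

Lemma has_diff_rad x w : x != 0 -> has_diff (fun x => rad x w) x
  (fun v => ri x ^+ 2 * dot3 v w - 2 * ri x ^+ 4 * dot3 x v * dot3 x w).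
Proof.
move=> x0; apply: has_diff_ext (has_diffM (has_diffX 2 (has_diff_ri x0)) (has_diff_dot3 x w)) _ => v.
by rewrite /=; ring.
Qed.

(** In dimension three r^2 times the Laplacian of a radial g is (r d/dr)^2 g + (r d/dr) g; here [g1]
    is r d/dr g and [g2] is r d/dr g1. *)
Lemma lap_radial x (g1 : R3 R -> R) g2 : x != 0 ->
  has_diff g1 x (fun v => g2 * rad x v) ->
  (forall i, differentiable (fun y => g1 y * rad y (e3 R i)) x) /\
  \sum_(i < 3) 'D_(e3 R i) (fun y => g1 y * rad y (e3 R i)) x =
    ri x ^+ 2 * (g2 + g1 x).
Proof.
move=> x0 hg; have d w := has_diffM hg (has_diff_rad w x0).
split=> [i|]; first by case: (d (e3 R i)).
have -> : ri x ^+ 2 * (g2 + g1 x) =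
   g2 * (ri x ^+ 2 * (ri x ^+ 2 * dot3 x x)) + g1 x * (3 * ri x ^+ 2 - 2 * (ri x ^+ 2 * (ri x ^+ 2 * dot3 x x))).
  by rewrite ri_dot3//; ring.
rewrite sum_ord3; have [_ ->] := d (e3 R 0); have [_ ->] := d (e3 R 1).
have [_ ->] := d (e3 R (inord 2)).
rewrite e3_2 e3_1 e3_0 /rad /dot3 /=; ring.
Qed.

Definition domega x w v : R := ri x * dot3 v w - ri x ^+ 3 * dot3 x w * dot3 x v.

Lemma has_diff_omega x w : x != 0 -> has_diff (fun x => dot3 x w * ri x) x (domega x w).
Proof.
move=> x0; apply: has_diff_ext (has_diffM (has_diff_dot3 x w) (has_diff_ri x0)) _ => v.
by rewrite /domega; ring.
Qed.

Lemma has_diff_domega x w z : x != 0 -> has_diff (fun x => domega x w z) x (fun v =>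
  - ri x ^+ 3 * dot3 x v * dot3 z w + 3 * ri x ^+ 5 * dot3 x v * dot3 x w * dot3 x z
  - ri x ^+ 3 * dot3 v w * dot3 x z - ri x ^+ 3 * dot3 x w * dot3 v z).
Proof.
move=> x0; apply: has_diff_ext (has_diffD (has_diffM (has_diff_ri x0) (has_diff_cst (dot3 z w) x))
  (has_diffN (has_diffM (has_diffM (has_diffX 3 (has_diff_ri x0)) (has_diff_dot3 x w)) (has_diff_dot3 x z)))) _ => v.
by rewrite /=; ring.
Qed.

(** As for radial functions, with the additional term - 2 h: linear functions restricted to the unit
    sphere are eigenfunctions of its Laplacian with eigenvalue - 2. *)
Lemma lap_omega x w (h h1 : R3 R -> R) h2 : x != 0 ->
  has_diff h x (fun v => h1 x * rad x v) ->
  has_diff h1 x (fun v => h2 * rad x v) ->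
  (forall i, differentiable (fun y => h1 y * rad y (e3 R i) * (dot3 y w * ri y) + h y * domega y w (e3 R i)) x) /\
  \sum_(i < 3) 'D_(e3 R i) (fun y => h1 y * rad y (e3 R i) * (dot3 y w * ri y) + h y * domega y w (e3 R i)) x =
    ri x ^+ 2 * (h2 + h1 x - 2 * h x) * (dot3 x w * ri x).
Proof.
move=> x0 hh hh1.
have d z := has_diffD (has_diffM (has_diffM hh1 (has_diff_rad z x0)) (has_diff_omega w x0))
  (has_diffM hh (has_diff_domega w z x0)).
split=> [i|]; first by case: (d (e3 R i)).
rewrite sum_ord3; have [_ ->] := d (e3 R 0); have [_ ->] := d (e3 R 1).
have [_ ->] := d (e3 R (inord 2)).
(* The relation N = 1 is unknown to [ring], so the sum is first matched with a polynomial in N. *)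
pose N := ri x ^+ 2 * dot3 x x; have N1 : N = 1 by exact: ri_dot3.
transitivity (ri x ^+ 3 * dot3 x w * (h2 * N + h1 x * (3 - 2 * N) + 2 * h1 x * (1 - N)
  + h x * (3 * N - 5))); last by rewrite N1; ring.
by rewrite /N e3_2 e3_1 e3_0 /domega /rad /dot3 /=; ring.
Qed.

(* The value at 0 is an arbitrary point of the target. *)
Definition spiral T x : 'rV[R]_6 := if x == 0 then vec6 1 0 0 0 1 0 else
  vec6 ((1 + ut T x) * (x.1.1 * ri x)) ((1 + ut T x) * (x.1.2 * ri x))
    ((1 + ut T x) * (x.2 * ri x)) (st T x) (cos (Kf (st T x))) (sin (Kf (st T x))).

Definition dspiral T x v : 'rV[R]_6 :=
  let w k := ut T x ^+ 2 * rad x v * (dot3 x (e3 R k) * ri x) + (1 + ut T x) * domega x (e3 R k) v in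
  vec6 (w 0) (w 1) (w (inord 2)) (st T x ^+ 2 * ut T x * rad x v)
    (sin (Kf (st T x)) * kt T x * ut T x * rad x v)
    (- (cos (Kf (st T x)) * kt T x * ut T x) * rad x v).

Lemma dot3_e0 x : dot3 x (e3 R 0) = x.1.1. Proof. by rewrite e3_0 /dot3 /=; ring. Qed.
Lemma dot3_e1 x : dot3 x (e3 R 1) = x.1.2. Proof. by rewrite e3_1 /dot3 /=; ring. Qed.
Lemma dot3_e2 x : dot3 x (e3 R (inord 2)) = x.2. Proof. by rewrite e3_2 /dot3 /=; ring. Qed.

Definition spiral' T x : 'rV[R]_6 := let w k := (1 + ut T x) * (dot3 x (e3 R k) * ri x) in
  vec6 (w 0) (w 1) (w (inord 2)) (st T x) (cos (Kf (st T x))) (sin (Kf (st T x))).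

Lemma spiralE T x : x != 0 -> spiral T x = spiral' T x.
Proof. by move=> x0; rewrite /spiral (negbTE x0) /spiral' dot3_e0 dot3_e1 dot3_e2. Qed.

Lemma has_diff_1u T x : spiral_dom T x -> has_diff (fun x => 1 + ut T x) x (fun v => ut T x ^+ 2 * rad x v).
Proof.
move=> Ox; apply: has_diff_ext (has_diffD (has_diff_cst (1 : R) x) (has_diff_ut Ox)) _ => v.
by rewrite add0r.
Qed.

Lemma has_diff_vec6 (V : normedModType R) (a0 a1 a2 a3 a4 a5 : V -> R) (p : V) (L : V -> 'rV[R]_6) :
  has_diff a0 p (fun w => L w 0 (o6 0)) -> has_diff a1 p (fun w => L w 0 (o6 1)) ->
  has_diff a2 p (fun w => L w 0 (o6 2)) -> has_diff a3 p (fun w => L w 0 (o6 3)) ->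
  has_diff a4 p (fun w => L w 0 (o6 4)) -> has_diff a5 p (fun w => L w 0 (o6 5)) ->
  has_diff (fun q => vec6 (a0 q) (a1 q) (a2 q) (a3 q) (a4 q) (a5 q)) p L.
Proof.
move=> h0 h1 h2 h3 h4 h5; apply: has_diff_rV; apply: forall_ord6.
all: under [X in has_diff X]eq_fun do rewrite vec6E; assumption.
Qed.

Lemma has_diff_spiral' T x : spiral_dom T x -> has_diff (spiral' T) x (dspiral T x).
Proof.
move=> Ox; have x0 : x != 0 by case: Ox.
apply: has_diff_vec6.
1,2,3: apply: has_diff_ext (has_diffM (has_diff_1u Ox) (has_diff_omega _ x0)) _ => v; by rewrite !vec6E.
- by apply: has_diff_ext (has_diff_st Ox) _ => v; rewrite !vec6E.
- by apply: has_diff_ext (has_diff_cost Ox) _ => v; rewrite !vec6E.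
- by apply: has_diff_ext (has_diff_sint Ox) _ => v; rewrite !vec6E mulNr.
Qed.

Lemma near_punctured x : x != 0 -> \near x, x != 0.
Proof. by move=> x0; apply: open_nbhs_nbhs; split=> //; exact: open_punctured. Qed.

Lemma has_diff_spiral T x : spiral_dom T x -> has_diff (spiral T) x (dspiral T x).
Proof.
move=> Ox; apply: has_diff_near (has_diff_spiral' Ox).
near=> y; apply/esym/spiralE; near: y; apply: near_punctured; by case: Ox.
Unshelve. all: by end_near. Qed.

Lemma smooth_spiral T : smooth_on (spiral_dom T) (spiral T).
Proof.
apply: (@smooth_on_eq _ _ _ _ (spiral' T)); first exact: open_spiral_dom.
  by move=> x [x0 _]; rewrite spiralE.
have Gri : gen (base3 T) ri by exact/gen_in/base3_ri.
have Gw k : gen (base3 T) (fun x => (1 + ut T x) * (dot3 x (e3 R k) * ri x)).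
  apply: genM; first by apply: genD; [exact: gen_cst|exact/gen_in/base3_u].
  by apply: genM => //; exact/gen_in/base3_x.
apply: smooth_on_rV => [|j]; first exact: open_spiral_dom.
apply: gen_smooth (@open_spiral_dom _ _) (@base3_closed _ _) _.
move: j; apply: forall_ord6.
all: under [X in gen _ X]eq_fun do rewrite vec6E; try exact: Gw.
- exact/gen_in/base3_s.
- exact/gen_in/base3_cos.
- exact/gen_in/base3_sin.
Qed.

(** With r = |x| one has r d/dr u = u^2, r d/dr s = s^2 u and r d/dr theta = - k u. Then - b is r^2
    times the Laplacian of theta, acting along (- sin, cos), and - k^2 u^2 is the centripetal
    term. *)
Lemma laplacian_spiral T x : spiral_dom T x -> let u := ut T x in let s := st T x in
  let k := kt T x in let c := cos (Kf s) in let d := sin (Kf s) in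
  let b := k * u + k * u ^+ 2 - (u ^+ 2 + 2 * s ^+ 5) * u ^+ 2 * k^-1 in
  laplacian (spiral T) x = ri x ^+ 2 *: vec6
    ((2 * u ^+ 3 + u ^+ 2 - 2 * (1 + u)) * (x.1.1 * ri x))
    ((2 * u ^+ 3 + u ^+ 2 - 2 * (1 + u)) * (x.1.2 * ri x))
    ((2 * u ^+ 3 + u ^+ 2 - 2 * (1 + u)) * (x.2 * ri x))
    (2 * s ^+ 3 * u ^+ 2 + s ^+ 2 * u ^+ 2 + s ^+ 2 * u)
    (- c * k ^+ 2 * u ^+ 2 + d * b) (- d * k ^+ 2 * u ^+ 2 - c * b).
Proof.
move=> Ox u s k c d b; have x0 : x != 0 by case: Ox.
have k0 := kt_neq0 Ox; have s0 := st_neq0 Ox.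
have hw i := @lap_omega x (e3 R i) _ (fun x => ut T x ^+ 2) (2 * u ^+ 3) x0 (has_diff_1u Ox) ltac:(
  by apply: has_diff_ext (has_diffX 2 (has_diff_ut Ox)) _ => v; rewrite /rad /u /=; ring).
have hs := @lap_radial x (fun x => st T x ^+ 2 * ut T x) (2 * s ^+ 3 * u ^+ 2 + s ^+ 2 * u ^+ 2) x0 ltac:(
  by apply: has_diff_ext (has_diffM (has_diffX 2 (has_diff_st Ox)) (has_diff_ut Ox)) _ => v; rewrite /rad /u /s /=; ring).
have hc := @lap_radial x (fun x => sin (Kf (st T x)) * kt T x * ut T x)
  (- c * k ^+ 2 * u ^+ 2 + d * (b - k * u)) x0 ltac:(
  by apply: has_diff_ext (has_diffM (has_diffM (has_diff_sint Ox) (has_diff_kt Ox)) (has_diff_ut Ox)) _ => v;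
     rewrite /rad /b /c /d /u /s /k /=; ring).
have hd := @lap_radial x (fun x => - (cos (Kf (st T x)) * kt T x * ut T x))
  (- d * k ^+ 2 * u ^+ 2 - c * (b - k * u)) x0 ltac:(
  by apply: has_diff_ext (has_diffN (has_diffM (has_diffM (has_diff_cost Ox) (has_diff_kt Ox)) (has_diff_ut Ox))) _ => v;
     rewrite /rad /b /c /d /u /s /k /=; ring).
have Ew v : (forall k, (k = 0 \/ k = 1 \/ k = inord 2) ->
  (fun y => dspiral T y v 0 (o6 k)) = (fun y => ut T y ^+ 2 * rad y v * (dot3 y (e3 R k) * ri y) + (1 + ut T y) * domega y (e3 R k) v)).
  move=> n n3; apply/funext => y.
  by case: n3 => [->|[->|->]]; rewrite /= ?inordK// vec6E.
have Es v : (fun y => dspiral T y v 0 (o6 3)) = (fun y => st T y ^+ 2 * ut T y * rad y v).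
  by apply/funext => y; rewrite vec6E.
have Ec v : (fun y => dspiral T y v 0 (o6 4)) = (fun y => sin (Kf (st T y)) * kt T y * ut T y * rad y v).
  by apply/funext => y; rewrite vec6E.
have Ed v : (fun y => dspiral T y v 0 (o6 5)) = (fun y => - (cos (Kf (st T y)) * kt T y * ut T y) * rad y v).
  by apply/funext => y; rewrite vec6E.
have E0 v := Ew v 0 (or_introl erefl).
have E1 v := Ew v 1 (or_intror (or_introl erefl)).
have E2 v := Ew v (inord 2) (or_intror (or_intror erefl)).
rewrite /= ?inordK// in E2.
apply/rowP => j; rewrite (@laplacianE _ _ (spiral_dom T) (dspiral T)) => //.
- rewrite mxE; move: j; apply: forall_ord6; rewrite vec6E.
  + by under eq_bigr do rewrite E0; have [_ ->] := hw 0; rewrite dot3_e0 -/u; ring.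
  + by under eq_bigr do rewrite E1; have [_ ->] := hw 1; rewrite dot3_e1 -/u; ring.
  + by under eq_bigr do rewrite E2; have [_ ->] := hw (inord 2); rewrite dot3_e2 -/u; ring.
  + by under eq_bigr do rewrite Es; have [_ ->] := hs.
  + under eq_bigr do rewrite Ec; have [_ ->] := hc; congr (_ * _).
    by rewrite -/u -/s -/k -/c -/d; ring.
  + under eq_bigr do rewrite Ed; have [_ ->] := hd; congr (_ * _).
    by rewrite -/u -/s -/k -/c -/d; ring.
- exact: open_spiral_dom.
- by move=> y; exact: has_diff_spiral.
- move=> i; apply: forall_ord6; rewrite ?E0 ?E1 ?E2 ?Es ?Ec ?Ed.
  + by case: (hw 0).
  + by case: (hw 1).
  + by case: (hw (inord 2)).
  + by case: hs.
  + by case: hc.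
  + by case: hd.
Qed.
End map.

(** * The Euler-Lagrange system along the spiral *)

Section harmonic.
Context {R : realType}.
Implicit Types (x y : R3 R) (T t r s sig M : R).

Lemma flat_pos_derive1 (g : R -> R) s L : I2 s -> has_diff g s L ->
  derive1 (flat g) s = uf s * s ^- 2 * g s + uf s * L 1.
Proof.
move=> /andP[s0 _] gL.
have fg : \near s, uf s * g s = flat g s.
  by near=> x; rewrite /flat ifT//; near: x; exact: lt_nbhsr.
have [_ +] := has_diff_near fg (has_diffM (has_diff_uf (lt0r_neq0 s0)) gL).
by rewrite derive1E => ->; rewrite mulr1.
Unshelve. all: by end_near. Qed.

Lemma Af_derive1 s : I2 s -> derive1 Af s = (2 + 2 * uf s) * uf s * s ^- 2.
Proof.
move=> Is; have /andP[s0 _] := Is.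
rewrite (flat_pos_derive1 Is (has_diffD (has_diff_cst (2 : R) s) (has_diff_uf (lt0r_neq0 s0)))) /=.
by ring.
Qed.

(** ([B1f], [B2f]) is orthogonal to (cos, sin), so the derivative of u * [cf] drops out; only the
    rotation of the frame, at speed kapf / s^2, contributes. *)
Lemma Bf_derive1 s : I2 s ->
  cos (Kf s) * derive1 B1f s + sin (Kf s) * derive1 B2f s = uf s * cf s * kapf s * s ^- 2.
Proof.
move=> Is; have /andP[s0 _] := Is.
have [L [cL _]] := gen_gradient (@base1_closed R) (@gen_cf R).
have c1 := cL s Is; have hK := has_diff_Kf Is.
rewrite (flat_pos_derive1 Is (has_diffN (has_diffM c1 (has_diff_sin hK)))).
rewrite (flat_pos_derive1 Is (has_diffM c1 (has_diff_cos hK))) /=.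
set c := cos _; set d := sin _.
have -> : uf s * cf s * kapf s / s ^+ 2 = uf s * cf s * kapf s / s ^+ 2 * (c ^+ 2 + d ^+ 2).
  by rewrite cos2Dsin2 mulr1.
by ring.
Qed.

Lemma psi_derive1_neg s : s < 0 -> derive1 psi s = 0.
Proof.
move=> s0; rewrite derive1E.
have fg : \near s, 0 = psi s.
  by near=> x; rewrite psi0// ltW//; near: x; exact: lt_nbhsl.
by have [_ ->] := has_diff_near fg (has_diff_cst (0 : R) s).
Unshelve. all: by end_near. Qed.

Lemma sphere_ri x : x != 0 ->
  (x.1.1 * ri x) ^+ 2 + (x.1.2 * ri x) ^+ 2 + (x.2 * ri x) ^+ 2 = 1.
Proof. by move=> x0; rewrite -(ri_dot3 x0) /dot3; ring. Qed.

Lemma spiral_vec T x : x != 0 -> spiral T x =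
  vec6 ((1 + ut T x) * (x.1.1 * ri x)) ((1 + ut T x) * (x.1.2 * ri x))
    ((1 + ut T x) * (x.2 * ri x)) (st T x) (cos (Kf (st T x))) (sin (Kf (st T x))).
Proof. by rewrite /spiral => /negbTE ->. Qed.

(** W is the inner product of x/|x| with the first three components of a tangent vector, v3, v4, v5
    are the others, and X = u * [cf] is the slope of Phi across the spiral. The last two hypotheses
    express tangency to the two constraints defining the target. *)
Lemma euler_lagrange_algebra (u s k c d b q X W v3 v4 v5 : R) :
  1 + u != 0 -> s != 0 -> q = 2 + 2 * u - u ^+ 2 - 2 * u ^+ 3 ->
  k ^+ 2 = 2 - u ^+ 2 - s ^+ 4 ->
  b * k = k ^+ 2 * u + k ^+ 2 * u ^+ 2 - (u ^+ 2 + 2 * s ^+ 5) * u ^+ 2 ->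
  X * q = - (2 * (1 + u) * b) ->
  s ^+ 2 * (2 * (1 + u) * W) = ((2 + 2 * u) * u + X * k) * v3
    + s ^+ 2 * (- X * d * v4 + X * c * v5) ->
  c * v4 + d * v5 = 0 ->
  (2 * u ^+ 3 + u ^+ 2 - 2 * (1 + u)) * W +
    (2 * s ^+ 3 * u ^+ 2 + s ^+ 2 * u ^+ 2 + s ^+ 2 * u) * v3 +
    (- c * k ^+ 2 * u ^+ 2 + d * b) * v4 + (- d * k ^+ 2 * u ^+ 2 - c * b) * v5 = 0.
Proof.
move=> u1 s0 qE k2 bk Xq hW cd.
have : 2 * (1 + u) * s ^+ 2 != 0 by rewrite !mulf_neq0 ?expf_neq0// pnatr_eq0.
move=> /mulfI; apply; rewrite mulr0.
move/eqP: qE; rewrite -subr_eq0 => /eqP; set Z0 := (X in X = 0) => z0.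
move/eqP: k2; rewrite -subr_eq0 => /eqP; set Z1 := (X in X = 0) => z1.
move/eqP: bk; rewrite -subr_eq0 => /eqP; set Z2 := (X in X = 0) => z2.
move/eqP: Xq; rewrite -subr_eq0 => /eqP; set Z3 := (X in X = 0) => z3.
move/eqP: hW; rewrite -subr_eq0 => /eqP; set Z4 := (X in X = 0) => z4.
set Z5 := c * v4 + d * v5 in cd.
(* The claim, multiplied by 2 (1 + u) s^2, is a combination of the six relations Z0, ..., Z5 with
   polynomial multipliers. *)
transitivity (- q * Z4 + Z3 * (- k * v3 + s ^+ 2 * (d * v4 - c * v5))
  + 2 * (1 + u) * v3 * Z2 - 2 * (1 + u) * s ^+ 2 * (k ^+ 2 * u ^+ 2) * Z5
  + Z0 * (s ^+ 2 * 2 * (1 + u) * W - (2 + 2 * u) * u * v3)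
  + 2 * (1 + u) * v3 * (u + u ^+ 2) * Z1).
  by rewrite /Z0 /Z1 /Z2 /Z3 /Z4 /Z5; ring.
by rewrite z0 z1 z2 z3 z4 cd; ring.
Qed.

Lemma ut_gt0 T x : spiral_dom T x -> 0 < ut T x.
Proof. by move=> /spiral_dom_facts[_ _ _ _ <-]; exact: uf_gt0. Qed.

Lemma dotvZl d a (p v : 'rV[R]_d) : dotv (a *: p) v = a * dotv p v.
Proof. by rewrite /dotv mulr_sumr; apply: eq_bigr => j _; rewrite mxE mulrA. Qed.

Lemma euler_lagrange_spiral sig M T x : sig <= 16^-1 -> spiral_dom T x -> st T x ^+ 2 < sig ->
  euler_lagrange (Nset sig M) (spiral T) x.
Proof.
move=> sig16 Ox ssig v /(tangent_N sig16); have [x0 _ _ Is us] := spiral_dom_facts Ox.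
rewrite (laplacian_spiral Ox) dotvZl /dotv sum_ord6.
rewrite /dnu2 /dnw2 /dPhi /Phis spiral_vec// !vec6E psi_derive1_neg ?subr_lt0// !mul0r mulr0 subr0.
have -> : derive1 Af (st T x) + cos (Kf (st T x)) * derive1 B1f (st T x) +
    sin (Kf (st T x)) * derive1 B2f (st T x) =
    (2 + 2 * uf (st T x)) * uf (st T x) * st T x ^- 2 +
    uf (st T x) * cf (st T x) * kapf (st T x) * st T x ^- 2.
  by rewrite -addrA Bf_derive1// Af_derive1.
have B1E : B1f (st T x) = uf (st T x) * - (cf (st T x) * sin (Kf (st T x))).
  by rewrite /B1f /flat; case/andP: Is => ->.
have B2E : B2f (st T x) = uf (st T x) * (cf (st T x) * cos (Kf (st T x))).
  by rewrite /B2f /flat; case/andP: Is => ->.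
rewrite B1E B2E us -/(kt T x).
have k2 : kt T x ^+ 2 = 2 - ut T x ^+ 2 - st T x ^+ 4 by rewrite /kt kapf_sqr// us.
have := kt_neq0 Ox; have := st_neq0 Ox.
have : qf (st T x) != 0.
  by case/andP: Is => /qf_ge1 + _; apply: contraTneq => ->; lra.
have : 0 < ut T x by rewrite -us uf_gt0.
rewrite /cf /qf us -/(kt T x).
set c := cos _; set d := sin _; set k := kt T x in k2 *; set u := ut T x in k2 *.
set s := st T x in k2 *.
move=> u0 q0 s0 k0 [hW /eqP]; rewrite mulf_eq0 pnatr_eq0 /= => /eqP cd.
set q := 2 + 2 * u - u ^+ 2 - 2 * u ^+ 3 in q0 hW.
pose b := k * u + k * u ^+ 2 - (u ^+ 2 + 2 * s ^+ 5) * u ^+ 2 * k^-1.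
pose W := x.1.1 * ri x * v 0 (o6 0) + x.1.2 * ri x * v 0 (o6 1) + x.2 * ri x * v 0 (o6 2).
pose X := - (2 * (1 + u) * b) * q^-1.
have := @euler_lagrange_algebra u s k c d b q X W (v 0 (o6 3)) (v 0 (o6 4)) (v 0 (o6 5)).
rewrite -/b => H.
transitivity (ri x ^+ 2 * 0); last by rewrite mulr0.
rewrite -[in RHS]H; first by rewrite /W; ring.
- by rewrite gt_eqF// addr_gt0.
- exact: s0.
- by [].
- exact: k2.
- by rewrite /b; field.
- by rewrite /X divfK.
- transitivity (s ^+ 2 * (2 * ((1 + u) * (x.1.1 * ri x) * v 0 (o6 0) +
    (1 + u) * (x.1.2 * ri x) * v 0 (o6 1) + (1 + u) * (x.2 * ri x) * v 0 (o6 2)))).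
    by rewrite /W; ring.
  by rewrite hW /X /b; field; rewrite q0 k0 s0.
- exact: cd.
Qed.

Lemma spiral_in_N sig M T x : sig <= 16^-1 -> spiral_dom T x -> st T x ^+ 2 < sig -> Nset sig M (spiral T x).
Proof.
move=> sig16 Ox ss; have [x0 _ _ Is us] := spiral_dom_facts Ox.
have s2 := sqr_ge0 (st T x).
rewrite spiral_vec//; split; rewrite /nw2 /nu2 /Phi ?vec6E; first by lra.
  exact: cos2Dsin2.
rewrite psi0; last by rewrite subr_le0 ltW.
rewrite /Af /B1f /B2f /flat; case/andP: (Is) => -> _; rewrite us.
transitivity ((1 + ut T x) ^+ 2 * ((x.1.1 * ri x) ^+ 2 + (x.1.2 * ri x) ^+ 2 + (x.2 * ri x) ^+ 2)).
  by ring.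
by rewrite sphere_ri//; ring.
Qed.
End harmonic.

(** * Weak derivatives across the origin *)

Section space_measure.
Context {R : realType}.
Implicit Types (x y v : R3 R) (U : set (R3 R)).

Local Notation mu := (@lebesgue_measure R).

(** [mR3 R] carries the product sigma-algebra; an open set is a countable union of cubes with
    rational centres and radii, which are measurable boxes. *)
Lemma open_measurable3 U : open U -> @measurable _ (mR3 R) U.
Proof.
move=> oU.
pose box (q : rat * rat * rat * rat) : set (R3 R) :=
  (ball (ratr q.1.1.1 : R) (ratr q.2) `*` ball (ratr q.1.1.2 : R) (ratr q.2)) `*`
   ball (ratr q.1.2 : R) (ratr q.2).
have -> : U = \bigcup_q (if `[< box q `<=` U >] then box q else set0).
  apply/seteqP; split=> [x Ux|x [q _]]; last by case: asboolP => // h /h.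
  have [e /= e0 eU] : exists2 e : R, 0 < e & ball x e `<=` U.
    by have /nbhs_ballP[e e0 h] := open_nbhs_nbhs (conj oU Ux); exists e.
  have [r /[!in_itv]/= /andP[r0 re]] := @rat_in_itvoo R 0 (e / 2) ltac:(lra).
  have near_rat (z : R) : exists q : rat, ball (ratr q : R) (ratr r) z.
    have [q /[!in_itv]/= /andP[q0 q1]] := @rat_in_itvoo R (z - ratr r) (z + ratr r) ltac:(lra).
    by exists q; rewrite /ball/= ltr_norml; lra.
  have [a xa] := near_rat x.1.1; have [b xb] := near_rat x.1.2; have [c xc] := near_rat x.2.
  exists (a, b, c, r) => //; case: asboolP => // -[] y [[ya yb] yc]; apply: eU.
  have tri (p z w : R) : ball p (ratr r) z -> ball p (ratr r) w -> ball z e w.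
    rewrite /ball/= !ltr_norml => /andP[? ?] /andP[? ?]; lra.
  by split; [split|]; apply: tri; eassumption.
apply: countable_bigcupT_measurable => // q; case: asboolP => // _.
by apply: measurableX; [apply: measurableX|]; rewrite ball_itv; exact: measurable_itv.
Qed.

Lemma continuous_measurable3 U (f : R3 R -> R) : open U ->
  (forall x, U x -> {for x, continuous f}) -> @measurable_fun _ _ (mR3 R) R U f.
Proof.
move=> oU cf; apply: (measurability _ (measurable_realfun.RGenOpens.measurableE R)).
move=> _ [_ [a [b ->] <-]]; apply: open_measurable3.
rewrite openE => x [Ux fx]; near=> y; split.
  by near: y; exact: open_nbhs_nbhs.
near: y; apply: (cf x Ux); apply: open_nbhs_nbhs; split => //.
Unshelve. all: by end_near. Qed.

Lemma set0_prod : [set (0 : R3 R)] = ([set 0] `*` [set 0]) `*` [set 0].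
Proof.
apply/seteqP; split=> [x ->//|[[a b] c] [[/= -> ->] ->]]; exact.
Qed.

Lemma measurable_set0_3 : @measurable _ (mR3 R) [set (0 : R3 R)].
Proof. by rewrite set0_prod; do 2?apply: measurableX. Qed.

Lemma leb3_prod (A B C : set R) : measurable A -> measurable B -> measurable C ->
  (leb3 R) ((A `*` B) `*` C) = (mu A * mu B * mu C)%E.
Proof.
move=> mA mB mC; rewrite product_measure1E//; last exact: measurableX.
by congr (_ * _)%E; exact: product_measure1E.
Qed.

Lemma leb3_set0 : leb3 R [set (0 : R3 R)] = 0%E.
Proof. by rewrite set0_prod leb3_prod// lebesgue_measure_set1 !mul0e. Qed.

Lemma open_eball r : open (@eball R r).
Proof.
have -> : @eball R r = [set: R3 R] `&` [set x | 0 < r - enorm x].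
  by apply/seteqP; split=> [x /=|x [_ /=]]; rewrite subr_gt0.
apply: open_pos; first exact: openT.
by move=> x _; apply: cvgB; [exact: cvg_cst|exact: continuous_enorm].
Qed.

Lemma measurable_eball r : @measurable _ (mR3 R) (@eball R r).
Proof. by apply: open_measurable3; exact: open_eball. Qed.

Lemma measurable_punctured r (f : R3 R -> R) :
  (forall x, x != 0 -> eball r x -> {for x, continuous f}) ->
  @measurable_fun _ _ (mR3 R) R (eball r) f.
Proof.
move=> cf; have o0 := @open_punctured R.
have : @measurable_fun _ _ (mR3 R) R ((eball r `&` [set x | x != 0]) `|` [set 0]) f.
  apply/measurable_funU.
  - by apply: open_measurable3; apply: openI => //; exact: open_eball.
  - exact: measurable_set0_3.
  split; last exact: measurable_fun_set1.
  apply: continuous_measurable3; first by apply: openI => //; exact: open_eball.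
  by move=> x [? ?]; exact: cf.
apply: measurable_funS.
  apply: measurableU; last exact: measurable_set0_3.
  by apply: open_measurable3; apply: openI => //; exact: open_eball.
by move=> x rx; have [->|x0] := eqVneq x 0; [right|left].
Qed.

Definition cube (r : R) : set (R3 R) := (`[- r, r] `*` `[- r, r]) `*` `[- r, r].

Lemma measurable_cube r : @measurable _ (mR3 R) (cube r).
Proof. by apply: measurableX; [apply: measurableX|]; exact: measurable_itv. Qed.

Lemma leb3_cube r : 0 <= r -> leb3 R (cube r) = (8 * r ^+ 3)%:E.
Proof.
move=> r0; rewrite leb3_prod; try exact: measurable_itv.
have -> : mu `[- r, r] = (2 * r)%:E.
  rewrite lebesgue_measure_itv /= lte_fin; case: ifPn => [_|].
    by rewrite -EFinD; congr EFin; ring.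
  by rewrite -leNgt => ?; congr EFin; lra.
by rewrite -!EFinM; congr EFin; ring.
Qed.

Lemma coord_le_enorm x : [/\ `|x.1.1| <= enorm x, `|x.1.2| <= enorm x & `|x.2| <= enorm x].
Proof.
by rewrite /enorm; split; rewrite -sqrtr_sqr ler_wsqrtr//;
  have := sqr_ge0 x.1.1; have := sqr_ge0 x.1.2; have := sqr_ge0 x.2; lra.
Qed.

Lemma eball_cube r x : enorm x <= r -> cube r x.
Proof.
move=> xr; have [h1 h2 h3] := coord_le_enorm x.
by split; [split|]; rewrite /= in_itv/= -ler_norml; apply: le_trans xr.
Qed.

Lemma leb3_eball r : 0 <= r -> (leb3 R (eball r) < +oo)%E.
Proof.
move=> r0; apply: (@le_lt_trans _ _ (leb3 R (cube r))); last by rewrite leb3_cube// ltry.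
apply: le_measure; rewrite ?inE; [exact: measurable_eball|exact: measurable_cube|].
by move=> x /ltW; exact: eball_cube.
Qed.

Lemma continuous_ri x : x != 0 -> {for x, continuous (@ri R)}.
Proof. by move=> /has_diff_ri[d _]; exact: differentiable_continuous. Qed.

Lemma dyadic (a : R) : 0 < a -> a < 1 -> exists k, 2 ^- k.+1 <= a /\ a < 2 ^- k.
Proof.
move=> a0 a1.
have [n an] : exists n, 2 ^- n.+1 <= a.
  have /archi_boundP : 0 <= a^-1 by rewrite invr_ge0 ltW.
  set n := Num.bound _ => h; exists n.
  rewrite -[leRHS]invrK lef_pV2 ?posrE ?invr_gt0 ?exprn_gt0//.
  apply/ltW/(lt_le_trans h); rewrite -natrX ler_nat.
  exact: leq_trans (ltnW (ltn_expl n (ltnSn 1))) (leq_pexp2l _ _).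
have [k kP kmin] := ex_minnP (ex_intro (fun n => 2 ^- n.+1 <= a) n an).
exists k; split=> //; case: k kP kmin => [|k] kP kmin; first by rewrite expr0 invr1.
by rewrite ltNge; apply/negP => /kmin; rewrite ltnn.
Qed.

(** On the shell r 2^-(k+1) <= |x| < r 2^-k the integrand is at most 4^(k+1) / r^2. The shell lies
    in a cube of volume 8 (r 2^-k)^3, so the k-th contribution is at most 32 r 2^-k, and these sum
    to 64 r. *)
Lemma integral_ri2 r : 0 < r ->
  (\int[leb3 R]_(x in eball r) ((ri x) ^+ 2)%:E < +oo)%E.
Proof.
move=> r0.
pose g' (k : nat) (x : R3 R) : R := (4 ^+ k.+1 / r ^+ 2) * \1_(cube (r * 2 ^- k)) x.
pose g (k : nat) (x : R3 R) : \bar R := (g' k x)%:E.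
have r2k k : 0 <= r * 2 ^- k by rewrite mulr_ge0 ?ltW// invr_gt0 exprn_gt0.
have c0 k : 0 <= 4 ^+ k.+1 / r ^+ 2 by rewrite divr_ge0 ?exprn_ge0// ltW.
have g0 k x : (0 <= g k x)%E by rewrite lee_fin mulr_ge0.
have mg k : @measurable_fun _ _ (mR3 R) R (eball r) (g' k).
  apply: measurable_funM => //.
  by apply: measurable_indic; exact: measurable_cube.
have gi k : (\int[leb3 R]_(x in eball r) g k x <= (32 * r * 2 ^- k)%:E)%E.
  rewrite /g /g'; under eq_integral do rewrite EFinM.
  rewrite ge0_integralZl//; first last.
  - by rewrite lee_fin.
  - by apply/measurable_EFinP; apply: measurable_indic; exact: measurable_cube.
  - exact: measurable_eball.
  rewrite integral_indic//; [|exact: measurable_eball|exact: measurable_cube].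
  apply: (@le_trans _ _ ((4 ^+ k.+1 / r ^+ 2)%:E * leb3 R (cube (r * 2 ^- k)))%E).
    apply: lee_wpmul2l; first by rewrite lee_fin.
    apply: le_measure; rewrite ?inE//; last exact: measurable_cube.
    by apply: measurableI; [exact: measurable_cube|exact: measurable_eball].
  rewrite leb3_cube// -EFinM lee_fin le_eqVlt; apply/orP; left; apply/eqP.
  have -> : 4 ^+ k.+1 = 4 * (2 ^+ k) ^+ 2 :> R.
    by rewrite exprS; congr (_ * _); rewrite exprAC; congr (_ ^+ _); ring.
  have rn0 : r != 0 by rewrite gt_eqF.
  have k0 : (2 : R) ^+ k != 0 by rewrite expf_neq0.
  by move: (2 ^+ k) k0 => a a0; field; rewrite rn0 a0.
have riE x : eball r x -> x != 0 -> exists k, (((ri x) ^+ 2)%:E <= g k x)%E.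
  move=> xr x0; have e0 : 0 < enorm x by rewrite enorm_gt0.
  have [||k [k1 k2]] := @dyadic (enorm x / r); first by rewrite divr_gt0.
    by rewrite ltr_pdivrMr// mul1r.
  exists k; rewrite lee_fin /g' indicE mem_set; last first.
    by apply: eball_cube; move: k2; rewrite ltr_pdivrMr// mulrC => /ltW.
  rewrite mulr1 (_ : 4 ^+ k.+1 / r ^+ 2 = (2 ^+ k.+1 / r) ^+ 2); last first.
    by rewrite expr_div_n exprAC; congr (_ ^+ _ / _); ring.
  have a0 : 0 < 2 ^+ k.+1 / r by rewrite divr_gt0// exprn_gt0.
  apply: lerXn2r; rewrite ?nnegrE ?ri_ge0 ?(ltW a0)//.
  have -> : 2 ^+ k.+1 / r = (r * 2 ^- k.+1)^-1 by rewrite invfM invrK mulrC.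
  rewrite lef_pV2 ?posrE//; last by rewrite mulr_gt0// invr_gt0 exprn_gt0.
  by move: k1; rewrite ler_pdivlMr// mulrC.
have main : (\int[leb3 R]_(x in eball r) ((ri x) ^+ 2)%:E <=
    \int[leb3 R]_(x in eball r) \sum_(k <oo) g k x)%E.
  apply: ge0_le_integral.
  - exact: measurable_eball.
  - by move=> x _; rewrite lee_fin sqr_ge0.
  - apply/measurable_EFinP; apply: measurable_funX.
    by apply: measurable_punctured => x x0 _; exact: continuous_ri.
  - by apply: ge0_emeasurable_sum => // k _; apply/measurable_EFinP; exact: mg.
  - move=> x xr; have [->|x0] := eqVneq x 0.
      by rewrite /ri enorm0 invr0 expr0n; apply: nneseries_ge0.
    have [k hk] := riE x xr x0; apply: le_trans hk _.
    rewrite (@nneseriesD1 _ _ k xpredT)//.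
    by rewrite leeDl// nneseries_ge0.
apply: le_lt_trans main _; rewrite integral_nneseries//; first last.
- by move=> k; apply/measurable_EFinP; exact: mg.
- exact: measurable_eball.
apply: (@le_lt_trans _ _ (64 * r)%:E); last by rewrite ltry.
apply: lime_le.
  by apply: is_cvg_nneseries => n _ _; exact: integral_ge0.
apply: nearW => n.
apply: (@le_trans _ _ (\sum_(0 <= k < n) (32 * r * 2 ^- k)%:E)%E); first exact: lee_sum.
rewrite sumEFin lee_fin.
have : \sum_(0 <= k < n) (32 * r * 2 ^- k) = 64 * r - 64 * r * 2 ^- n.
  elim: n => [|n IH]; first by rewrite big_geq// expr0 invr1; ring.
  have n0 : (2 : R) ^+ n != 0 by rewrite expf_neq0.
  by rewrite big_nat_recr//= IH exprS; move: (2 ^+ n) n0 => a a0; field.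
move=> ->; rewrite lerBlDr lerDl; apply: mulr_ge0 => //.
by rewrite mulr_ge0// ltW.
Qed.
End space_measure.

(** * Integration by parts across the origin *)

Section by_parts.
Context {R : realType}.
Implicit Types (x y v : R3 R) (U : set (R3 R)).

Local Notation mu := (@lebesgue_measure R).

(* A copy of the product measure, carrying the sigma-finite structure that
   Fubini's theorem on the triple product requires. *)
Definition leb2 : set (measurableTypeR R * measurableTypeR R) -> \bar R :=
  (mu \x mu)%E.

HB.instance Definition _ := Measure.on leb2.

Lemma leb2_sigma_finite : sigma_finite setT leb2.
Proof.
have /sigma_finiteP[F [TF ndF Foo]] := @sigma_finiteT _ _ _ mu.
exists (fun n => F n `*` F n).
  rewrite -setXTT TF predeqE => -[x y]; split.
    move=> [/= [n _ Fnx] [k _ Gky]]; exists (maxn n k) => //; split.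
    - by move: x Fnx; exact/subsetPset/ndF/leq_maxl.
    - by move: y Gky; exact/subsetPset/ndF/leq_maxr.
  by move=> [n _ []/= ? ?]; split; exists n.
move=> k; have [? ?] := Foo k; split; first exact: measurableX.
by rewrite /leb2 product_measure1E// lte_mul_pinfty// ge0_fin_numE.
Qed.

HB.instance Definition _ :=
  Measure_isSigmaFinite.Build _ _ _ leb2 leb2_sigma_finite.

Lemma line_integral0 (r : R) (h H : R -> R) : 0 < r ->
  (forall s : R, is_derive s (1 : R) h (H s)) -> continuous H ->
  (forall s, r <= `|s| -> h s = 0 /\ H s = 0) ->
  (\int[mu]_s (H s)%:E = 0)%E.
Proof.
move=> r0 dh cH out.
have ch : continuous h.
  by move=> s; apply: differentiable_continuous; apply/derivable1_diffP; case: (dh s).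
have rr : - r < r by lra.
transitivity (\int[mu]_(s in `[(- r)%R, r]) (H s)%:E)%E.
  rewrite [RHS]integral_mkcond; apply: eq_integral => s _.
  rewrite patchE; case: ifPn => //; rewrite notin_setE /= in_itv /= -ler_norml => /negP.
  by rewrite -ltNge => /ltW /out[_ ->].
rewrite (@continuous_FTC2 _ H h)//.
- have [-> _] := out r ltac:(by rewrite ger0_norm// ltW).
  have [-> _] := out (- r) ltac:(by rewrite normrN ger0_norm// ltW).
  by rewrite -EFinB subrr.
- exact: continuous_subspaceT.
- split=> [s _||]; first by case: (dh s).
    exact/cvg_at_right_filter/ch.
  exact/cvg_at_left_filter/ch.
- by move=> s _; rewrite derive1E; case: (dh s).
Qed.

Definition line (i : 'I_3) (b c s : R) : R3 R :=
  if i == 0 then ((s, b), c) else if i == 1 then ((b, s), c) else ((b, c), s).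

Lemma line_e3 i b c s h : line i b c (h + s) = h *: e3 R i + line i b c s.
Proof.
have ext (x y : R3 R) : x.1.1 = y.1.1 -> x.1.2 = y.1.2 -> x.2 = y.2 -> x = y.
  by case: x y => [[? ?] ?] [[? ?] ?] /= -> -> ->.
by case: i => [[|[|[|m]]] i3] //; apply: ext; rewrite /line /e3 /= /GRing.scale /=; ring.
Qed.

Lemma continuous_line i b c : continuous (line i b c).
Proof.
have -> : line i b c = fun s => s *: e3 R i + line i b c 0.
  by apply/funext => s; rewrite -line_e3 addr0.
by move=> s; apply: cvgD; [apply: cvgZ; [exact: cvg_id|exact: cvg_cst]|exact: cvg_cst].
Qed.

Lemma is_derive_line i b c s (P : R3 R -> R) dP :
  is_derive (line i b c s) (e3 R i) P dP ->
  is_derive s (1 : R) (fun s => P (line i b c s)) dP.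
Proof.
move=> [dv <-].
have E : (fun h : R => h^-1 *: ((fun s => P (line i b c s)) (h *: (1 : R) + s) - P (line i b c s))) =
   (fun h => h^-1 *: (P (h *: e3 R i + line i b c s) - P (line i b c s))).
  by apply/funext => h; rewrite -line_e3 [h *: 1]mulr1.
by apply: DeriveDef; [rewrite /derivable E|rewrite /derive E].
Qed.

Lemma line_le_enorm i b c s : `|s| <= enorm (line i b c s).
Proof.
by have [] := coord_le_enorm (line i b c s); rewrite /line; case: ifP => _; [|case: ifP].
Qed.

Lemma line_neq0 i b c s : b != 0 \/ c != 0 -> line i b c s != 0.
Proof.
move=> bc; apply/eqP; rewrite /line; case: ifP => _; [|case: ifP => _].
all: by move=> -[e1 e2 e3]; case: bc; rewrite ?e1 ?e2 ?e3 eqxx.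
Qed.

(** A common majorant for bounded functions, for 1/|x| (by [ri_le]) and for 1/|x|^2. *)
Lemma integrable_weight (r B : R) : 0 < r ->
  (leb3 R).-integrable (eball r) (EFin \o (fun x : mR3 R => B * (1 + ri x ^+ 2))).
Proof.
move=> r0; have iri : (leb3 R).-integrable (eball r) (EFin \o (fun x : mR3 R => ri x ^+ 2)).
  apply/integrableP; split.
    apply/measurable_EFinP; apply: measurable_funX.
    by apply: measurable_punctured => x x0 _; exact: continuous_ri.
  under eq_integral do rewrite /= ger0_norm ?sqr_ge0//.
  exact: integral_ri2.
have i1 : (leb3 R).-integrable (eball r) (EFin \o (fun x : mR3 R => 1)).
  apply/integrableP; split; first exact/measurable_EFinP/measurable_cst.
  under eq_integral do rewrite /= normr1.
  by rewrite integral_cst ?mul1e; [apply: leb3_eball; exact: ltW|exact: measurable_eball].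
have := integrableZl (measurable_eball r) B (integrableD (measurable_eball r) i1 iri).
by apply: eq_integrable => [|x _ /=]; [exact: measurable_eball|rewrite -EFinD -EFinM].
Qed.

Lemma ri_le x : ri x <= 1 + ri x ^+ 2.
Proof. by have := sqr_ge0 (ri x - 1); nra. Qed.

Section weak.
Variables (r : R) (i : 'I_3) (f df phi : R3 R -> R) (M : R).
Hypothesis r0 : 0 < r.
Hypothesis dfi : forall x, eball r x -> x != 0 -> is_derive x (e3 R i) f (df x).
Hypothesis cf : forall x, x != 0 -> eball r x -> {for x, continuous f}.
Hypothesis cdf : forall x, x != 0 -> eball r x -> {for x, continuous df}.
Hypothesis fM : forall x, eball r x -> `|f x| <= M.
Hypothesis dfM : forall x, eball r x -> `|df x| <= M * ri x.
Hypothesis tphi : test_function (eball r) phi.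

Let dphi := 'D_(e3 R i) phi.
(** The product f phi and its derivative along [e3 i], extended by 0 outside the ball. As phi
    vanishes near every point outside the ball, the extension stays regular away from the origin
    although nothing is known of f out there. *)
Let P x := if enorm x < r then f x * phi x else 0.
Let H x := if enorm x < r then f x * dphi x + df x * phi x else 0.

Let cphi : continuous phi.
Proof. by case: tphi => sphi _ x; exact: (sphi 0 x I). Qed.

Let diffphi x : differentiable phi x.
Proof. by case: tphi => sphi _; have [+ _] := sphi 1; apply. Qed.

Let cdphi : continuous dphi.
Proof. by case: tphi => sphi _ x; have [_ /(_ (e3 R i))] := sphi 1; exact. Qed.

Let support_near x : ~ eball r x -> \forall y \near x, phi y = 0.
Proof.
case: tphi => _ [K [cK KU] Kphi] xr.
have cl : closed K by exact: compact_closed (@norm_hausdorff _ _) cK.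
have oK : open (~` K) by exact: closed_openC.
by apply: filterS (open_nbhs_nbhs (conj oK (contra_not (@KU x) xr))) => y; exact: Kphi.
Qed.

Let dphi_near x : ~ eball r x -> \forall y \near x, phi y = 0 /\ dphi y = 0.
Proof.
move=> /support_near /nbhs_interior nx; apply: filterS nx => y ny; split.
  exact: nbhs_singleton ny.
rewrite /dphi (near_eq_derive (e3 R i) (g := cst 0)); first exact: derive_cst.
by apply: filterS ny.
Qed.

Let dphi_out x : ~ eball r x -> phi x = 0 /\ dphi x = 0.
Proof. by move=> /dphi_near/nbhs_singleton. Qed.

Let near_ball x : eball r x -> \forall y \near x, enorm y < r.
Proof. by move=> xr; apply: open_nbhs_nbhs; split=> //; exact: open_eball. Qed.

Let derP x : x != 0 -> is_derive x (e3 R i) P (H x).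
Proof.
move=> x0; have [xr|xr] := boolP (enorm x < r).
  have e : \near x, f x * phi x = P x.
    by apply: filterS (near_ball xr) => y yr; rewrite /P yr.
  apply: near_eq_is_derive e _; rewrite /H xr.
  have dp : is_derive x (e3 R i) phi (dphi x) by exact/derivableP/diff_derivable.
  have := @is_deriveM _ _ f phi x (e3 R i) _ _ (dfi xr x0) dp.
  by move/is_derive_eq; apply; rewrite /GRing.scale /= [phi x * _]mulrC.
have e : \near x, 0 = P x.
  by apply: filterS (dphi_near (negP xr)) => y [py _]; rewrite /P py mulr0; case: ifP.
by apply: near_eq_is_derive e _; rewrite /H (negbTE xr); exact: is_derive_cst.
Qed.

Let contH x : x != 0 -> {for x, continuous H}.
Proof.
move=> x0; have [xr|xr] := boolP (enorm x < r).
  have e : \near x, f x * dphi x + df x * phi x = H x.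
    by apply: filterS (near_ball xr) => y yr; rewrite /H yr.
  have : (f y * dphi y + df y * phi y) @[y --> x] --> H x.
    rewrite /H xr; apply: cvgD; apply: cvgM => //.
    - exact: cf.
    - exact: cdphi.
    - exact: cdf.
    - exact: cphi.
  by apply: cvg_trans; exact: near_eq_cvg.
have e : \near x, 0 = H x.
  by apply: filterS (dphi_near (negP xr)) => y [py dy]; rewrite /H py dy !mulr0 addr0; case: ifP.
have : cst 0 @ x --> H x by rewrite /H (negbTE xr); exact: cvg_cst.
by apply: cvg_trans; exact: near_eq_cvg.
Qed.

Let line0 b c : b != 0 \/ c != 0 -> (\int[mu]_s (H (line i b c s))%:E = 0)%E.
Proof.
move=> bc; apply: (@line_integral0 r (fun s => P (line i b c s))) => //.
- by move=> s; apply: is_derive_line; apply: derP; exact: line_neq0.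
- move=> s; apply: (@continuous_comp _ _ _ (line i b c) H); first exact: continuous_line.
  by apply: contH; exact: line_neq0.
- move=> s rs; rewrite /P /H ltNge (le_trans rs)//; exact: line_le_enorm.
Qed.

Let phi_bound : exists2 B, 0 <= B & forall x, `|phi x| <= B /\ `|dphi x| <= B.
Proof.
case: (tphi) => _ [K [cK KU] Kphi].
have bd (g : R3 R -> R) : continuous g -> exists2 B, 0 <= B & forall x, K x -> `|g x| <= B.
  move=> cg; have cgK : compact (g @` K).
    by apply: continuous_compact cK; exact: continuous_subspaceT.
  have [B [_ hB]] := compact_bounded cgK.
  exists (`|B| + 1) => // x Kx; apply: (hB (`|B| + 1)); last by exists x.
  by rewrite (le_lt_trans (ler_norm B))// ltrDl.
have [B1 B10 h1] := bd phi cphi; have [B2 B20 h2] := bd dphi cdphi.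
exists (B1 + B2) => [|x]; first exact: addr_ge0.
have [Kx|Kx] := pselect (K x).
  by split; [apply: le_trans (h1 x Kx) _; rewrite lerDl|apply: le_trans (h2 x Kx) _; rewrite lerDr].
have oK : open (~` K).
  by apply: closed_openC; exact: compact_closed (@norm_hausdorff _ _) cK.
rewrite Kphi// /dphi (near_eq_derive (e3 R i) (g := cst 0)); last first.
  by apply: filterS (open_nbhs_nbhs (conj oK Kx)) => y; exact: Kphi.
by rewrite derive_cst normr0 addr_ge0.
Qed.

Let mf : @measurable_fun _ _ (mR3 R) R (eball r) f.
Proof. by apply: measurable_punctured => x x0 xr; exact: cf. Qed.

Let mdf : @measurable_fun _ _ (mR3 R) R (eball r) df.
Proof. by apply: measurable_punctured => x x0 xr; exact: cdf. Qed.

Let mphi : @measurable_fun _ _ (mR3 R) R (eball r) phi.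
Proof. by apply: measurable_punctured => x _ _; exact: cphi. Qed.

Let mdphi : @measurable_fun _ _ (mR3 R) R (eball r) dphi.
Proof. by apply: measurable_punctured => x _ _; exact: cdphi. Qed.

Let M0 : 0 <= M.
Proof. by apply: le_trans (fM (x := 0) _); rewrite // /eball /= enorm0. Qed.

Let int1 : (leb3 R).-integrable (eball r) (EFin \o (fun x : mR3 R => f x * dphi x)).
Proof.
have [B B0 hB] := phi_bound.
apply: (le_integrable (measurable_eball r) _ _ (integrable_weight (M * B) r0)).
  by apply/measurable_EFinP; exact: measurable_funM.
move=> x xr; rewrite lee_fin normrM.
rewrite [leRHS]ger0_norm; last by rewrite mulr_ge0 ?mulr_ge0// addr_ge0// sqr_ge0.
apply: (@le_trans _ _ (M * B)); first by apply: ler_pM => //; [exact: fM|case: (hB x)].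
by rewrite ler_peMr ?mulr_ge0// lerDl sqr_ge0.
Qed.

Let int2 : (leb3 R).-integrable (eball r) (EFin \o (fun x : mR3 R => df x * phi x)).
Proof.
have [B B0 hB] := phi_bound.
apply: (le_integrable (measurable_eball r) _ _ (integrable_weight (M * B) r0)).
  by apply/measurable_EFinP; exact: measurable_funM.
move=> x xr; rewrite lee_fin normrM.
rewrite [leRHS]ger0_norm; last by rewrite mulr_ge0 ?mulr_ge0// addr_ge0// sqr_ge0.
apply: (@le_trans _ _ (M * ri x * B)).
  by apply: ler_pM => //; [exact: dfM|case: (hB x)].
by rewrite mulrAC ler_wpM2l ?mulr_ge0// ri_le.
Qed.

Let intH : (leb3 R).-integrable setT (EFin \o (H : mR3 R -> R)).
Proof.
have := integrableD (measurable_eball r) int1 int2.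
move/(integrable_mkcond _ (measurable_eball r)).1; apply: eq_integrable => // x _.
rewrite patchE /H; case: ifPn; first by rewrite inE /eball/= => ->; rewrite EFinD.
by rewrite notin_setE /eball/= => /negP/negbTE ->.
Qed.

Let ae_neq0 : {ae mu, forall z : R, z != 0}.
Proof.
exists [set 0]; split => //; first exact: lebesgue_measure_set1.
by move=> z /= /negP; rewrite negbK => /eqP.
Qed.

(** For the first two directions all lines in a plane of height z <> 0 miss the origin. *)
Let plane0 (z : R) : i != inord 2 -> z != 0 ->
  (mu \x mu)%E.-integrable setT (fun p => (H (p, z))%:E) ->
  (\int[(mu \x mu)%E]_p (H (p, z))%:E = 0)%E.
Proof.
move=> i2 z0 ig; have [i0|i0] := eqVneq i 0.
  rewrite -(integral21_prod_meas1 ig) integral0_eq// => y _.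
  rewrite -[RHS](@line0 y z (or_intror z0)); apply: eq_integral => s _.
  by rewrite /line i0 eqxx.
have i1 : i = 1.
  apply/val_inj; move: i2 i0; rewrite -!val_eqE /= inordK//.
  by have := ltn_ord i; case: (nat_of_ord i) => [|[|[|]]].
rewrite -(integral12_prod_meas1 ig) integral0_eq// => x _.
rewrite -[RHS](@line0 x z (or_intror z0)); apply: eq_integral => s _.
by rewrite /line i1.
Qed.

Let intH2 : (leb2 \x mu)%E.-integrable setT (EFin \o (H : mR3 R -> R)).
Proof. exact: intH. Qed.

(** The order of integration is adapted to the direction, so that the lines through the origin form
    a null set: for the third axis they sit over the single point (0, 0) of the plane, for the other
    two axes they lie in the plane z = 0. *)
Let integral0 : (\int[leb3 R]_x (H x)%:E = 0)%E.
Proof.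
rewrite -[LHS]/(\int[(leb2 \x mu)%E]_x ((EFin \o (H : mR3 R -> R)) x))%E.
have [i2|i2] := eqVneq i (inord 2); last first.
  rewrite -[LHS](integral21_prod_meas1 intH2).
  rewrite (ae_eq_integral (cst 0%E)) ?integral0//; first exact: measurable_fubini_G intH2.
  have Fae := ae_filter_ringOfSetsType mu.
  have := ae_integrable2 intH2; apply: filterS2 (ae_neq0) => z z0 iz _.
  exact: plane0.
rewrite -[LHS](integral12_prod_meas1 intH2).
rewrite (ae_eq_integral (cst 0%E)) ?integral0//; first exact: measurable_fubini_F intH2.
exists ([set 0] `*` [set 0]); split.
- exact: measurableX.
- apply: (eq_trans (product_measure1E mu mu _ _)) => //.
  have h0 : mu [set 0] = 0%E by exact: lebesgue_measure_set1.
  by rewrite -[LHS]/(mu [set 0%R] * mu [set 0%R])%E h0 mul0e.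
- move=> [b c] /= h; apply: contrapT => bc; apply: h => _.
  rewrite -[RHS](@line0 b c).
    by apply: eq_integral => s _; rewrite /line i2 -!val_eqE /= inordK.
  have [b0|] := eqVneq b 0; last by left.
  by right; apply/eqP => c0; apply: bc; rewrite /= b0 c0.
Qed.

(* All lines parallel to [e3 R i] but one avoid the origin, so that Fubini's
   theorem reduces the integration by parts to dimension one. *)
Lemma weak_derivative : \int[leb3 R]_(x in eball r) (f x * dphi x) =
  - \int[leb3 R]_(x in eball r) (df x * phi x).
Proof.
apply/eqP; rewrite -addr_eq0 -RintegralD//; last exact: measurable_eball.
rewrite /Rintegral integral_mkcond.
have -> : ((fun x : mR3 R => (f x * dphi x + df x * phi x)%:E) \_ (eball r) =
    fun x : mR3 R => (H x)%:E).
  apply/funext => x; rewrite patchE /H.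
  case: ifPn; first by rewrite inE /eball/= => ->.
  by rewrite notin_setE /eball/= => /negP/negbTE ->.
by rewrite integral0.
Qed.
End weak.
End by_parts.

(** * Sobolev membership and weak convergence from pointwise bounds *)

Section sobolev.
Context {R : realType}.
Implicit Types (x y v : R3 R) (r M : R).

Local Notation mu := (@lebesgue_measure R).

Lemma integrable_bounded_by r B (g : R3 R -> R) : 0 < r -> 0 <= B ->
  @measurable_fun _ _ (mR3 R) R (eball r) g ->
  (forall x, eball r x -> `|g x| <= B * (1 + ri x ^+ 2)) ->
  (leb3 R).-integrable (eball r) (EFin \o (g : mR3 R -> R)).
Proof.
move=> r0 B0 mg gB.
apply: (le_integrable (measurable_eball r) _ _ (integrable_weight B r0)).
  exact/measurable_EFinP.
move=> x xr; rewrite lee_fin [leRHS]ger0_norm; first exact: gB.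
by rewrite mulr_ge0// addr_ge0// sqr_ge0.
Qed.

Lemma integral_lty_bounded_by r B (g : R3 R -> R) : 0 < r -> 0 <= B ->
  @measurable_fun _ _ (mR3 R) R (eball r) g ->
  (forall x, eball r x -> 0 <= g x <= B * (1 + ri x ^+ 2)) ->
  (\int[leb3 R]_(x in eball r) (g x)%:E < +oo)%E.
Proof.
move=> r0 B0 mg gB.
have /integrableP[_] : (leb3 R).-integrable (eball r) (EFin \o (g : mR3 R -> R)).
  apply: (@integrable_bounded_by r B) => // x xr; have /andP[g0 gle] := gB x xr.
  by rewrite ger0_norm.
apply: le_lt_trans; rewrite le_eqVlt; apply/orP; left; apply/eqP.
apply: eq_integral => x /[!inE] xr; have /andP[g0 _] := gB x xr.
by rewrite /= ger0_norm.
Qed.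

Lemma measurable_sum_sqr d (I : finType) r (F : I -> R3 R -> 'rV[R]_d) :
  (forall i j, @measurable_fun _ _ (mR3 R) R (eball r) (fun x => F i x 0 j)) ->
  @measurable_fun _ _ (mR3 R) R (eball r) (fun x => \sum_i dotv (F i x) (F i x)).
Proof.
move=> mF; apply: measurable_sum => i; apply: measurable_sum => j.
by apply: measurable_funM.
Qed.

Lemma dotv_ge0 d (v : 'rV[R]_d) : 0 <= dotv v v.
Proof. by apply: sumr_ge0 => j _; rewrite -expr2 sqr_ge0. Qed.

Lemma dotv_le d (v : 'rV[R]_d) B : (forall j, `|v 0 j| <= B) -> dotv v v <= d%:R * B ^+ 2.
Proof.
move=> vB; rewrite /dotv.
apply: (@le_trans _ _ (\sum_(j < d) B ^+ 2)).
  apply: ler_sum => j _; rewrite -expr2 -real_normK ?num_real//.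
  by rewrite lerXn2r ?nnegrE// (le_trans _ (vB j)).
by rewrite sumr_const card_ord mulr_natl.
Qed.

(** The gradient bound M / |x| is square integrable near 0 in dimension three, and [weak_derivative]
    shows that the origin carries no singular part of the distributional derivative. *)
Lemma W12_punctured d r (F : R3 R -> 'rV[R]_d) (DFv : 'I_3 -> R3 R -> 'rV[R]_d) M :
  0 < r -> 0 <= M ->
  (forall i j x, eball r x -> x != 0 ->
     is_derive x (e3 R i) (fun x => F x 0 j) (DFv i x 0 j)) ->
  (forall j x, x != 0 -> eball r x -> {for x, continuous (fun x => F x 0 j)}) ->
  (forall i j x, x != 0 -> eball r x -> {for x, continuous (fun x => DFv i x 0 j)}) ->
  (forall j x, eball r x -> `|F x 0 j| <= M) ->
  (forall i j x, eball r x -> `|DFv i x 0 j| <= M * ri x) ->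
  W12 (eball r) F DFv.
Proof.
move=> r0 M0 dF cF cDF FM DFM.
have mF : vmeasurable (eball r) F.
  by move=> j; apply: measurable_punctured => x x0 xr; exact: cF.
have mDF i : vmeasurable (eball r) (DFv i).
  by move=> j; apply: measurable_punctured => x x0 xr; exact: cDF.
split=> //.
- have mFF : @measurable_fun _ _ (mR3 R) R (eball r) (fun x => dotv (F x) (F x)).
    by apply: measurable_sum => j; apply: measurable_funM; exact: mF.
  apply: (@integral_lty_bounded_by r (d%:R * M ^+ 2)) => //; first by rewrite mulr_ge0// sqr_ge0.
  move=> x xr; rewrite dotv_ge0 /=.
  apply: le_trans (dotv_le _) _ => [j|]; first exact: FM.
  by rewrite ler_peMr ?mulr_ge0 ?sqr_ge0// lerDl sqr_ge0.
- apply: (@integral_lty_bounded_by r (3 * (d%:R * M ^+ 2))) => //.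
  + by rewrite !mulr_ge0// sqr_ge0.
  + exact: measurable_sum_sqr.
  + move=> x xr; apply/andP; split; first by apply: sumr_ge0 => i _; exact: dotv_ge0.
    apply: (@le_trans _ _ (\sum_(i < 3) (d%:R * (M * ri x) ^+ 2))).
      by apply: ler_sum => i _; apply: dotv_le => j; exact: DFM.
    rewrite sumr_const card_ord -[_ *+ 3]mulr_natl exprMn -!mulrA.
    by rewrite !ler_wpM2l ?sqr_ge0// lerDr.
- move=> phi i j tphi; apply: (@weak_derivative _ r i (fun x => F x 0 j) (fun x => DFv i x 0 j) phi M) => //.
  + by move=> x x0 xr; exact: cF.
  + by move=> x x0 xr; exact: cDF.
  + by move=> x xr; exact: FM.
  + by move=> x xr; exact: DFM.
Qed.

Lemma integrable_L2 r (h : R3 R -> R) : L2 (eball r) h ->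
  (leb3 R).-integrable (eball r) (EFin \o (fun x : mR3 R => h x ^+ 2)).
Proof.
move=> [mh hoo]; apply/integrableP; split.
  by apply/measurable_EFinP; exact: measurable_funX.
apply: le_lt_trans hoo; rewrite le_eqVlt; apply/orP; left; apply/eqP.
by apply: eq_integral => x _; rewrite /= ger0_norm ?sqr_ge0.
Qed.

(** Young's inequality turns the bound M (1 + 1/|x|) |h| into the integrable majorant M (2 (1 +
    1/|x|^2) + h^2). *)
Lemma dominated_cvg_L2 r M (g_ : nat -> R3 R -> R) (g h : R3 R -> R) :
  0 < r -> 0 <= M ->
  (forall n, @measurable_fun _ _ (mR3 R) R (eball r) (g_ n)) ->
  @measurable_fun _ _ (mR3 R) R (eball r) g ->
  (forall n x, eball r x -> `|g_ n x| <= M * (1 + ri x)) ->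
  (forall x, eball r x -> x != 0 -> g_ n x @[n --> \oo] --> g x) ->
  L2 (eball r) h ->
  \int[leb3 R]_(x in eball r) (g_ n x * h x) @[n --> \oo] -->
    \int[leb3 R]_(x in eball r) (g x * h x).
Proof.
move=> r0 M0 mg_ mg gM gg Lh; have [mh _] := Lh; have mE := measurable_eball r.
have iG : (leb3 R).-integrable (eball r)
    (EFin \o (fun x : mR3 R => M * (2 * (1 + ri x ^+ 2) + h x ^+ 2))).
  have := integrableZl mE M (integrableD mE (integrable_weight 2 r0) (integrable_L2 Lh)).
  by apply: eq_integrable => // x _ /=; rewrite -EFinD -EFinM.
have [||||i1 _ i2] := @dominated_convergence _ (mR3 R) R (leb3 R) (eball r) mE
   (fun n x => (g_ n x * h x)%:E) (fun x => (g x * h x)%:E) _ _ _ _ iG.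
- by move=> n; apply/measurable_EFinP; exact: measurable_funM.
- by apply/measurable_EFinP; exact: measurable_funM.
- exists [set 0]; split; [exact: measurable_set0_3|exact: leb3_set0|].
  move=> x /= nx; apply: contrapT => x0; apply: nx => xr.
  apply/fine_cvgP; split; first by near=> n.
  by apply: cvgM; [apply: gg => //; exact/eqP|exact: cvg_cst].
- apply: aeW => x n xr; rewrite /= lee_fin normrM.
  apply: (@le_trans _ _ (M * (1 + ri x) * `|h x|)).
    by rewrite ler_wpM2r//; exact: gM.
  rewrite -mulrA ler_wpM2l//.
  have := ri_ge0 x; have := normr_ge0 (h x); rewrite -(real_normK (num_real (h x))).
  move: (ri x) `|h x| => a b a0 b0.
  by have := sqr_ge0 (1 + a - b); have := sqr_ge0 (a - 1); nra.
have fin : (\int[leb3 R]_(x in eball r) (g x * h x)%:E)%E \is a fin_num.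
  exact: integrable_fin_num.
by apply: fine_cvg; rewrite fineK.
Unshelve. all: by end_near. Qed.

(** One constant M bounds both the map and |x| times its derivatives, so that a sequence with these
    data has a common majorant. *)
Definition W12_data d r M (F : R3 R -> 'rV[R]_d) (DFv : 'I_3 -> R3 R -> 'rV[R]_d) : Prop :=
  [/\ forall i j x, eball r x -> x != 0 ->
     is_derive x (e3 R i) (fun x => F x 0 j) (DFv i x 0 j),
  forall j x, x != 0 -> eball r x -> {for x, continuous (fun x => F x 0 j)},
  forall i j x, x != 0 -> eball r x -> {for x, continuous (fun x => DFv i x 0 j)},
  forall j x, eball r x -> `|F x 0 j| <= M &
  forall i j x, eball r x -> `|DFv i x 0 j| <= M * ri x].

(** Dominated convergence, applied to the maps and to their derivatives against each test function
    [h]. The sequences are shifted by [N] because the bounds hold for large indices only. *)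
Lemma weak_cvg_punctured d r M (F_ : nat -> R3 R -> 'rV[R]_d) (DF_ : nat -> 'I_3 -> R3 R -> 'rV[R]_d) F DFv :
  0 < r -> 0 <= M ->
  (\forall n \near \oo, W12_data r M (F_ n) (DF_ n)) -> W12_data r M F DFv ->
  (forall j x, eball r x -> x != 0 -> F_ n x 0 j @[n --> \oo] --> F x 0 j) ->
  (forall i j x, eball r x -> x != 0 -> DF_ n i x 0 j @[n --> \oo] --> DFv i x 0 j) ->
  weak_cvg_W12 (eball r) F_ F.
Proof.
move=> r0 M0 dF_ dF cF cDF.
have toW (G : R3 R -> 'rV[R]_d) DG : W12_data r M G DG -> W12 (eball r) G DG.
  by move=> [h1 h2 h3 h4 h5]; exact: (@W12_punctured d r G DG M).
exists DF_, DFv; split; [by apply: filterS dF_ => n; exact: toW|exact: toW|].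
case: dF_ => N _ dF_; move=> h Lh j.
have mc (G : R3 R -> 'rV[R]_d) DG k : W12_data r M G DG -> @measurable_fun _ _ (mR3 R) R (eball r) (fun x => G x 0 k).
  by move=> [_ h2 _ _ _]; apply: measurable_punctured => x x0 xr; exact: h2.
have mdc (G : R3 R -> 'rV[R]_d) DG i k : W12_data r M G DG -> @measurable_fun _ _ (mR3 R) R (eball r) (fun x => DG i x 0 k).
  by move=> [_ _ h3 _ _]; apply: measurable_punctured => x x0 xr; exact: h3.
have dN n : W12_data r M (F_ (n + N)%N) (DF_ (n + N)%N) by apply: dF_; rewrite /= leq_addl.
split=> [|i]; rewrite -(cvg_shiftn N).
- apply: (dominated_cvg_L2 r0 M0) Lh => [n||n x xr|x xr x0].
  + exact: mc (dN n).
  + exact: mc dF.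
  + have [_ _ _ h4 _] := dN n; apply: le_trans (h4 j x xr) _.
    by rewrite ler_peMr// lerDl ri_ge0.
  + by have := cF j x xr x0; rewrite -(cvg_shiftn N).
- apply: (dominated_cvg_L2 r0 M0) Lh => [n||n x xr|x xr x0].
  + exact: mdc (dN n).
  + exact: mdc dF.
  + have [_ _ _ _ h5] := dN n; apply: le_trans (h5 i j x xr) _.
    by rewrite ler_wpM2l// lerDr.
  + by have := cDF i j x xr x0; rewrite -(cvg_shiftn N).
Qed.
End sobolev.

(** * Uniform bounds for the spiral and for its limits *)

Section data.
Context {R : realType}.
Implicit Types (x y v : R3 R) (T t r l : R).

Lemma is_derive_coord d (V : normedModType R) (F : V -> 'rV[R]_d) (p w : V)
    (L : V -> 'rV[R]_d) j :
  has_diff F p L -> is_derive p w (fun q => F q 0 j) (L w 0 j).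
Proof.
move=> [dF FL]; have dc : differentiable (fun q => F q 0 j) p.
  apply: (@differentiable_comp _ _ _ _ F (fun p : 'rV[R]_d => p 0 j)) => //.
  by case: (has_diff_coord j (F p)).
rewrite -FL derive_coord//.
exact/derivableP/diff_derivable.
Qed.

Lemma continuous_coord_at d (V : topologicalType) (F : V -> 'rV[R]_d) (p : V) j :
  {for p, continuous F} -> {for p, continuous (fun q => F q 0 j)}.
Proof.
move=> cF; apply: (@continuous_comp _ _ _ F (fun p : 'rV[R]_d => p 0 j)) => //.
exact: coord_continuous.
Qed.

Lemma ball_spiral_dom T r x : expR 2 <= T - ln r -> 0 < r -> x != 0 -> eball r x -> spiral_dom T x.
Proof.
move=> Tr r0 x0 xr; split=> //; apply: le_lt_trans Tr _.
by rewrite /rtime ltrD2l ltrN2 ltr_ln// posrE enorm_gt0.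
Qed.

Lemma e3_le i x : `|dot3 x (e3 R i)| <= enorm x.
Proof.
have [h0 h1 h2] := coord_le_enorm x.
have : i = 0 \/ i = 1 \/ i = inord 2.
  case: i => [[|[|[|m]]] i3] //; [left|right; left|right; right]; apply/val_inj => //.
  by rewrite /= inordK.
by case=> [->|[->|->]]; rewrite ?dot3_e0 ?dot3_e1 ?dot3_e2.
Qed.

Lemma e3_e3_le i k : `|dot3 (e3 R i) (e3 R k)| <= 1.
Proof.
apply: le_trans (e3_le _ _) _; rewrite /enorm /e3 /=.
by case: i => [[|[|[|m]]] i3] //=; rewrite ?expr1n ?expr0n /= ?addr0 ?add0r sqrtr1.
Qed.

Lemma ri_enorm x : ri x * enorm x <= 1.
Proof.
have [->|x0] := eqVneq x 0; first by rewrite enorm0 mulr0.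
by rewrite /ri mulVf// gt_eqF// enorm_gt0.
Qed.

Lemma rad_le i x : `|rad x (e3 R i)| <= ri x.
Proof.
rewrite /rad normrM ger0_norm ?sqr_ge0// expr2 -mulrA ler_piMr ?ri_ge0//.
apply: le_trans (ri_enorm x); rewrite ler_wpM2l ?ri_ge0//; exact: e3_le.
Qed.

Lemma omega_le k x : `|dot3 x (e3 R k) * ri x| <= 1.
Proof.
rewrite normrM (ger0_norm (ri_ge0 x)) mulrC; apply: le_trans (ri_enorm x).
by rewrite ler_wpM2l ?ri_ge0//; exact: e3_le.
Qed.

Lemma domega_le k i x : `|domega x (e3 R k) (e3 R i)| <= 2 * ri x.
Proof.
rewrite /domega; apply: le_trans (ler_normB _ _) _.
have -> : ri x ^+ 3 * dot3 x (e3 R k) * dot3 x (e3 R i) =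
  (dot3 x (e3 R k) * ri x) * (dot3 x (e3 R i) * ri x) * ri x by ring.
rewrite 3!normrM (ger0_norm (ri_ge0 x)) mulr_natl mulr2n lerD//.
  by rewrite ler_piMr ?ri_ge0//; exact: e3_e3_le.
rewrite ler_piMl ?ri_ge0// -[leRHS]mulr1 ler_pM//; exact: omega_le.
Qed.

Lemma norm_cos_le (a : R) : `|cos a| <= 1.
Proof. by rewrite ler_norml cos_geN1 cos_le1. Qed.

Lemma norm_sin_le (a : R) : `|sin a| <= 1.
Proof. by rewrite ler_norml sin_geN1 sin_le1. Qed.

Lemma ut_lt1 T x : spiral_dom T x -> ut T x < 1.
Proof. by move=> /spiral_dom_facts[_ _ _ /andP[s0 _] <-]; exact: uf_lt1. Qed.

Lemma radial_le T x (c : R) i : spiral_dom T x -> `|c| <= 1 -> `|c * kt T x * ut T x * rad x (e3 R i)| <= 2 * ut T x * ri x.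
Proof.
move=> Ox c1; have u0 := ut_gt0 Ox; rewrite 3!normrM (gtr0_norm u0).
have k2 : `|kt T x| <= 2 by rewrite ger0_norm ?sqrtr_ge0// kapf_le.
apply: ler_pM => //; last exact: rad_le.
  by rewrite !mulr_ge0// ltW.
by rewrite ler_wpM2r ?(ltW u0)// -[leRHS]mul1r ler_pM.
Qed.

Lemma omega_comp_le T x k i : spiral_dom T x ->
  `|ut T x ^+ 2 * rad x (e3 R i) * (dot3 x (e3 R k) * ri x) + (1 + ut T x) * domega x (e3 R k) (e3 R i)| <= 6 * ri x.
Proof.
move=> Ox; have u0 := ut_gt0 Ox; have u1 := ut_lt1 Ox; have r0 := ri_ge0 x.
apply: le_trans (ler_normD _ _) _.
have h1 : `|ut T x ^+ 2 * rad x (e3 R i) * (dot3 x (e3 R k) * ri x)| <= ri x.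
  rewrite 2!normrM -[leRHS]mulr1 ler_pM//; last exact: omega_le.
  rewrite -[leRHS]mul1r ler_pM//; last exact: rad_le.
  by rewrite ger0_norm ?sqr_ge0// expr_le1// ltW.
have h2 : `|(1 + ut T x) * domega x (e3 R k) (e3 R i)| <= 2 * (2 * ri x).
  rewrite normrM ler_pM//; last exact: domega_le.
  by rewrite ger0_norm; lra.
by lra.
Qed.

(** At the origin [ri] is 0, since 0^-1 = 0; the bound M * ri in [W12_data] therefore asks the
    derivative to vanish there. *)
Lemma DF_ri0 T x v : ri x = 0 -> dspiral T x v = 0.
Proof.
move=> r0; apply/rowP; apply: forall_ord6; rewrite vec6E [RHS]mxE /domega /rad r0.
all: by rewrite !expr0n /= ?mul0r ?subrr ?mulr0 ?mul0r ?mulr0 ?addr0.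
Qed.

(** The bound 6 does not depend on T and so serves all blow-ups at once. The largest contribution,
    estimated in [omega_comp_le], is at most 5 / |x|. *)
Lemma W12_data_spiral T r : 0 < r -> expR 2 <= T - ln r ->
  W12_data r 6 (spiral T) (fun i x => dspiral T x (e3 R i)).
Proof.
move=> r0 Tr; have O x := @ball_spiral_dom T r x Tr r0.
split.
- by move=> i j x xr x0; apply: (@is_derive_coord 6 _ (spiral T)); apply: has_diff_spiral; exact: O.
- move=> j x x0 xr; apply: continuous_coord_at; apply: differentiable_continuous.
  by case: (has_diff_spiral (O x x0 xr)).
- move=> i j x x0 xr; apply: continuous_coord_at.
  have c0 : Ck 0 (spiral_dom T) ('D_(e3 R i) (spiral T)) := proj2 (smooth_spiral T 1) _.
  suff c1 : Ck 0 (spiral_dom T) (fun y => dspiral T y (e3 R i)) by apply: c1; exact: O.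
  apply: Ck_eq c0; first exact: open_spiral_dom.
  by move=> y Oy; have [_ ->] := has_diff_spiral Oy.
- move=> j x xr; have [->|x0] := eqVneq x 0.
    rewrite /spiral eqxx; move: j; apply: forall_ord6; rewrite vec6E ?normr0 ?normr1; lra.
  have Ox := O x x0 xr; have [_ _ _ /andP[s0 s1] _] := spiral_dom_facts Ox.
  have u0 := ut_gt0 Ox; have u1 := ut_lt1 Ox.
  have w k : `|(1 + ut T x) * (dot3 x (e3 R k) * ri x)| <= 6.
    rewrite normrM; apply: (@le_trans _ _ (2 * 1)); last by lra.
    by apply: ler_pM => //; [rewrite ger0_norm; lra|exact: omega_le].
  rewrite spiralE//; move: j; apply: forall_ord6; rewrite vec6E //.
  + by rewrite gtr0_norm//; lra.
  + by apply: le_trans (norm_cos_le _) _; lra.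
  + by apply: le_trans (norm_sin_le _) _; lra.
- move=> i j x xr; have [->|x0] := eqVneq x 0.
    have r00 : ri (0 : R3 R) = 0 by rewrite /ri enorm0 invr0.
    by rewrite r00 mulr0 normr_le0 DF_ri0// mxE.
  have Ox := O x x0 xr; have [_ _ _ /andP[s0 s1] _] := spiral_dom_facts Ox.
  have u0 := ut_gt0 Ox; have u1 := ut_lt1 Ox; have ri0 := ri_ge0 x.
  have tri : 2 * ut T x * ri x <= 6 * ri x by rewrite ler_wpM2r//; lra.
  move: j; apply: forall_ord6; rewrite vec6E; try exact: omega_comp_le.
  + rewrite normrM ler_pM//; last exact: rad_le.
    by rewrite ger0_norm; nra.
  + by apply: le_trans tri; apply: radial_le => //; exact: norm_sin_le.
  + by apply: le_trans tri; rewrite mulNr normrN; apply: radial_le => //; exact: norm_cos_le.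
Qed.

(** The value at 0 lies in the target too when (l1, l2) is on the unit circle, as a tangent map
    takes its values there at every point. *)
Definition limit_map l1 l2 x : 'rV[R]_6 := if x == 0 then vec6 1 0 0 0 l1 l2 else
  let w k := dot3 x (e3 R k) * ri x in vec6 (w 0) (w 1) (w (inord 2)) 0 l1 l2.

Definition dlimit_map x v : 'rV[R]_6 :=
  let w k := domega x (e3 R k) v in vec6 (w 0) (w 1) (w (inord 2)) 0 0 0.

Lemma has_diff_limit_map l1 l2 x : x != 0 -> has_diff (limit_map l1 l2) x (dlimit_map x).
Proof.
move=> x0; apply: (@has_diff_near _ _ _ (fun x => let w k := dot3 x (e3 R k) * ri x in vec6 (w 0) (w 1) (w (inord 2)) 0 l1 l2)).
  near=> y; rewrite /limit_map ifN//; near: y; exact: near_punctured.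
have h k := has_diff_omega (e3 R k) x0; have c (a : R) := has_diff_cst a x.
apply: has_diff_vec6.
- by apply: has_diff_ext (h _) _ => v; rewrite vec6E.
- by apply: has_diff_ext (h _) _ => v; rewrite vec6E.
- by apply: has_diff_ext (h _) _ => v; rewrite vec6E.
- by apply: has_diff_ext (c _) _ => v; rewrite vec6E.
- by apply: has_diff_ext (c _) _ => v; rewrite vec6E.
- by apply: has_diff_ext (c _) _ => v; rewrite vec6E.
Unshelve. all: by end_near. Qed.

Lemma W12_data_limit_map r l1 l2 : `|l1| <= 1 -> `|l2| <= 1 ->
  W12_data r 6 (limit_map l1 l2) (fun i x => dlimit_map x (e3 R i)).
Proof.
move=> l11 l21; split.
- by move=> i j x xr x0; apply: (@is_derive_coord 6 _ (limit_map l1 l2)); exact: has_diff_limit_map.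
- move=> j x x0 xr; apply: continuous_coord_at; apply: differentiable_continuous.
  by case: (has_diff_limit_map l1 l2 x0).
- move=> i j x x0 xr; apply: differentiable_continuous.
  have h k := has_diff_domega (e3 R k) (e3 R i) x0.
  have E k (g : R3 R -> R) : (forall y, dlimit_map y (e3 R i) 0 k = g y) ->
      differentiable g x -> differentiable (fun y => dlimit_map y (e3 R i) 0 k) x.
    by move=> Eg dg; rewrite (_ : (fun y => _) = g)//; exact/funext.
  move: j; apply: forall_ord6.
  + by apply: (E _ (fun y => domega y (e3 R 0) (e3 R i))) => [y|]; [rewrite vec6E|case: (h 0)].
  + by apply: (E _ (fun y => domega y (e3 R 1) (e3 R i))) => [y|]; [rewrite vec6E|case: (h 1)].
  + by apply: (E _ (fun y => domega y (e3 R (inord 2)) (e3 R i))) => [y|]; [rewrite vec6E|case: (h (inord 2))].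
  + by apply: (E _ (fun=> 0)) => [y|]; [rewrite vec6E|exact: differentiable_cst].
  + by apply: (E _ (fun=> 0)) => [y|]; [rewrite vec6E|exact: differentiable_cst].
  + by apply: (E _ (fun=> 0)) => [y|]; [rewrite vec6E|exact: differentiable_cst].
- move=> j x xr; have [->|x0] := eqVneq x 0.
    rewrite /limit_map eqxx; move: j; apply: forall_ord6; rewrite vec6E ?normr0 ?normr1; lra.
  have om k : `|dot3 x (e3 R k) * ri x| <= 6 by apply: le_trans (omega_le _ _) _; lra.
  rewrite /limit_map (negbTE x0); move: j; apply: forall_ord6; rewrite vec6E ?normr0//.
  + by apply: le_trans l11 _; lra.
  + by apply: le_trans l21 _; lra.
- move=> i j x xr; have ri0 := ri_ge0 x.
  move: j; apply: forall_ord6; rewrite vec6E ?normr0 ?mulr_ge0//.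
  all: by apply: le_trans (domega_le _ _ _) _; rewrite ler_wpM2r//; lra.
Qed.
End data.

(** * Tangent maps *)

Section convergence.
Context {R : realType}.
Implicit Types (x y v : R3 R) (T t r l : R).

(** The angle of [spiral T] on the unit sphere, where [rtime T] is T. *)
Definition phase_at T : R := phase (ln T).

Lemma phase_lip (a b : R) : 2 < a -> 2 < b -> `|phase a - phase b| <= 2 * `|a - b|.
Proof.
wlog ab : a b / b <= a.
  move=> H a2 b2; have [ba|/ltW ba] := leP b a; first exact: H.
  by rewrite distrC [X in 2 * X]distrC; exact: H.
move=> a2 b2; have /andP[h1 h2] := phase_incr b2 ab.
rewrite (ger0_norm (_ : 0 <= a - b)) ?subr_ge0// ger0_norm//.
by apply: le_trans h1; rewrite mulr_ge0// subr_ge0.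
Qed.

Lemma cvg_bounded_mul0 (a b : nat -> R) M : (forall n, `|a n| <= M) ->
  b n @[n --> \oo] --> 0 -> a n * b n @[n --> \oo] --> 0.
Proof.
move=> aM b0; apply/norm_cvg0P.
apply: (@squeeze_cvgr _ _ _ _ (cst 0) (fun n => M * `|b n|)).
- by near=> n; rewrite normr_ge0 normrM ler_wpM2r.
- exact: cvg_cst.
- by rewrite -(mulr0 M); apply: cvgM; [exact: cvg_cst|exact/norm_cvg0P].
Unshelve. all: by end_near. Qed.

(** The sequence [b] may diverge, so continuity at a limit is no help; the addition formulas write
    each difference as bounded factors times null sequences. *)
Lemma cos_shift (b d : nat -> R) : d n @[n --> \oo] --> 0 ->
  (cos (b n + d n) - cos (b n) @[n --> \oo] --> 0) /\
  (sin (b n + d n) - sin (b n) @[n --> \oo] --> 0).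
Proof.
move=> d0.
have c1 : cos (d n) - 1 @[n --> \oo] --> (0 : R).
  rewrite -(subrr 1); apply: cvgB; last exact: cvg_cst.
  by rewrite -cos0; apply: continuous_cvg => //; exact: continuous_cos.
have s1 : sin (d n) @[n --> \oo] --> (0 : R).
  by rewrite -[X in _ --> X]sin0; apply: continuous_cvg => //; exact: continuous_sin.
have bc n : `|cos (b n)| <= 1 by exact: norm_cos_le.
have bs n : `|sin (b n)| <= 1 by exact: norm_sin_le.
split.
- rewrite (_ : (fun n => _) = fun n => cos (b n) * (cos (d n) - 1) - sin (b n) * sin (d n)); last first.
    by apply/funext => n; rewrite cosD; ring.
  by rewrite -(subrr 0); apply: cvgB; apply: cvg_bounded_mul0 => //.
- rewrite (_ : (fun n => _) = fun n => sin (b n) * (cos (d n) - 1) + cos (b n) * sin (d n)); last first.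
    by apply/funext => n; rewrite sinD; ring.
  by rewrite -(addr0 0); apply: cvgD; apply: cvg_bounded_mul0 => //.
Qed.

Lemma vec6_cvg (a0 a1 a2 a3 a4 a5 : nat -> R) b0 b1 b2 b3 b4 b5 j :
  a0 n @[n --> \oo] --> b0 -> a1 n @[n --> \oo] --> b1 -> a2 n @[n --> \oo] --> b2 ->
  a3 n @[n --> \oo] --> b3 -> a4 n @[n --> \oo] --> b4 -> a5 n @[n --> \oo] --> b5 ->
  vec6 (a0 n) (a1 n) (a2 n) (a3 n) (a4 n) (a5 n) 0 j @[n --> \oo] --> vec6 b0 b1 b2 b3 b4 b5 0 j.
Proof.
move=> h0 h1 h2 h3 h4 h5; move: j.
by apply: forall_ord6; rewrite [X in _ --> X]vec6E; under eq_fun do rewrite vec6E.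
Qed.

Section sequence.
Variable T_ : nat -> R.
Hypothesis Too : T_ n @[n --> \oo] --> +oo.

Lemma rtime_cvg x : rtime (T_ n) x @[n --> \oo] --> +oo.
Proof.
apply/cvgryPge => A; move/cvgryPge : Too => /(_ (A + ln (enorm x))).
by apply: filterS => n; rewrite /rtime lerBrDr.
Qed.

Lemma near_spiral_dom x : x != 0 -> \forall n \near \oo, spiral_dom (T_ n) x.
Proof.
move=> x0; have /cvgryPge/(_ (expR 2 + 1)) := rtime_cvg x.
by apply: filterS => n h; split=> //; apply: lt_le_trans h; rewrite ltrDl.
Qed.

Lemma ut_cvg x : x != 0 -> ut (T_ n) x @[n --> \oo] --> 0.
Proof.
move=> x0; apply/gtr0_cvgV0; last exact: rtime_cvg.
by apply: filterS (near_spiral_dom x0) => n /spiral_dom_facts[].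
Qed.

Lemma st_cvg x : x != 0 -> st (T_ n) x @[n --> \oo] --> 0.
Proof.
move=> x0; apply/gtr0_cvgV0.
  by apply: filterS (near_spiral_dom x0) => n /spiral_dom_facts[].
apply/cvgryPge => A; have /cvgryPge/(_ (expR A)) := rtime_cvg x.
by apply: filterS => n h; rewrite -(expRK A) ler_ln ?posrE ?expR_gt0// (lt_le_trans (expR_gt0 A)).
Qed.

(** The difference is ln (1 - c / T_n) once T_n is large. *)
Lemma ln_shift c : ln (T_ n - c) - ln (T_ n) @[n --> \oo] --> 0.
Proof.
have pos A : \forall n \near \oo, A < T_ n.
  move/cvgryPge : Too => /(_ (A + 1)); apply: filterS => n; apply: lt_le_trans.
  by rewrite ltrDl.
have V0 : (T_ n)^-1 @[n --> \oo] --> 0 by apply/gtr0_cvgV0.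
have h1 : 1 - c * (T_ n)^-1 @[n --> \oo] --> (1 : R).
  rewrite -[X in _ --> X]subr0; apply: cvgB; first exact: cvg_cst.
  by rewrite -(mulr0 c); apply: cvgM => //; exact: cvg_cst.
have h2 : ln (1 - c * (T_ n)^-1) @[n --> \oo] --> (0 : R).
  rewrite -[X in _ --> X]ln1; apply: continuous_cvg => //.
  exact: continuous_ln.
apply: cvg_trans h2; apply: near_eq_cvg; near=> n.
have T0 : 0 < T_ n by near: n; exact: pos.
have Tc : 0 < T_ n - c by rewrite subr_gt0; near: n; exact: pos.
rewrite -ln_div ?posrE//; congr ln; field; by rewrite gt_eqF.
Unshelve. all: by end_near. Qed.

(** Passing from the unit sphere to the sphere through x shifts T_n by ln |x|. This changes ln T_n
    by a null sequence, and the phase is Lipschitz in that variable. *)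
Lemma Kf_shift x : x != 0 ->
  Kf (st (T_ n) x) - phase_at (T_ n) @[n --> \oo] --> 0.
Proof.
move=> x0; apply/norm_cvg0P.
have lnT (S_ : nat -> R) : S_ n @[n --> \oo] --> +oo -> \forall n \near \oo, 2 < ln (S_ n).
  move=> /cvgryPge/(_ (expR 3)); apply: filterS => n h.
  apply: (@lt_le_trans _ _ 3); first by lra.
  by rewrite -(expRK 3) ler_ln ?posrE ?expR_gt0// (lt_le_trans (expR_gt0 3)).
apply: (@squeeze_cvgr _ _ _ _ (cst 0) (fun n => 2 * `|ln (T_ n - ln (enorm x)) - ln (T_ n)|)).
- near=> n; rewrite normr_ge0 /= /Kf /st invrK /phase_at phase_lip//.
    by near: n; apply: lnT; exact: rtime_cvg.
  by near: n; exact: lnT.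
- exact: cvg_cst.
- by rewrite -(mulr0 2); apply: cvgM; [exact: cvg_cst|apply/norm_cvg0P; exact: ln_shift].
Unshelve. all: by end_near. Qed.

Lemma cos_st_shift x : x != 0 ->
  cos (Kf (st (T_ n) x)) - cos (phase_at (T_ n)) @[n --> \oo] --> 0 /\
  sin (Kf (st (T_ n) x)) - sin (phase_at (T_ n)) @[n --> \oo] --> 0.
Proof.
move=> x0; have [] := cos_shift (fun n => phase_at (T_ n)) (Kf_shift x0).
have E n : phase_at (T_ n) + (Kf (st (T_ n) x) - phase_at (T_ n)) = Kf (st (T_ n) x) by rewrite addrC subrK.
by under eq_fun do rewrite E; move=> ?; under eq_fun do rewrite E.
Qed.

Variables l1 l2 : R.
Hypothesis cl1 : cos (phase_at (T_ n)) @[n --> \oo] --> l1.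
Hypothesis sl2 : sin (phase_at (T_ n)) @[n --> \oo] --> l2.

Lemma limit_circle : l1 ^+ 2 + l2 ^+ 2 = 1.
Proof.
have h : cos (phase_at (T_ n)) ^+ 2 + sin (phase_at (T_ n)) ^+ 2 @[n --> \oo] --> l1 ^+ 2 + l2 ^+ 2.
  by rewrite !expr2; apply: cvgD; under eq_fun do rewrite expr2; apply: cvgM.
have h1 : cos (phase_at (T_ n)) ^+ 2 + sin (phase_at (T_ n)) ^+ 2 @[n --> \oo] --> (1 : R).
  by under eq_fun do rewrite cos2Dsin2; exact: cvg_cst.
exact: (cvg_unique _ h h1).
Qed.

Lemma norm_le1_circle : `|l1| <= 1 /\ `|l2| <= 1.
Proof.
have := limit_circle; have := sqr_ge0 l1; have := sqr_ge0 l2 => ? ? ?.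
by rewrite !ler_norml; split; nra.
Qed.

Lemma cvg_sub0 (a b : nat -> R) l : a n - b n @[n --> \oo] --> 0 ->
  b n @[n --> \oo] --> l -> a n @[n --> \oo] --> l.
Proof.
move=> h1 h2; have E : (fun n => (a n - b n) + b n) = a by apply/funext => n; rewrite subrK.
by rewrite -E -[l]add0r; exact: cvgD.
Qed.

Lemma cos_st_cvg x : x != 0 -> cos (Kf (st (T_ n) x)) @[n --> \oo] --> l1.
Proof. by move=> x0; have [h _] := cos_st_shift x0; exact: cvg_sub0 h cl1. Qed.

Lemma sin_st_cvg x : x != 0 -> sin (Kf (st (T_ n) x)) @[n --> \oo] --> l2.
Proof. by move=> x0; have [_ h] := cos_st_shift x0; exact: cvg_sub0 h sl2. Qed.

Lemma spiral_cvg j x : x != 0 -> spiral (T_ n) x 0 j @[n --> \oo] --> limit_map l1 l2 x 0 j.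
Proof.
move=> x0; have hw k : (1 + ut (T_ n) x) * (dot3 x (e3 R k) * ri x) @[n --> \oo] --> dot3 x (e3 R k) * ri x.
  rewrite -[X in _ --> X]mul1r; apply: cvgM; last exact: cvg_cst.
  by rewrite -[X in _ --> X]addr0; apply: cvgD; [exact: cvg_cst|exact: ut_cvg].
rewrite /limit_map (negbTE x0).
under eq_fun do rewrite spiralE//.
apply: vec6_cvg.
- exact: hw.
- exact: hw.
- exact: hw.
- exact: st_cvg.
- exact: cos_st_cvg.
- exact: sin_st_cvg.
Qed.

Lemma dspiral_cvg v j x : x != 0 -> dspiral (T_ n) x v 0 j @[n --> \oo] --> dlimit_map x v 0 j.
Proof.
move=> x0; have u0 := ut_cvg x0; have s0 := st_cvg x0.
have hw k : ut (T_ n) x ^+ 2 * rad x v * (dot3 x (e3 R k) * ri x) + (1 + ut (T_ n) x) * domega x (e3 R k) v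
    @[n --> \oo] --> domega x (e3 R k) v.
  rewrite -[X in _ --> X]add0r; apply: cvgD.
    rewrite -(mul0r (dot3 x (e3 R k) * ri x)); apply: cvgM; last exact: cvg_cst.
    rewrite -(mul0r (rad x v)); apply: cvgM; last exact: cvg_cst.
    by rewrite -(mul0r 0); under eq_fun do rewrite expr2; apply: cvgM.
  rewrite -[X in _ --> X]mul1r; apply: cvgM; last exact: cvg_cst.
  by rewrite -[X in _ --> X]addr0; apply: cvgD; [exact: cvg_cst|exact: u0].
have hr (c : nat -> R) : (forall n, `|c n| <= 1) -> c n * kt (T_ n) x * ut (T_ n) x * rad x v @[n --> \oo] --> 0.
  move=> c1; rewrite -(mul0r (rad x v)); apply: cvgM; last exact: cvg_cst.
  apply: (@cvg_bounded_mul0 _ _ 2) => // n; rewrite normrM -[leRHS]mul1r ler_pM//.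
  by rewrite ger0_norm ?sqrtr_ge0// kapf_le.
apply: vec6_cvg.
- exact: hw.
- exact: hw.
- exact: hw.
- rewrite -(mul0r (rad x v)); apply: cvgM; last exact: cvg_cst.
  rewrite -[X in _ --> X](mulr0 0); apply: cvgM => //.
  by rewrite -(mul0r 0); under eq_fun do rewrite expr2; apply: cvgM.
- by apply: hr => n; exact: norm_sin_le.
- under eq_fun do rewrite -!mulNr.
  by apply: hr => n; rewrite normrN; exact: norm_cos_le.
Qed.

Lemma weak_cvg_spiral r : 0 < r -> weak_cvg_W12 (eball r) (fun n => spiral (T_ n)) (limit_map l1 l2).
Proof.
move=> r0; have [l11 l21] := norm_le1_circle.
apply: (@weak_cvg_punctured _ 6 r 6 _ (fun n i x => dspiral (T_ n) x (e3 R i)) _ (fun i x => dlimit_map x (e3 R i))) => //.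
- move/cvgryPge : Too => /(_ (expR 2 + ln r)); apply: filterS => n h.
  by apply: W12_data_spiral => //; rewrite lerBrDr.
- exact: W12_data_limit_map.
- by move=> j x _ x0; exact: spiral_cvg.
- by move=> i j x _ x0; exact: dspiral_cvg.
Qed.
End sequence.
End convergence.

(** * Scaling, harmonicity and the isolated singularity *)

Section harmonic_map.
Context {R : realType}.
Implicit Types (x y v : R3 R) (T t r l sig M : R).

Lemma riZ t x : 0 < t -> ri (t *: x) = t^-1 * ri x.
Proof. by move=> t0; rewrite /ri enormZ ?ltW// invfM. Qed.

Lemma omegaZ t x (a : R) : 0 < t -> t * a * ri (t *: x) = a * ri x.
Proof. by move=> t0; rewrite riZ//; field; rewrite gt_eqF. Qed.

Lemma scale_neq0 t x : 0 < t -> x != 0 -> t *: x != 0.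
Proof. by move=> t0; rewrite -!enorm_gt0 enormZ ?ltW//; exact: mulr_gt0. Qed.

(** Dilations only translate the parameter T, so every blow-up of a spiral is again a spiral. *)
Lemma spiral_scale T r x : 0 < r -> spiral T (r *: x) = spiral (T - ln r) x.
Proof.
move=> r0; have [->|x0] := eqVneq x 0; first by rewrite scaler0 /spiral eqxx.
have e0 : 0 < enorm x by rewrite enorm_gt0.
have tE : rtime T (r *: x) = rtime (T - ln r) x.
  by rewrite /rtime enormZ ?ltW// lnM ?posrE// opprD addrA.
rewrite (spiral_vec _ x0) (spiral_vec _ (scale_neq0 r0 x0)).
rewrite /ut /st tE.
by rewrite (omegaZ x x.1.1 r0) (omegaZ x x.1.2 r0) (omegaZ x x.2 r0).
Qed.

Lemma limit_map_vec l1 l2 x : x != 0 ->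
  limit_map l1 l2 x = vec6 (x.1.1 * ri x) (x.1.2 * ri x) (x.2 * ri x) 0 l1 l2.
Proof. by move=> /negbTE x0; rewrite /limit_map x0 dot3_e0 dot3_e1 dot3_e2. Qed.

Lemma limit_map_scale l1 l2 t x : 0 < t -> limit_map l1 l2 (t *: x) = limit_map l1 l2 x.
Proof.
move=> t0; have [->|x0] := eqVneq x 0; first by rewrite scaler0.
rewrite (limit_map_vec _ _ x0) (limit_map_vec _ _ (scale_neq0 t0 x0)).
by rewrite (omegaZ x x.1.1 t0) (omegaZ x x.1.2 t0) (omegaZ x x.2 t0).
Qed.

Lemma limit_map_in_N sig M l1 l2 x : 0 <= sig -> l1 ^+ 2 + l2 ^+ 2 = 1 ->
  Nset sig M (limit_map l1 l2 x).
Proof.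
move=> sig0 l12; rewrite /limit_map; case: ifPn => [_|x0].
  split; rewrite /nw2 /nu2 /Phi ?vec6E// ?expr0n ?mulr_ge0//=.
  rewrite psi0 ?sub0r ?oppr_le0//.
  by rewrite /Af /B1f /B2f /flat ltxx expr1n !mulr0 !addr0 subr0.
split; rewrite /nw2 /nu2 /Phi ?vec6E// ?expr0n ?mulr_ge0//=.
rewrite dot3_e0 dot3_e1 dot3_e2 sphere_ri// psi0 ?sub0r ?oppr_le0//.
by rewrite /Af /B1f /B2f /flat ltxx !mulr0 !addr0 subr0.
Qed.

Lemma ball_st_small A sig r x : 0 < A -> A ^- 2 < sig -> 0 < r -> expR A <= r ->
  x != 0 -> eball 1 x -> st r x ^+ 2 < sig.
Proof.
move=> A0 Asig r0 Ar x0 x1; apply: lt_trans Asig.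
have e0 : 0 < enorm x by rewrite enorm_gt0.
have tA : expR A < rtime r x.
  by apply: le_lt_trans Ar _; rewrite /rtime ltrDl oppr_gt0 ln_lt0// e0.
have lA : A < ln (rtime r x).
  by rewrite -{1}(expRK A) ltr_ln ?posrE ?expR_gt0// (lt_trans (expR_gt0 A)).
rewrite /st exprVn ltf_pV2 ?posrE ?exprn_gt0//; last exact: lt_trans lA.
by rewrite ltrXn2r ?nnegrE// ltW// (lt_trans A0).
Qed.

Section base_point.
Variables (sig M T0 : R).
Hypotheses (sig16 : sig <= 16^-1) (sig0 : 0 < sig) (T02 : expR 2 <= T0)
  (sts : forall x, x != 0 -> eball 1 x -> st T0 x ^+ 2 < sig).

Lemma ball_spiral_dom1 x : x != 0 -> eball 1 x -> spiral_dom T0 x.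
Proof. by apply: ball_spiral_dom => //; rewrite ln1 subr0. Qed.

Lemma spiral0_in_N : Nset sig M (spiral T0 0).
Proof.
have -> : spiral T0 0 = limit_map 1 0 0 by rewrite /spiral /limit_map eqxx.
by apply: limit_map_in_N; rewrite ?ltW// expr0n expr1n addr0.
Qed.

Lemma finite_energy_spiral : finite_energy_map (Nset sig M) (spiral T0).
Proof.
split=> [x x1|].
  have [->|x0] := eqVneq x 0; first exact: spiral0_in_N.
  by apply: spiral_in_N => //; [exact: ball_spiral_dom1|exact: sts].
exists (fun i x => dspiral T0 x (e3 R i)).
have [|h1 h2 h3 h4 h5] := @W12_data_spiral _ T0 1 ltr01; first by rewrite ln1 subr0.
exact: (@W12_punctured _ 6 1 _ _ 6).
Qed.

Lemma smooth_spiral_ball (U : set (R3 R)) : (forall x, U x -> x != 0 /\ eball 1 x) ->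
  smooth_on U (spiral T0).
Proof.
by move=> hU k; apply: Ck_sub (smooth_spiral T0 k) => x /hU[]; exact: ball_spiral_dom1.
Qed.

(* Along the first axis the first coordinate of [spiral] tends to 1 on one side and
   to -1 on the other. *)
Lemma spiral_discontinuous c :
  ~ {for 0, continuous (fun x : R3 R => if x == 0 then c else spiral T0 x)}.
Proof.
move=> /(@continuous_coord_at _ 6 _ _ _ (o6 0)).
pose h x : R := (if x == 0 then c else spiral T0 x) 0 (o6 0); move=> ch.
pose e : R3 R := e3 R 0.
have enE t : enorm (t *: e) = `|t|.
  by rewrite /enorm /e /e3 /= /GRing.scale /= !mulr0 mulr1 !expr0n /= !addr0 sqrtr_sqr.
have : {for 0, continuous (fun t : R => h (t *: e))}.
  apply: (@continuous_comp _ _ _ (fun t : R => t *: e) h); first exact: scalel_continuous.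
  by rewrite scale0r.
move=> /cvgrPdist_lt/(_ 1 ltr01)/nbhs_ballP[d /= d0 hd].
pose m : R := Num.min d 1 / 2.
have m0 : 0 < m by rewrite divr_gt0// lt_min d0 ltr01.
have [md m1] : m < d /\ m < 1.
  have [h1 h2] : Num.min d 1 <= d /\ Num.min d 1 <= 1 by rewrite !ge_min !lexx orbT.
  by rewrite /m; split; lra.
have hE t : `|t| < 1 -> t != 0 -> h (t *: e) = (1 + ut T0 (t *: e)) * (t / `|t|).
  move=> t1 t0.
  have te0 : t *: e != 0 by rewrite -enorm_gt0 enE normr_gt0.
  rewrite /h (negbTE te0) spiral_vec// vec6E /ri enE.
  by rewrite /e /e3 /= /GRing.scale /= mulr1.
have hm t : `|t| = m -> `|h 0 - h (t *: e)| < 1.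
  move=> tm; have := hd t; rewrite /ball /= sub0r normrN tm scale0r; exact.
have u0 t : t != 0 -> `|t| < 1 -> 0 < ut T0 (t *: e).
  by move=> t0 t1; apply: ut_gt0; apply: ball_spiral_dom1; rewrite -?enorm_gt0 /eball /= enE ?normr_gt0.
have m0' : m != 0 by rewrite gt_eqF.
have mm : `|m| = m by rewrite gtr0_norm.
have mN : `|- m| = m by rewrite normrN.
have Nm0 : - m != 0 by rewrite oppr_eq0.
(* Since u > 0, [h] is above 1 at m e and below - 1 at - m e, yet both values are at distance less
   than 1 from [h 0]. *)
have := hm _ mm; have := hm _ mN; rewrite !hE ?mm ?mN// mulNr divff// mulrN mulr1.
have := u0 m; have := u0 (- m); rewrite mm mN => /(_ Nm0 m1) + /(_ m0' m1).
by rewrite !ltr_norml; lra.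
Qed.

Lemma harmonic_spiral : harmonic_map (Nset sig M) (spiral T0).
Proof.
split; first exact: finite_energy_spiral.
have D x : (eball 1 `\` [set 0]) x -> x != 0 /\ eball 1 x.
  by move=> [x1 x0]; split=> //; apply/eqP.
exists [set 0]; split=> //.
- by move=> x ->; rewrite /eball /= enorm0.
- move=> x ->; have E : (fun x : R3 R => if x == 0 then spiral T0 0 else spiral T0 x) = spiral T0.
    by apply/funext => y; case: eqP => [->|].
  by have := @spiral_discontinuous (spiral T0 0); rewrite E.
- exact: smooth_spiral_ball.
- move=> x /D[x0 x1]; apply: euler_lagrange_spiral => //; first exact: ball_spiral_dom1.
  exact: sts.
Qed.

Lemma isolated_singularity_spiral : isolated_singularity0 (spiral T0).
Proof.
split; first exact: spiral_discontinuous.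
exists 1 => //; apply: smooth_spiral_ball => x /= /andP[x0 x1].
by rewrite -enorm_gt0.
Qed.
End base_point.
End harmonic_map.

(** * Recovering a limit from its integrals *)

Section weak_limits.
Context {R : realType}.
Implicit Types (x y v : R3 R) (T t r l sig M : R).

Lemma integrable_bounded r M (g : R3 R -> R) : 0 < r ->
  @measurable_fun _ _ (mR3 R) R (eball r) g -> (forall x, eball r x -> `|g x| <= M) ->
  (leb3 R).-integrable (eball r) (EFin \o (g : mR3 R -> R)).
Proof.
move=> r0 mg gM; have M0 : 0 <= M.
  by apply: le_trans (gM 0 _); rewrite ?normr_ge0// /eball /= enorm0.
apply: (@integrable_bounded_by _ r M) => // x xr; apply: le_trans (gM x xr) _.
by rewrite ler_peMr// lerDl sqr_ge0.
Qed.

Lemma L2_bounded r M (g : R3 R -> R) : 0 < r ->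
  @measurable_fun _ _ (mR3 R) R (eball r) g -> (forall x, eball r x -> `|g x| <= M) ->
  L2 (eball r) g.
Proof.
move=> r0 mg gM; split=> //; apply: (@integral_lty_bounded_by _ r (M ^+ 2)) => //.
- exact: sqr_ge0.
- exact: measurable_funX.
move=> x xr; rewrite sqr_ge0 /=; apply: (@le_trans _ _ (M ^+ 2)).
  by rewrite -real_normK ?num_real// lerXn2r ?nnegrE ?normr_ge0 ?gM// (le_trans _ (gM x xr)).
by rewrite ler_peMr ?sqr_ge0// lerDl sqr_ge0.
Qed.

(* Test against [g - g']. *)
Lemma ae_eq_of_integrals r M (g g' : R3 R -> R) : 0 < r ->
  @measurable_fun _ _ (mR3 R) R (eball r) g -> (forall x, eball r x -> `|g x| <= M) ->
  @measurable_fun _ _ (mR3 R) R (eball r) g' -> (forall x, eball r x -> `|g' x| <= M) ->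
  (forall h, L2 (eball r) h ->
    \int[leb3 R]_(x in eball r) (g x * h x) = \int[leb3 R]_(x in eball r) (g' x * h x)) ->
  {ae leb3 R, forall x, eball r x -> g x = g' x}.
Proof.
move=> r0 mg gM mg' gM' gg'.
pose d x : R := g x - g' x.
have md : @measurable_fun _ _ (mR3 R) R (eball r) d by exact: measurable_funB.
have dM x : eball r x -> `|d x| <= M + M.
  by move=> xr; apply: le_trans (ler_normB _ _) _; rewrite lerD ?gM ?gM'.
have Ld := L2_bounded r0 md dM.
have im (k : R3 R -> R) : @measurable_fun _ _ (mR3 R) R (eball r) k -> (forall x, eball r x -> `|k x| <= M) ->
    (leb3 R).-integrable (eball r) (EFin \o (fun x : mR3 R => k x * d x)).
  move=> mk kM; apply: (@integrable_bounded r (M * (M + M)) (fun x => k x * d x)) => //.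
    exact: measurable_funM.
  by move=> x xr; rewrite normrM ler_pM ?kM ?dM.
have mE := @measurable_eball R r.
have := RintegralB mE (im g mg gM) (im g' mg' gM').
rewrite gg'// subrr => I0.
have i2 := integrable_L2 Ld.
have E0 : (\int[leb3 R]_(x in eball r) (d x ^+ 2)%:E)%E = 0%E.
  have fin : (\int[leb3 R]_(x in eball r) (d x ^+ 2)%:E)%E \is a fin_num by exact: integrable_fin_num.
  rewrite -(fineK fin); congr EFin; rewrite -{}I0; apply: eq_Rintegral => x _.
  by rewrite /d; ring.
have : (\int[leb3 R]_(x in eball r) `|(d x ^+ 2)%:E|)%E = 0%E.
  by rewrite -E0; apply: eq_integral => x _; rewrite /= ger0_norm// sqr_ge0.
move/(ae_eq_integral_abs (leb3 R) mE) => h.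
have /h : @measurable_fun _ _ (mR3 R) _ (eball r) (fun x => (d x ^+ 2)%:E).
  by apply/measurable_EFinP; exact: measurable_funX.
apply: filterS => x hx xr; have := hx xr => /= -[] /eqP.
by rewrite sqrf_eq0 subr_eq0 => /eqP.
Qed.

Lemma leb3_eball_gt0 : (0 < leb3 R (eball 1))%E.
Proof.
apply: (@lt_le_trans _ _ (leb3 R (cube 2^-1))).
  by rewrite leb3_cube ?invr_ge0// lte_fin; lra.
apply: le_measure; rewrite ?inE; [exact: measurable_cube|exact: measurable_eball|].
move=> x [[/=]]; rewrite !in_itv /= => /andP[? ?] /andP[? ?] /andP[? ?].
have : enorm x ^+ 2 < 1 by rewrite enorm_sqr /dot3; nra.
by rewrite /eball /= expr_lt1// enorm_ge0.
Qed.
End weak_limits.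

Section tangent_maps.
Context {R : realType}.
Implicit Types (x y v : R3 R) (T t r l : R).
Variables (sig M T0 : R).
Hypotheses (sig16 : sig <= 16^-1) (sig0 : 0 < sig).

Lemma blowup_spiral r y : 0 < r -> spiral T0 (0 + r *: y) = spiral (T0 - ln r) y.
Proof. by move=> r0; rewrite add0r spiral_scale. Qed.

Lemma expR_sub_cvg0 (T_ : nat -> R) : T_ n @[n --> \oo] --> +oo ->
  expR (T0 - T_ n) @[n --> \oo] --> 0.
Proof.
move=> Too; have -> : (fun n => expR (T0 - T_ n)) = (fun n => (expR (T_ n - T0))^-1).
  by apply/funext => n; rewrite -expRN opprB.
apply/gtr0_cvgV0; first by apply: nearW => n; exact: expR_gt0.
apply/cvgryPge => A; move/cvgryPge : Too => /(_ (A + T0)); apply: filterS => n h.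
by apply: le_trans (expR_ge1Dx _); lra.
Qed.

Lemma tangent_map_limit_map (T_ : nat -> R) l1 l2 : T_ n @[n --> \oo] --> +oo ->
  cos (phase_at (T_ n)) @[n --> \oo] --> l1 -> sin (phase_at (T_ n)) @[n --> \oo] --> l2 ->
  tangent_map (Nset sig M) (spiral T0) 0 (limit_map l1 l2).
Proof.
move=> Too c1 s2; split.
- by move=> y; apply: limit_map_in_N; [exact: ltW|exact: limit_circle c1 s2].
- by move=> t y t0; exact: limit_map_scale.
(* With these radii T0 - ln r_n = T_n, so the blow-ups are exactly the maps [spiral (T_ n)]. *)
exists (fun n => expR (T0 - T_ n)); split; first by move=> n; exact: expR_gt0.
  exact: expR_sub_cvg0.
move=> rho rho0; have -> : (fun n y => spiral T0 (0 + expR (T0 - T_ n) *: y)) = fun n => spiral (T_ n).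
  apply/funext => n; apply/funext => y; rewrite blowup_spiral ?expR_gt0// expRK.
  by congr spiral; lra.
exact: weak_cvg_spiral.
Qed.

Lemma blowup_times (r_ : nat -> R) : (forall n, 0 < r_ n) -> r_ n @[n --> \oo] --> 0 ->
  T0 - ln (r_ n) @[n --> \oo] --> +oo.
Proof.
move=> r0 rc; apply/cvgryPge => A.
move/cvgrPdist_lt : rc => /(_ (expR (T0 - A)) (expR_gt0 _)); apply: filterS => n.
rewrite sub0r normrN gtr0_norm// => h.
have : ln (r_ n) < T0 - A by rewrite -(expRK (T0 - A)) ltr_ln ?posrE ?expR_gt0.
lra.
Qed.

(* Applied to the last two components of the blow-ups: weak convergence alone
   forces the phases to converge. *)
Lemma mean_cvg (f_ : nat -> R3 R -> R) (c : nat -> R) (L : R) :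
  (forall n, @measurable_fun _ _ (mR3 R) R (eball 1) (f_ n)) ->
  (forall n x, eball 1 x -> `|f_ n x| <= 6) -> (forall n, `|c n| <= 1) ->
  (forall x, x != 0 -> f_ n x - c n @[n --> \oo] --> 0) ->
  \int[leb3 R]_(x in eball 1) (f_ n x * 1) @[n --> \oo] --> L ->
  c n @[n --> \oo] --> L / fine (leb3 R (eball 1)).
Proof.
move=> mf f6 c1 fc fL; have mE := @measurable_eball R 1.
have m1 (a : R) : @measurable_fun _ _ (mR3 R) R (eball 1) (fun=> a) by exact: measurable_cst.
have L1 : L2 (eball 1) (fun=> (1 : R)).
  by apply: (@L2_bounded _ 1 1) => // x _; rewrite normr1.
have mfc n : @measurable_fun _ _ (mR3 R) R (eball 1) (fun x => f_ n x - c n).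
  by apply: measurable_funB.
have I0 : \int[leb3 R]_(x in eball 1) (0 * (1 : R)) = 0.
  transitivity (\int[leb3 R]_(x in eball 1) (0 : R)); last by rewrite Rintegral_cst// mul0r.
  by apply: eq_Rintegral => x _; rewrite mul0r.
have h : \int[leb3 R]_(x in eball 1) ((f_ n x - c n) * 1) @[n --> \oo] --> 0.
  rewrite -[X in _ --> X]I0.
  apply: (@dominated_cvg_L2 R 1 7 (fun n x => f_ n x - c n) (fun=> 0) (fun=> 1)) => //.
    move=> n x x1; apply: le_trans (ler_normB _ _) _; have := ri_ge0 x.
    by have := f6 n x x1; have := c1 n; lra.
  by move=> x _; exact: fc.
set V := fine _; have V0 : V != 0 by rewrite gt_eqF// fine_gt0// leb3_eball_gt0 leb3_eball.
have E n : c n = (\int[leb3 R]_(x in eball 1) (f_ n x * 1) -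
    \int[leb3 R]_(x in eball 1) ((f_ n x - c n) * 1)) / V.
  apply: (canRL (mulfK V0)); rewrite -Rintegral_cst// -RintegralB//.
  - by apply: eq_Rintegral => x _; ring.
  - apply: (@integrable_bounded _ 1 6 (fun x => f_ n x * 1)) => //.
      by apply: measurable_funM.
    by move=> x x1; rewrite mulr1 f6.
  - apply: (@integrable_bounded _ 1 (6 + 1) (fun x => (f_ n x - c n) * 1)) => //.
      by apply: measurable_funM.
    by move=> x x1; rewrite mulr1; apply: le_trans (ler_normB _ _) _; rewrite lerD ?f6.
rewrite (funext E : c = _) -[L]subr0; apply: cvgM; last exact: cvg_cst.
exact: cvgB.
Qed.
End tangent_maps.

(** * Classification of the tangent maps *)

Section classification.
Context {R : realType}.
Implicit Types (x y v : R3 R) (T t r l : R).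

Lemma circle_angle l1 l2 : l1 ^+ 2 + l2 ^+ 2 = 1 ->
  exists a, cos a = l1 /\ sin a = l2.
Proof.
move=> l12; have s1 := sqr_ge0 l1; have s2 := sqr_ge0 l2.
have l1B : -1 <= l1 <= 1 by apply/andP; split; nra.
have l2E : Num.sqrt (1 - l1 ^+ 2) = `|l2|.
  by rewrite -l12 addrC addKr sqrtr_sqr.
have [l20|l20] := leP 0 l2.
  by exists (acos l1); rewrite acosK ?in_itv// sin_acos// l2E ger0_norm.
exists (- acos l1); rewrite cosN sinN acosK ?in_itv// sin_acos// l2E.
by rewrite ltr0_norm// opprK.
Qed.

(** The last conclusion makes the solution a tend to infinity with b. *)
Lemma phase_onto (b : R) : phase 3 <= b ->
  exists a, [/\ 3 <= a, phase a = b & b - phase 3 <= 2 * (a - 3)].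
Proof.
move=> b3; have l23 : (2 : R) < 3 by lra.
(* As the phase has slope at least 1/2, it has reached b at c; the intermediate value theorem
   applies on [3, c]. *)
pose c := 3 + 2 * (b - phase 3).
have c3 : 3 <= c by rewrite /c; lra.
have /andP[h1 h2] := phase_incr l23 c3.
have bc : b <= phase c by move: h1; rewrite /c; lra.
have [||a] := @IVT R phase 3 c b c3.
- apply: continuous_in_subspaceT => x; rewrite inE/= in_itv/= => /andP[x3 _].
  have x1 : 1 < x by lra.
  have := is_derive_phase x1; move=> [dx _].
  exact/differentiable_continuous/derivable1_diffP.
- by rewrite ge_min b3/= le_max bc orbT.
rewrite in_itv/= => /andP[a3 _] ab; exists a; split=> //.
by have /andP[_] := phase_incr l23 a3; rewrite ab.
Qed.

(** The phase takes the values a + 2 pi (n + k) at arguments s_n tending to infinity, and T_n = exp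
    s_n. *)
Lemma times_of_angle (a : R) : exists T_ : nat -> R,
  [/\ T_ n @[n --> \oo] --> +oo, forall n, cos (phase_at (T_ n)) = cos a &
      forall n, sin (phase_at (T_ n)) = sin a].
Proof.
(* The offset k lifts all values b n to at least phase 3 + n, the range covered by [phase_onto]. *)
pose k := Num.bound `|phase 3 - a|.
have hk : `|phase 3 - a| < k%:R by apply: archi_boundP.
pose b n : R := a + (pi *+ 2) *+ (n + k).
have bn n : phase 3 + n%:R <= b n.
  have := pi_ge2 R; rewrite /b => p2.
  have : (n + k)%:R <= (pi *+ 2) *+ (n + k) :> R.
    by rewrite ler_wMn2r// mulr2n; lra.
  by rewrite natrD; move: hk; rewrite ltr_norml => /andP[_]; lra.
have /choice[s hs] n : exists a, [/\ 3 <= a, phase a = b n & b n - phase 3 <= 2 * (a - 3)].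
  by apply: phase_onto; apply: le_trans (bn n); rewrite lerDl.
exists (fun n => expR (s n)); split=> [|n|n].
- apply/cvgryPge => A; have /cvgryPge/(_ (2 * A)) := @cvgr_idn R.
  apply: filterS => n An; have [_ _ h] := hs n; have := bn n => ?.
  by apply: le_trans (expR_ge1Dx _); lra.
- by have [_ h _] := hs n; rewrite /phase_at expRK h (periodicn (@cosD2pi R)).
- by have [_ h _] := hs n; rewrite /phase_at expRK h (periodicn (@sinD2pi R)).
Qed.

Section target.
Variables (sig M T0 : R).
Hypotheses (sig16 : sig <= 16^-1) (sig0 : 0 < sig).

Lemma tangent_map_angle (a : R) :
  tangent_map (Nset sig M) (spiral T0) 0 (limit_map (cos a) (sin a)).
Proof.
have [T_ [Too c s]] := times_of_angle a.
apply: (tangent_map_limit_map M T0 sig0 Too).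
  by under eq_fun do rewrite c; exact: cvg_cst.
by under eq_fun do rewrite s; exact: cvg_cst.
Qed.

(** A tangent map takes its values in the target, hence is bounded and can enter the test function
    of [ae_eq_of_integrals]. *)
Lemma coord_bounded_N : exists2 B, 0 <= B & forall p, Nset sig M p ->
  forall j, `|p 0 j| <= B.
Proof.
have [B [_ hB]] := bounded_N M sig16.
exists (`|B| + 1); first by rewrite addr_ge0.
move=> p Np j; have : B < `|B| + 1 by rewrite ltr_pwDr// ler_norm.
move=> /hB/(_ p Np); apply: le_trans.
rewrite [leRHS]/Num.Def.normr/= mx_normrE.
by apply: (le_bigmax _ (fun i : 'I_1 * 'I_6 => `|p i.1 i.2|) (0, j)).
Qed.

(** [mean_cvg] extracts the limits of the cosine and sine of the phases from the weak convergence
    alone. The blow-ups then also converge weakly to a known [limit_map], and two weak limits agree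
    almost everywhere. *)
Lemma tangent_map_inv g : tangent_map (Nset sig M) (spiral T0) 0 g ->
  exists a, g = limit_map (cos a) (sin a) %[ae leb3 R].
Proof.
move=> [gN _ [r_ [r0 rc wc]]].
have Too0 := blowup_times T0 r0 rc.
(* Dropping K terms puts every remaining blow-up under the bound of [W12_data_spiral] on the unit
   ball; [mean_cvg] asks for bounds at all indices. *)
have [K _ hK] : \forall n \near \oo, expR 2 <= T0 - ln (r_ n) by move/cvgryPge : Too0; exact.
pose T_ n := T0 - ln (r_ (n + K)%N).
have Too : T_ n @[n --> \oo] --> +oo by move: Too0; rewrite -(cvg_shiftn K).
have mg (rho : R) : 0 < rho -> forall j, @measurable_fun _ _ (mR3 R) R (eball rho) (fun x => g x 0 j).
  by move=> /wc[? [? [_ [h _ _ _ _] _]]].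
have wg (rho : R) h j : 0 < rho -> L2 (eball rho) h ->
   \int[leb3 R]_(x in eball rho) (spiral (T_ n) x 0 j * h x) @[n --> \oo] -->
   \int[leb3 R]_(x in eball rho) (g x 0 j * h x).
  move=> rho0 Lh; have [D1 [D2 [_ _ H]]] := wc rho rho0.
  have [H1 _] := H h Lh j.
  have E n : \int[leb3 R]_(x in eball rho) (spiral (T_ n) x 0 j * h x) =
      \int[leb3 R]_(x in eball rho) (spiral T0 (0 + r_ (n + K)%N *: x) 0 j * h x).
    by apply: eq_Rintegral => x _; rewrite blowup_spiral.
  under eq_fun do rewrite E.
  by move: H1; rewrite -(cvg_shiftn K).
have WF n : W12_data 1 6 (spiral (T_ n)) (fun i x => dspiral (T_ n) x (e3 R i)).
  by apply: W12_data_spiral => //; rewrite ln1 subr0; apply: hK; rewrite /= leq_addl.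
have L1 : L2 (eball 1) (fun=> (1 : R)).
  by apply: (@L2_bounded _ 1 1) => // x _; rewrite normr1.
have mF n j : @measurable_fun _ _ (mR3 R) R (eball 1) (fun x => spiral (T_ n) x 0 j).
  by have [_ h _ _ _] := WF n; apply: measurable_punctured => x x0 xr; exact: h.
have F6 n j x : eball 1 x -> `|spiral (T_ n) x 0 j| <= 6.
  by have [_ _ _ h _] := WF n; exact: h.
have := @mean_cvg R (fun n x => spiral (T_ n) x 0 (o6 4)) (fun n => cos (phase_at (T_ n))) _
  (fun n => mF n (o6 4)) (fun n => @F6 n (o6 4)) (fun n => norm_cos_le _) _ (wg 1 _ (o6 4) ltr01 L1).
have := @mean_cvg R (fun n x => spiral (T_ n) x 0 (o6 5)) (fun n => sin (phase_at (T_ n))) _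
  (fun n => mF n (o6 5)) (fun n => @F6 n (o6 5)) (fun n => norm_sin_le _) _ (wg 1 _ (o6 5) ltr01 L1).
set l2 := _ / _ => h2; set l1 := _ / _ => h1.
have {}h1 : cos (phase_at (T_ n)) @[n --> \oo] --> l1.
  apply: h1 => x x0; have [h _] := cos_st_shift Too x0.
  by under eq_fun do rewrite spiral_vec// vec6E.
have {}h2 : sin (phase_at (T_ n)) @[n --> \oo] --> l2.
  apply: h2 => x x0; have [_ h] := cos_st_shift Too x0.
  by under eq_fun do rewrite spiral_vec// vec6E.
have [a [ca sa]] := circle_angle (limit_circle h1 h2); exists a.
rewrite ca sa; have [l11 l21] := norm_le1_circle h1 h2.
have [B B0 hB] := coord_bounded_N.
have ae (rho : R) j : 0 < rho -> {ae leb3 R, forall x, eball rho x -> g x 0 j = limit_map l1 l2 x 0 j}.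
  move=> rho0; have [_ c2 _ b6 _] := W12_data_limit_map rho l11 l21.
  apply: (@ae_eq_of_integrals _ rho (B + 6)) => //; first exact: mg.
  - by move=> x xr; apply: le_trans (hB _ (gN x) j) _; rewrite lerDl.
  - by apply: measurable_punctured => x x0 xr; exact: c2.
  - by move=> x xr; apply: le_trans (b6 j x xr) _; rewrite lerDr.
  - move=> h Lh; have [? [? [_ _ /(_ h Lh j)[H _]]]] := weak_cvg_spiral Too h1 h2 rho0.
    exact: (cvg_unique _ (wg rho h j rho0 Lh) H).
have Fae := ae_filter_ringOfSetsType (leb3 R).
(* Countably many balls exhaust the space, so the exceptional sets have a null union. *)
have : {ae leb3 R, forall x, forall n : nat, forall j, eball n.+1%:R x -> g x 0 j = limit_map l1 l2 x 0 j}.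
  by apply: ae_foralln => n; apply: filter_forall => j; exact: ae.
apply: filterS => x hx _; apply/rowP => j.
apply: (hx (Num.bound (enorm x)) j); rewrite /eball /=.
apply: lt_trans (archi_boundP (enorm_ge0 x)) _; by rewrite ltr_nat.
Unshelve. all: by end_near. Qed.
End target.
End classification.

(** * The cardinality of the set of tangent maps *)

Section cardinality.
Context {R : realType}.
Variables (sig M T0 : R).
Hypotheses (sig16 : sig <= 16^-1) (sig0 : 0 < sig).

Let tm : set (R3 R -> 'rV[R]_6) := tangent_map (Nset sig M) (spiral T0) 0.

Let cls (g : R3 R -> 'rV[R]_6) : set (R3 R -> 'rV[R]_6) :=
  [set h | tm h /\ h = g %[ae leb3 R]].

(** Two maps that agree almost everywhere agree at some point, and the last two coordinates of a
    [limit_map] are constant. *)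
Lemma limit_map_ae_inj (l1 l2 k1 k2 : R) : limit_map l1 l2 = limit_map k1 k2 %[ae leb3 R] ->
  l1 = k1 /\ l2 = k2.
Proof.
have T0' : (0 < leb3 R [set: R3 R])%E.
  apply: (@lt_le_trans _ _ (leb3 R (eball 1))).
    exact: leb3_eball_gt0.
  by apply: le_measure; rewrite ?inE//; exact: measurable_eball.
have PF := ae_properfilter_algebraOfSetsType T0'.
move=> /filter_ex[x /(_ I) E].
have E4 := congr1 (fun p : 'rV[R]_6 => p 0 (o6 4)) E.
have E5 := congr1 (fun p : 'rV[R]_6 => p 0 (o6 5)) E.
by move: E4 E5; rewrite /limit_map; case: ifP => _; rewrite !vec6E.
Qed.

Lemma tangent_maps_le : (tangent_maps (Nset sig M) (spiral T0) 0 #<= [set: R])%card.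
Proof.
apply: card_le_trans (card_image_le (fun a : R => cls (limit_map (cos a) (sin a))) setT).
apply: subset_card_le => C [g gtm ->].
have [a ga] := tangent_map_inv sig16 gtm.
have Fae := ae_filter_ringOfSetsType (leb3 R).
exists a => //; apply/seteqP; split=> h [htm hg]; split=> //.
- by apply: filterS2 hg ga => x h1 h2 xT; rewrite h1// h2.
- by apply: filterS2 hg ga => x h1 h2 xT; rewrite h1// h2.
Qed.

Lemma tangent_maps_ge : ([set: R] #<= tangent_maps (Nset sig M) (spiral T0) 0)%card.
Proof.
(* The rational parametrization of the circle minus (-1, 0). In contrast to the angle it is
   injective on the whole line, with inverse d / (1 + c). *)
pose c (s : R) := (1 - s ^+ 2) / (1 + s ^+ 2).
pose d (s : R) := (2 * s) / (1 + s ^+ 2).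
have pos (s : R) : 1 + s ^+ 2 != 0 by rewrite gt_eqF// ltr_pwDl// sqr_ge0.
have gtm s : tm (limit_map (c s) (d s)).
  have [|a [<- <-]] := @circle_angle R (c s) (d s); last exact: tangent_map_angle.
  by rewrite /c /d; field.
have inj : {in setT &, injective (fun s => cls (limit_map (c s) (d s)))}.
  move=> s t _ _ E.
  have : cls (limit_map (c s) (d s)) (limit_map (c s) (d s)) by split=> //; exact: aeW.
  rewrite E => -[_ /limit_map_ae_inj[cE dE]].
  have sE (u : R) : u = d u / (1 + c u).
    have := pos u; rewrite /d /c => u0; field.
    by rewrite u0 /= (_ : _ + _ = 2)//; ring.
  by rewrite (sE s) (sE t) cE dE.
rewrite -(card_le_eql (inj_card_eq inj)).
apply: subset_card_le => C [s _ <-]. by exists (limit_map (c s) (d s)); first exact: gtm.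
Qed.

Lemma card_tangent_maps : (tangent_maps (Nset sig M) (spiral T0) 0 #= [set: R])%card.
Proof. exact: Cantor_Bernstein tangent_maps_le tangent_maps_ge. Qed.
End cardinality.

Theorem theorem2 (R : realType) :
  exists (d : nat) (N : set 'rV[R]_d) (f : R * R * R -> 'rV[R]_d),
    [/\ compact N, submanifold 4 N, harmonic_map N f,
        isolated_singularity0 f &
        (tangent_maps N f 0 #= [set: R])%card].
Proof.
have [sig [M adm]] := @exists_admissible R; have [sig0 sig16 _ _] := adm.
(* With T = exp A one has ln t > A on the punctured unit ball, hence s < 1/A. The summand 2 gives
   exp 2 <= T, and A > 1/sig together with A > 1 gives s^2 < sig, where the barrier in Phi is
   off. *)
pose A : R := 2 + sig^-1; have si0 : 0 < sig^-1 by rewrite invr_gt0.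
have A0 : 0 < A by rewrite /A; lra.
have Asig : A ^- 2 < sig.
  by rewrite -[ltRHS]invrK ltf_pV2 ?posrE ?exprn_gt0// /A; nra.
have T02 : expR 2 <= expR A by rewrite ler_expR /A; lra.
have sts x : x != 0 -> eball 1 x -> st (expR A) x ^+ 2 < sig.
  exact: ball_st_small A0 Asig (expR_gt0 A) (lexx _).
exists 6, (Nset sig M), (spiral (expR A)); split.
- exact: compact_N.
- exact: submanifold_N.
- exact: harmonic_spiral.
- exact: isolated_singularity_spiral.
- exact: card_tangent_maps.
Qed.
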